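(* Let $(\theta_0,f_0)\in\Theta\times H$ be such that $\tilde i_{\theta_0,f_0}>0$, with $\theta_0$ an interior point of $\Theta$. Suppose there are constants $D_1,D_2,D_3,D_4$ such that for all $\theta,\theta_0\in\Theta$ and all $f\in H$: (i) $\|K_\theta f\|_{H_2}\le D_1\|f\|_{H_1}$ and $\|\dot K_\theta f\|_{H_2}\le D_1\|f\|_{H_1}$; (ii) $\|(K_\theta-K_{\theta_0})f\|_S\le D_2|\theta-\theta_0|\,\|f\|_H$; (iii) $\|(K_\theta-K_{\theta_0}-(\theta-\theta_0)\dot K_{\theta_0})f\|_S\le D_3|\theta-\theta_0|^2\|f\|_H$; (iv) $\|\dot K_{\theta_0}(f-f_0)\|_S\le D_4\|f-f_0\|_H$. Assume that both the posterior and the posterior given $\theta_0$ contract at $(\theta_0,f_0)$ with respect to the semi-metrics $|\theta-\theta_0|+\|K_{\theta_0}(f-f_0)\|_{H_2}$ and $\|\dot K_{\theta_0}(f-f_0)\|_{H_2}$ at rates $\varepsilon_n\downarrow0$ and $\xi_n\downarrow0$ respectively, with $\varepsilon_n\le\xi_n$. Assume that the posterior mass of $\{f:\|f\|_H<M\}$ goes to $1$ for some $M>0$. Assume that there is a sequence $\gamma_n\in H$ with $\|\gamma_n-\gamma_{\theta_0,f_0}\|_{H_1}\le\rho_n$ for some $\rho_n\downarrow0$. Assume further that for some $\eta_n\downarrow0$, $$\Pi\bigl(\|K_\theta f-K_{\theta_0}f_0\|_{H_2}\le\varepsilon_n\bigr)\ge e^{-n\varepsilon_n^2/64},$$ $$\pi_f\Bigl(\exists\,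 s,t\in(-\varepsilon_n,\varepsilon_n):\ \Bigl|\log\frac{d\pi_{f+(s+t)\gamma_n}}{d\pi_{f+s\gamma_n}}(f)\Bigr|>\eta_n(1+nt^2)\Bigr)\le e^{-3n\varepsilon_n^2}.$$ Finally assume that $n\varepsilon_n^2\|K_{\theta_0}(\gamma_n-\gamma_{\theta_0,f_0})\|_{H_2}\to0$, and that either $n\varepsilon_n^2\xi_n^2\to0$, or $\theta\mapsto\|K_\theta f\|_{H_2}$ is constant for every $f\in H_1$. Then the Bernstein-von Mises theorem holds at $(\theta_0,f_0)$.
   Context: Setting. $\Theta\subset\mathbb R$ is compact, $H_1,H_2$ are separable Hilbert spaces, $\{K_\theta:H_1\to H_2,\ \theta\in\Theta\}$ are continuous linear operators, and $H\subseteq H_1$ is a linear subspace with a norm $\|\cdot\|_H$. The derivative $\dot K_\theta f:=\lim_{t\to0}(K_{\theta+t}f-K_\theta f)/t$ ($H_2$-norm limit) is assumed to exist. Model. One observes $X^{(n)}=K_\theta f+n^{-1/2}\dot W$ with $\dot W$ the iso-Gaussian process of $H_2$: for $h\in H_2$, $\langle h,X^{(n)}\rangle=\langle K_\theta f,h\rangle_{H_2}+n^{-1/2}\langle h,\dot W\rangle$, where $(\langle h,\dot W\rangle)_{h\in H_2}$ is centered Gaussian with covariance $\langle h,h'\rangle_{H_2}$. $P^n_{\theta,f}$ is the law of $X^{(n)}$ and, with $P_0^n$ the law of $n^{-1/2}\dot W$, $\log\frac{dP^n_{\theta,f}}{dP^n_0}(X^{(n)})=n\langle K_\theta f,X^{(n)}\rangle-\frac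 n2\|K_\theta f\|_{H_2}^2$. Prior and posterior. $\Pi=\pi_\theta\times\pi_f$, where $\pi_\theta$ has a positive Lebesgue density on $\Theta$ and $\pi_f$ is a probability distribution supported on $H$. $\Pi(\cdot\mid X^{(n)})$ is the posterior of $(\theta,f)$; the posterior given $\theta_0$, $\Pi^{\theta=\theta_0}(\cdot\mid X^{(n)})$, is the posterior of $f$ under prior $\pi_f$ in the model where $\theta=\theta_0$ is known. For $g\in H$, $\pi_{f+g}$ is the law of $f+g$ when $f\sim\pi_f$. The data are generated from $P^n_{\theta_0,f_0}$; ''posterior mass goes to 1'' means in $P^n_{\theta_0,f_0}$-probability as $n\to\infty$. The posterior contracts at $(\theta_0,f_0)$ w.r.t. a semi-metric $d$ at rate $\delta_n\downarrow0$ if the posterior mass of $\{d((\theta,f),(\theta_0,f_0))<\delta_n\}$ tends to 1 in $P^n_{\theta_0,f_0}$-probability (with $\theta=\theta_0$ for the posterior given $\theta_0$). Least favourable direction. $\gamma_{\theta,f}\in H$ denotes an element with $\langle\dot K_\theta f-K_\theta\gamma_{\theta,f},K_\theta h\rangle_{H_2}=0$ for all $h\in H$ (assumed to exist whenever it is used). The efficient Fisher information is $\tilde i_{\theta,f}=\|\dot K_\theta f-K_\theta\gamma_{\theta,f}\|_{H_2}^2=\|\dot K_\theta f\|_{H_2}^2-\|K_\theta\gamma_{\theta,f}\|_{H_2}^2$. Space $S$. $S\subset H_2$ is a normed space with norm $\|\cdot\|_S$ stronger than that of $H_2$, with $K_\theta H\subset S$, and $\int_0^1\sqrt{\log N(\varepsilon,\{h:\|h\|_S\le1\},\|\cdot\|_{H_2})}\,d\varepsilon<\infty$,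 where $N(\varepsilon,A,d)$ is the minimal number of $d$-balls of radius $\varepsilon$ covering $A$. Bernstein-von Mises. ''The Bernstein-von Mises theorem holds at $(\theta_0,f_0)$'' means that, in $P^n_{\theta_0,f_0}$-probability as $n\to\infty$, $\bigl\|\Pi(\theta\in\cdot\mid X^{(n)})-N\bigl(\theta_0+\tfrac1{\sqrt n}\Delta^n_{\theta_0,f_0},\tfrac1n\tilde i_{\theta_0,f_0}^{-1}\bigr)\bigr\|_{TV}\to0$, where $\Delta^n_{\theta_0,f_0}=\tilde i_{\theta_0,f_0}^{-1}\langle\dot K_{\theta_0}f_0-K_{\theta_0}\gamma_{\theta_0,f_0},\dot W\rangle\sim N(0,\tilde i_{\theta_0,f_0}^{-1})$, with $\dot W=\sqrt n(X^{(n)}-K_{\theta_0}f_0)$, and $\|P-Q\|_{TV}=2\sup_F|P(F)-Q(F)|$.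
   Formalization: The Lebesgue density of the prior on θ is additionally assumed continuous at θ₀; with only a positive density the claim fails, e.g. K_θf=f(cos θ, sin θ) and a prior density with a jump at θ₀. *)

(* Defs.v *)
From HB Require Import structures.
From mathcomp Require Import all_boot all_order all_algebra.
From mathcomp Require Import all_classical all_reals all_analysis.

Set Implicit Arguments.
Unset Strict Implicit.
Unset Printing Implicit Defensive.

Import Order.TTheory GRing.Theory Num.Theory.
Import numFieldNormedType.Exports.

Local Open Scope classical_set_scope.
Local Open Scope ring_scope.

(* Real Hilbert spaces. Positive definiteness of the inner product follows from
   dotp_norm, and completeness is inherited from the normed module. *)
HB.mixin Record CompleteNormedModule_isHilbert (R : realType) V
    & CompleteNormedModule R V := {
  dotp : V -> V -> R ;
  dotpC : forall x y, dotp x y = dotp y x ;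
  dotp_linearl : forall (a : R) x y z,
    dotp (a *: x + y) z = a * dotp x z + dotp y z ;
  dotp_norm : forall x, dotp x x = `|x| ^+ 2
}.

#[short(type="hilbertType")]
HB.structure Definition Hilbert (R : realType) :=
  { V of CompleteNormedModule_isHilbert R V & CompleteNormedModule R V }.

Definition separable (T : topologicalType) : Prop :=
  exists2 D : set T, countable D & dense D.

(* V with its Borel sigma-algebra. *)
Notation borel V := (g_sigma_algebraType (@open V)).

(* E is a linear subspace and N, whose values outside E are irrelevant, is a
   norm on E; nonnegativity of N on E follows from the other fields. *)
Record normed_subspace (R : realType) (V : lmodType R) (E : set V)
    (N : V -> R) : Prop := NormedSubspace {
  subspace0 : E 0 ;
  subspace_lin : forall a x y, E x -> E y -> E (a *: x + y) ;
  subspace_norm0 : forall x, E x -> N x = 0 -> x = 0 ;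
  subspace_normZ : forall a x, E x -> N (a *: x) = `|a| * N x ;
  subspace_normD : forall x y, E x -> E y -> N (x + y) <= N x + N y
}.

(* u_n decreases to 0, as in "u_n \downarrow 0". *)
Definition decreases_to0 (R : realType) (u : nat -> R) : Prop :=
  nonincreasing_seq u /\ u n @[n --> \oo] --> 0.

Section entropy.
Context {R : realType} {V : normedModType R}.

(* Equal to +oo when A has no finite cover by balls of radius e. *)
Definition covering_number (A : set V) (e : R) : \bar R :=
  ereal_inf [set k%:R%:E | k in
    [set k : nat | exists c : 'I_k -> V, A `<=` \bigcup_i ball (c i) e]].

Definition entropy_integral (A : set V) : \bar R :=
  (\int[lebesgue_measure]_(e in `]0%R, 1%R[) sqrte (lne (covering_number A e)))%E.

End entropy.

Section probability.
Context {R : realType}.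

(* Convergence to 0 in probability, with the outer probability of the events:
   it is the usual notion when the Z n are measurable. *)
Definition cvg_in_prob0 {d : measure_display} {Omega : measurableType d}
    (P : probability Omega R) (Z : nat -> Omega -> R) : Prop :=
  forall e : R, 0 < e ->
    mu_ext P [set w | e < `|Z n w|] @[n --> \oo] --> 0%E.

(* normal_prob is the uniform law on [0, 1] when the standard deviation is 0,
   hence the case distinction. *)
Definition centered_normal (sigma : R) : set (measurableTypeR R) -> \bar R :=
  if sigma == 0 then \d_(0 : measurableTypeR R) else normal_prob 0 sigma.

(* W h w stands for <h, Wdot>(w): a centered Gaussian process indexed by V with
   covariance <h, h'>. The version is taken jointly measurable in (h, w), which
   is possible because V is separable, and which gives a meaning to the integrals
   of the likelihood with respect to a prior; two such versions yield almost
   surely the same posterior distributions. *)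
Record iso_gaussian {V : hilbertType R} {d : measure_display}
    {Omega : measurableType d} (P : probability Omega R)
    (W : V -> Omega -> R) : Prop := IsoGaussian {
  iso_gaussian_measurable :
    measurable_fun [set: borel V * Omega] (fun hw => W hw.1 hw.2) ;
  iso_gaussian_normal : forall (k : nat) (h : 'I_k -> V) (a : 'I_k -> R),
    exists2 sigma : R, 0 <= sigma &
      forall B : set (measurableTypeR R), measurable B ->
        P ((fun w => \sum_i a i * W (h i) w) @^-1` B)
          = centered_normal sigma B ;
  iso_gaussian_cov : forall h h' : V,
    ('E_P[(fun w => W h w * W h' w)%R] = (dotp h h')%:E)%E
}.

Definition tv_dist (p q : set (measurableTypeR R) -> R) : R :=
  2 * sup [set `|p F - q F| | F in measurable].

(* r is a version of the density d nu / d mu. *)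
Record is_density {d : measure_display} {T : measurableType d}
    (mu nu : set T -> \bar R) (r : T -> R) : Prop := IsDensity {
  density_measurable : measurable_fun setT r ;
  density_ge0 : forall x, 0 <= r x ;
  density_integral : forall B, measurable B ->
    nu B = (\int[mu]_(x in B) (r x)%:E)%E
}.

(* The law of f + g for f with law mu. *)
Definition shift_law {V : normedModType R} (mu : set (borel V) -> \bar R)
    (g : V) : set (borel V) -> \bar R :=
  pushforward mu ((fun f => f + g) : borel V -> borel V).

(* Bayes' formula: the posterior mass of B for the prior mu on the parameter set
   D and the likelihood L. *)
Definition bayes {d : measure_display} {T : measurableType d}
    (mu : set T -> \bar R) (D : set T) (L : T -> R) (B : set T) : R :=
  fine (\int[mu]_(t in B `&` D) (L t)%:E)%E /
  fine (\int[mu]_(t in D) (L t)%:E)%E.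

End probability.

Section model.
Context {R : realType} {H1 H2 : hilbertType R}.
Implicit Types (K : R -> H1 -> H2) (x : H2 -> R) (n : nat).

(* An observation is x : H2 -> R, with x h standing for <h, X^(n)>. *)

(* <h, X^(n)> = <v, h> + n^(-1/2) <h, Wdot>, with v = K_theta f. *)
Definition observation {Omega : Type} (W : H2 -> Omega -> R) (v : H2) n
    (w : Omega) : H2 -> R :=
  fun h => dotp v h + (Num.sqrt n%:R)^-1 * W h w.

(* The density of the law of X^(n) with mean v relative to that of
   n^(-1/2) Wdot. *)
Definition likelihood n x (v : H2) : R :=
  expR (n%:R * x v - n%:R / 2 * `|v| ^+ 2).

Definition posterior K (Theta : set R) (H : set H1)
    (pi_theta : probability (measurableTypeR R) R)
    (pi_f : probability (borel H1) R) n x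
    (B : set (measurableTypeR R * borel H1)) : R :=
  bayes (pi_theta \x pi_f)%E (Theta `*` H)
    (fun p => likelihood n x (K p.1 p.2)) B.

(* The posterior of f when theta is known. *)
Definition posterior_given K (H : set H1) (pi_f : probability (borel H1) R)
    (theta : R) n x (B : set (borel H1)) : R :=
  bayes pi_f H (fun f => likelihood n x (K theta f)) B.

(* Kdot_theta f is the limit of (K_(theta+t) f - K_theta f) / t as t -> 0, with
   t <> 0 and theta + t in Theta. *)
Definition is_theta_derivative K (Kdot : R -> H1 -> H2) (Theta : set R)
    (H : set H1) : Prop :=
  forall theta f, Theta theta -> H f ->
    t^-1 *: (K (theta + t) f - K theta f)
      @[t --> within [set t | Theta (theta + t)] (0 : R)^'] --> Kdot theta f.

Definition least_favourable K (Kdot : R -> H1 -> H2) (H : set H1)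
    (theta : R) (f gamma : H1) : Prop :=
  H gamma /\
  forall h, H h -> dotp (Kdot theta f - K theta gamma) (K theta h) = 0.

Definition efficient_information K (Kdot : R -> H1 -> H2)
    (theta : R) (f gamma : H1) : R :=
  `|Kdot theta f - K theta gamma| ^+ 2.

Definition bernstein_von_mises K (Kdot : R -> H1 -> H2) (Theta : set R)
    (H : set H1) (pi_theta : probability (measurableTypeR R) R)
    (pi_f : probability (borel H1) R)
    {d : measure_display} {Omega : measurableType d} (P : probability Omega R)
    (W : H2 -> Omega -> R) (theta0 : R) (f0 gamma : H1) : Prop :=
  let info := efficient_information K Kdot theta0 f0 gamma in
  let Delta w := info^-1 * W (Kdot theta0 f0 - K theta0 gamma) w in
  cvg_in_prob0 P (fun n w =>
    tv_dist
      (fun F => posterior K Theta H pi_theta pi_f n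
        (observation W (K theta0 f0) n w) (F `*` setT))
      (* the second parameter of normal_prob is the standard deviation *)
      (fun F => fine (normal_prob
        (theta0 + (Num.sqrt n%:R)^-1 * Delta w)
        (Num.sqrt (n%:R^-1 * info^-1)) F))).

End model.

(* Main.v *)
Require Import Defs.
From HB Require Import structures.
From mathcomp Require Import all_boot all_order all_algebra.
From mathcomp Require Import all_classical all_reals all_analysis.
From mathcomp Require Import measurable_realfun.
From mathcomp Require Import ring lra.
Set Implicit Arguments.
Unset Strict Implicit.
Unset Printing Implicit Defensive.

Import Order.TTheory GRing.Theory Num.Theory.
Import numFieldNormedType.Exports.

Local Open Scope classical_set_scope.
Local Open Scope ring_scope.

(** The posterior of [(theta, f)] is a ratio of integrals of the likelihood ratio
    against the truth. Write [t = theta - theta0] and let [v] be the efficient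
    direction [Kdot theta0 f0 - K theta0 gamma]. The idea is to change the
    parameter and the function at the same time: if [f] is moved by [t *: gamman n]
    while the parameter is moved from [theta0] by [t], then, because [v] is
    orthogonal to the image of [K theta0], the log-likelihood at [(theta, f)] is
    that at [(theta0, f + t *: gamman n)] plus the Gaussian expression
    [sqrt n * W v * t - n * |v|^2 * t^2 / 2], up to errors that are small compared
    with [1 + n * t^2] ([log_lratio_expansion]). The quadratic errors are
    controlled by the smoothness of [K] and the assumed rates
    ([quadratic_expansion]). The noise of the remainder is controlled by Dudley's
    entropy bound ([noise_modulus]), since the remainder is [t] times an element
    of a ball of [S] that is small in [H2].

    The prior of [f] is almost invariant under these translations outside a set of
    negligible mass ([prior_translation_upper], [prior_translation_lower]). Hence
    the change of variables turns the integral of the likelihood over a set of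
    parameters into a product of a Gaussian integral in [theta] and an integral
    over [f] at [theta0] ([upper_mass], [lower_mass]). The second factor is the
    same in the numerator and the denominator of Bayes' formula, and what is left
    is the normal distribution of the theorem ([posterior_lower], [tv_bound]).

    The process is only known to be linear almost surely and for each direction
    separately, so that the expansion is an almost sure statement for each
    [(theta, f)]; Tonelli's theorem turns it into a statement for almost all
    [(theta, f)] simultaneously, which is all that integrals see
    ([ae_null_sections]). The upper bound is needed only on functions in the
    concentration set, but the lower bound needs it on all functions whose
    translates fall into the translated concentration set. For these the noise of
    [K theta (gamman n) - K theta0 (gamman n)] enters with a factor [eps n]
    instead of [t]; as only [|t| <= L / sqrt n] matters for the lower bound, its
    integral over the prior is negligible by Markov's inequality.

    Exceptional sets are compared with the denominator of Bayes' formula, which is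
    at least [exp (- 2 n eps^2)] with probability tending to one
    ([integrated_lratio_lower], [mass_lower]), while [n eps^2] tends to infinity
    because a posterior cannot contract at the parametric rate
    ([rate_diverges]). *)

(** * Integration against densities and image measures *)

Section measure_tools.
Context {R : realType}.
Import HBNNSimple.

(** Approximation by simple functions reduces the claim to indicators, for which
    it is the definition of a density. *)
Lemma integral_density {d : measure_display} {T : measurableType d}
    (mu nu : {measure set T -> \bar R}) (r : T -> R) (u : T -> \bar R) :
  is_density mu nu r -> measurable_fun setT u -> (forall x, 0 <= u x)%E ->
  (\int[nu]_x u x = \int[mu]_x (u x * (r x)%:E))%E.
Proof.
move=> [mr r0 rE] mu_ u0.
have mrE : measurable_fun setT (fun x => (r x)%:E).
  exact/measurable_EFinP.
have ind E : measurable E ->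
    (\int[nu]_x (\1_E x)%:E = \int[mu]_x ((\1_E x)%:E * (r x)%:E))%E.
  move=> mE; rewrite integral_indic//= setIT rE//.
  rewrite integral_mkcond; apply: eq_integral => x _.
  by rewrite patchE indicE; case: ifP; rewrite ?mul1e ?mul0e.
have nns (f : {nnsfun T >-> R}) :
    (\int[nu]_x (f x)%:E = \int[mu]_x ((f x)%:E * (r x)%:E))%E.
  under [LHS]eq_integral do rewrite fimfunE -fsumEFin//.
  rewrite [LHS]ge0_integral_fsum//; last 2 first.
    - by move=> k; exact/measurable_EFinP/measurableT_comp.
    - by move=> n x _; rewrite EFinM nnfun_muleindic_ge0.
  under [RHS]eq_integral.
    move=> x xD; rewrite fimfunE -fsumEFin// ge0_mule_fsuml; last first.
      by move=> k; rewrite EFinM nnfun_muleindic_ge0.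
    over.
  rewrite [RHS]ge0_integral_fsum//; last 2 first.
    - move=> k; apply: emeasurable_funM => //.
      by apply/measurable_EFinP; do 2 apply/measurableT_comp => //.
    - move=> n x _; apply: mule_ge0; last by rewrite lee_fin.
      by rewrite EFinM nnfun_muleindic_ge0.
  apply: eq_fsbigr => k; rewrite inE => -[y _ fyk].
  have k0 : 0 <= k by rewrite -fyk.
  rewrite integralZl_indic_nnsfun// ind//.
  under [RHS]eq_integral do rewrite EFinM -muleA.
  rewrite ge0_integralZl//.
  - apply: emeasurable_funM => //; exact/measurable_EFinP/measurable_indic.
  - by move=> x _; rewrite mule_ge0 ?lee_fin.
pose f_ := nnsfun_approx measurableT mu_.
transitivity (lim (\int[nu]_x (f_ n x)%:E @[n --> \oo])%E).
  rewrite -monotone_convergence//=.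
  - apply: eq_integral => ? /[!inE] xD; apply/esym/cvg_lim => //=.
    exact: cvg_nnsfun_approx.
  - by move=> n; exact/measurable_EFinP/measurable_funTS.
  - by move=> n ? _; rewrite lee_fin.
  - by move=> ? _ ? ? mn; rewrite lee_fin; exact/lefP/nd_nnsfun_approx.
under eq_fun do rewrite nns.
rewrite -monotone_convergence//=.
- apply: eq_integral => x _; apply/cvg_lim => //.
  apply: cvgeZr => //; exact: cvg_nnsfun_approx.
- by move=> n; apply: emeasurable_funM => //; exact/measurable_EFinP/measurable_funTS.
- by move=> n ? _; rewrite mule_ge0// lee_fin.
- move=> x _ m n mn; rewrite lee_wpmul2r ?lee_fin//.
  exact/lefP/nd_nnsfun_approx.
Qed.

Definition image_measure {d d' : measure_display} {T : measurableType d}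
    {T' : measurableType d'} (mu : {measure set T -> \bar R}) (X : T -> T')
    (mX : measurable_fun setT X) : {measure set T' -> \bar R} :=
  measure_function_pushforward__canonical__measure_function_Measure mu mX.

Lemma integral_law {d d' : measure_display} {T : measurableType d}
    {T' : measurableType d'} (mu : {measure set T -> \bar R})
    (nu : {measure set T' -> \bar R}) (X : T -> T') (u : T' -> \bar R) :
  measurable_fun setT X ->
  (forall B, measurable B -> mu (X @^-1` B) = nu B) ->
  measurable_fun setT u -> (forall x, 0 <= u x)%E ->
  (\int[mu]_x u (X x) = \int[nu]_y u y)%E.
Proof.
move=> mX XE mfu u0.
have -> : (\int[mu]_x u (X x) = \int[pushforward mu X]_y u y)%E.
  by rewrite ge0_integral_pushforward.
apply: (eq_measure_integral nu (m1 := image_measure mu mX)) => B mB _.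
exact: XE.
Qed.

End measure_tools.

(** * Moments of the normal distribution *)

Lemma le_of_perturbation {R : realFieldType} (a b c : R) : 0 <= c ->
  (forall e : R, 0 < e -> e <= 2^-1 -> a <= b + c * e) -> a <= b.
Proof.
move=> c0 h; rewrite leNgt; apply/negP => ba.
pose e := Num.min 2^-1 ((a - b) / (2 * (c + 1))).
have ab : 0 < a - b by rewrite subr_gt0.
have c1 : 0 < 2 * (c + 1) by lra.
have e0 : 0 < e by rewrite lt_min divr_gt0// andbT; lra.
have e1 : e <= 2^-1 by rewrite ge_min lexx.
have : e <= (a - b) / (2 * (c + 1)) by rewrite ge_min lexx orbT.
rewrite ler_pdivlMr// => e2.
by have := h e e0 e1; nra.
Qed.

Section gaussian.
Context {R : realType}.
Local Notation mu := (@lebesgue_measure R).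
Implicit Types (m s t x a b c : R).

Lemma normal_peakE s : 0 < s -> normal_peak s = (s * Num.sqrt (pi *+ 2))^-1.
Proof.
move=> s0; rewrite /normal_peak -mulrnAr sqrtrM ?sqr_ge0// sqrtr_sqr.
by rewrite gtr0_norm.
Qed.

Lemma normal_density m s :
  is_density mu (normal_prob m s) (normal_pdf m s).
Proof.
split; [exact: measurable_normal_pdf | exact: normal_pdf_ge0 | by []].
Qed.

Lemma normal_expRZ s c : 0 < s ->
  (\int[normal_prob 0 s]_x (expR (c * x))%:E = (expR ((c * s) ^+ 2 / 2))%:E)%E.
Proof.
move=> s0; have sN0 : s != 0 by rewrite gt_eqF.
rewrite (integral_density (normal_density 0 s))//; last first.
  apply/measurable_EFinP; exact: measurableT_comp.
transitivity (\int[mu]_x ((expR ((c * s) ^+ 2 / 2))%:E *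
    (normal_pdf (c * s ^+ 2) s x)%:E))%E.
  apply: eq_integral => x _; rewrite -!EFinM !normal_pdfE// /normal_fun.
  rewrite mulrCA [in RHS]mulrCA -!expRD; congr (_ * expR _)%:E.
  by field.
rewrite ge0_integralZl//= ?integral_normal_pdf ?mule1//.
- by apply/measurable_EFinP; exact: measurable_normal_pdf.
- by move=> x _; rewrite lee_fin normal_pdf_ge0.
Qed.

(** The moment generating function of the square, indexed by the standard
    deviation [t] of the Gaussian to which the exponential tilts [N(0, s^2)]. *)
Lemma normal_expR_sqr s t : 0 < s -> 0 < t ->
  (\int[normal_prob 0 s]_x
     (expR ((s ^- 2 - t ^- 2) / 2 * x ^+ 2))%:E = (t / s)%:E)%E.
Proof.
move=> s0 t0; have sN0 : s != 0 by rewrite gt_eqF.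
have tN0 : t != 0 by rewrite gt_eqF.
rewrite (integral_density (normal_density 0 s))//; last first.
  apply/measurable_EFinP; apply: measurableT_comp => //.
  by apply: measurable_funM => //; exact: measurable_funX.
transitivity (\int[mu]_x ((t / s)%:E * (normal_pdf 0 t x)%:E))%E.
  apply: eq_integral => x _; rewrite -!EFinM !normal_pdfE// /normal_fun.
  rewrite mulrCA -expRD [in RHS]mulrA; congr (_ * expR _)%:E; last by field; apply/andP.
  rewrite !normal_peakE//; field; rewrite sN0 tN0 /= gt_eqF// sqrtr_gt0.
  by rewrite mulrn_wgt0// pi_gt0.
rewrite ge0_integralZl//= ?integral_normal_pdf ?mule1//.
- by apply/measurable_EFinP; exact: measurable_normal_pdf.
- by move=> x _; rewrite lee_fin normal_pdf_ge0.
- by rewrite lee_fin divr_ge0// ltW.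
Qed.

(** The second moment is the derivative at zero of the moment generating function
    of the square: [1 + a x^2 <= exp (a x^2)] bounds it from above when [a] is
    positive and from below when [a] is negative. *)
Lemma normal_second_moment s : 0 < s ->
  (\int[normal_prob 0 s]_x (x ^+ 2)%:E = (s ^+ 2)%:E)%E.
Proof.
move=> s0; have sN0 : s != 0 by rewrite gt_eqF.
set N := normal_prob 0 s.
have mX : measurable_fun [set: measurableTypeR R] (fun x : R => (x ^+ 2)%:E).
  by apply/measurable_EFinP; exact: measurable_funX.
have X0 x : (0 <= (x ^+ 2)%:E)%E by rewrite lee_fin sqr_ge0.
have int1 : (\int[N]_x 1%:E = 1)%E.
  by rewrite integral_cst//= /N probability_setT mule1.
have up t : s < t -> (((s ^- 2 - t ^- 2) / 2)%:E * \int[N]_x (x ^+ 2)%:E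
    <= (t / s - 1)%:E)%E.
  move=> st; have t0 : 0 < t by exact: lt_trans st.
  have c0 : 0 <= (s ^- 2 - t ^- 2) / 2.
    rewrite divr_ge0// subr_ge0 lef_pV2 ?posrE ?exprn_gt0//.
    by rewrite lerXn2r ?nnegrE ?ltW.
  rewrite EFinB leeBrDr// -(normal_expR_sqr s0 t0) -ge0_integralZl_EFin//.
  rewrite -[X in (_ + X)%E]int1 -ge0_integralD//; last 2 first.
  - by move=> x _; rewrite mule_ge0.
  - by apply: emeasurable_funM => //; exact: measurable_cst.
  apply: ge0_le_integral => //.
  - by move=> x _; rewrite adde_ge0// mule_ge0.
  - apply: emeasurable_funD; last exact: measurable_cst.
    by apply: emeasurable_funM => //; exact: measurable_cst.
  - apply/measurable_EFinP; apply: measurableT_comp => //.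
    by apply: measurable_funM => //; exact: measurable_funX.
  - move=> x _; rewrite -EFinM -EFinD lee_fin addrC; exact: expR_ge1Dx.
have fin : (\int[N]_x (x ^+ 2)%:E)%E \is a fin_num.
  have s2 : s < s * 2 by lra.
  rewrite ge0_fin_numE ?integral_ge0//.
  have := up _ s2; rewrite (_ : (_ - _) / 2 = 3 / 8 / s ^+ 2); last by field.
  case: (\int[N]_x (x ^+ 2)%:E)%E => [r| |]//; first by rewrite ltry.
  rewrite gt0_muley ?leye_eq// lte_fin !divr_gt0// ?exprn_gt0//.
have [M MI] : exists M, (\int[N]_x (x ^+ 2)%:E = M%:E)%E.
  by exists (fine (\int[N]_x (x ^+ 2)%:E)%E); rewrite fineK.
have dn t : 0 < t -> t < s -> (s ^- 2 - t ^- 2) / 2 * M <= t / s - 1.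
  move=> t0 ts.
  have c0 : 0 <= - ((s ^- 2 - t ^- 2) / 2).
    rewrite -mulNr divr_ge0// opprB subr_ge0 lef_pV2 ?posrE ?exprn_gt0//.
    by rewrite lerXn2r ?nnegrE ?ltW.
  suff : (1 <= (t / s)%:E + (- ((s ^- 2 - t ^- 2) / 2))%:E * M%:E)%E.
    by rewrite -EFinM -EFinD lee_fin mulNr lerBrDl lerBrDl addrC.
  rewrite -(normal_expR_sqr s0 t0) -MI -ge0_integralZl_EFin//.
  have me : measurable_fun [set: measurableTypeR R]
      (fun x : R => (expR ((s ^- 2 - t ^- 2) / 2 * x ^+ 2))%:E).
    apply/measurable_EFinP; apply: measurableT_comp => //.
    by apply: measurable_funM => //; exact: measurable_funX.
  rewrite -ge0_integralD//; last 2 first.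
  - by move=> x _; rewrite mule_ge0.
  - by apply: emeasurable_funM => //; exact: measurable_cst.
  rewrite -int1; apply: ge0_le_integral => //.
  - by apply: emeasurable_funD => //; apply: emeasurable_funM => //.
  - move=> x _; rewrite -EFinM -EFinD lee_fin.
    by have := expR_ge1Dx ((s ^- 2 - t ^- 2) / 2 * x ^+ 2); lra.
rewrite MI; congr EFin; apply/eqP; rewrite eq_le; apply/andP; split.
- apply: (@le_of_perturbation _ _ _ (3 * s ^+ 2)) => [|e e0 e1].
    by rewrite mulr_ge0 ?sqr_ge0.
  have st : s < s * (1 + e) by rewrite ltr_pMr// ltrDl.
  have := up _ st; rewrite MI -EFinM lee_fin.
  have -> : s * (1 + e) / s - 1 = e by field.
  have -> : (s ^- 2 - (s * (1 + e)) ^- 2) / 2 =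
      e * (2 + e) / (2 * s ^+ 2 * (1 + e) ^+ 2).
    by field; rewrite sN0 /= gt_eqF//; lra.
  have e2 : 0 < 2 * s ^+ 2 * (1 + e) ^+ 2.
    by rewrite !mulr_gt0 ?exprn_gt0//; lra.
  rewrite mulrAC ler_pdivrMr// -[X in X <= _]mulrA ler_pM2l// => h.
  have s2 : 0 < s ^+ 2 by rewrite exprn_gt0.
  nra.
- apply: (@le_of_perturbation _ _ _ (2 * s ^+ 2)) => [|e e0 e1].
    by rewrite mulr_ge0 ?sqr_ge0.
  have e2 : 0 < 1 - e by lra.
  have st : s * (1 - e) < s by rewrite gtr_pMr//; lra.
  have := dn _ (mulr_gt0 s0 e2) st.
  have -> : s * (1 - e) / s - 1 = - e by field.
  have -> : (s ^- 2 - (s * (1 - e)) ^- 2) / 2 =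
      - e * (2 - e) / (2 * s ^+ 2 * (1 - e) ^+ 2).
    by field; rewrite sN0 /= gt_eqF//.
  have e3 : 0 < 2 * s ^+ 2 * (1 - e) ^+ 2.
    by rewrite !mulr_gt0 ?exprn_gt0//; lra.
  rewrite mulrAC ler_pdivrMr// -[X in X <= _]mulrA !mulNr lerN2 ler_pM2l// => h.
  have s2 : 0 < s ^+ 2 by rewrite exprn_gt0.
  nra.
Qed.

End gaussian.

(** * Inner products *)

Section inner_product.
Context {R : realType} {V : hilbertType R}.
Implicit Types (x y z : V) (a : R).

Lemma dotpDl x y z : dotp (x + y) z = dotp x z + dotp y z.
Proof. by have := dotp_linearl 1 x y z; rewrite scale1r mul1r. Qed.

Lemma dotp0l z : dotp 0 z = 0 :> R.
Proof. by have := dotpDl 0 0 z; rewrite addr0; lra. Qed.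

Lemma dotpZl a x z : dotp (a *: x) z = a * dotp x z.
Proof. by have := dotp_linearl a x 0 z; rewrite addr0 dotp0l addr0. Qed.

Lemma dotpNl x z : dotp (- x) z = - dotp x z.
Proof. by rewrite -scaleN1r dotpZl mulN1r. Qed.

Lemma dotpBl x y z : dotp (x - y) z = dotp x z - dotp y z.
Proof. by rewrite dotpDl dotpNl. Qed.

Lemma dotpDr x y z : dotp z (x + y) = dotp z x + dotp z y.
Proof. by rewrite !(dotpC z) dotpDl. Qed.

Lemma dotpZr a x z : dotp z (a *: x) = a * dotp z x.
Proof. by rewrite !(dotpC z) dotpZl. Qed.

Lemma dotpNr x z : dotp z (- x) = - dotp z x.
Proof. by rewrite !(dotpC z) dotpNl. Qed.

Lemma dotpBr x y z : dotp z (x - y) = dotp z x - dotp z y.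
Proof. by rewrite !(dotpC z) dotpBl. Qed.

Lemma dotp_suml (I : Type) (r : seq I) (F : I -> V) z :
  dotp (\sum_(i <- r) F i) z = \sum_(i <- r) dotp (F i) z.
Proof.
elim: r => [|i r IH]; first by rewrite !big_nil dotp0l.
by rewrite !big_cons dotpDl IH.
Qed.

Lemma dotp_sumr (I : Type) (r : seq I) (F : I -> V) z :
  dotp z (\sum_(i <- r) F i) = \sum_(i <- r) dotp z (F i).
Proof. by rewrite dotpC dotp_suml; apply: eq_bigr => i _; rewrite dotpC. Qed.

Lemma normD_dotp x y : `|x + y| ^+ 2 = `|x| ^+ 2 + 2 * dotp x y + `|y| ^+ 2.
Proof.
by rewrite -!dotp_norm dotpDl !dotpDr (dotpC y x); ring.
Qed.

Lemma normB_dotp x y : `|x - y| ^+ 2 = `|x| ^+ 2 - 2 * dotp x y + `|y| ^+ 2.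
Proof. by rewrite normD_dotp dotpNr normrN; ring. Qed.

Lemma normZ_dotp a x : `|a *: x| ^+ 2 = a ^+ 2 * `|x| ^+ 2.
Proof. by rewrite -!dotp_norm dotpZl dotpZr expr2 mulrA. Qed.

Lemma cauchy_schwarz x y : `|dotp x y| <= `|x| * `|y|.
Proof.
have [->|x0] := eqVneq x 0; first by rewrite dotp0l !normr0 mul0r.
have nx : 0 < `|x| ^+ 2 by rewrite exprn_gt0// normr_gt0.
rewrite -ler_sqr ?nnegrE ?mulr_ge0// real_normK ?num_real//.
have := sqr_ge0 `|(`|x| ^+ 2) *: y - dotp x y *: x|.
rewrite normB_dotp !normZ_dotp dotpZl dotpZr (dotpC y x).
rewrite (_ : _ + _ = `|x| ^+ 2 * ((`|x| * `|y|) ^+ 2 - dotp x y ^+ 2)).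
  by rewrite pmulr_rge0// subr_ge0.
by ring.
Qed.

End inner_product.

(** * Linear combinations of the noise *)

Section gaussian_process.
Context {R : realType} {V : hilbertType R} {d : measure_display}
  {Omega : measurableType d} (P : probability Omega R) (W : V -> Omega -> R).
Hypothesis isoW : iso_gaussian P W.

Lemma measurable_noise h : measurable_fun setT (W h).
Proof.
exact: (measurable_fun_pair2 (h : borel V) (iso_gaussian_measurable isoW)).
Qed.

Lemma noise_sqr h : (\int[P]_w (W h w ^+ 2)%:E = (`|h| ^+ 2)%:E)%E.
Proof.
have := iso_gaussian_cov isoW h h; rewrite dotp_norm unlock => <-.
by apply: eq_integral => w _; rewrite expr2.
Qed.

Lemma integrable_noiseM h h' :
  P.-integrable setT (fun w => (W h w * W h' w)%:E).
Proof.
have sq g : P.-integrable setT (fun w => (W g w ^+ 2)%:E).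
  apply/integrableP; split.
    by apply/measurable_EFinP/measurable_funX; exact: measurable_noise.
  under eq_integral do rewrite gee0_abs ?lee_fin ?sqr_ge0//.
  by rewrite noise_sqr ltry.
have := integrableD measurableT (sq h) (sq h').
apply: le_integrable => //.
  apply/measurable_EFinP/measurable_funM; exact: measurable_noise.
move=> w _ /=; rewrite lee_fin.
rewrite [leRHS]ger0_norm ?addr_ge0 ?sqr_ge0//.
rewrite ler_norml; apply/andP; split.
  have := sqr_ge0 (W h w + W h' w); have := sqr_ge0 (W h w).
  by have := sqr_ge0 (W h' w); nra.
have := sqr_ge0 (W h w - W h' w); have := sqr_ge0 (W h w).
by have := sqr_ge0 (W h' w); nra.
Qed.

Lemma noise_comb_sqr (k : nat) (h : 'I_k -> V) (a : 'I_k -> R) :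
  (\int[P]_w ((\sum_i a i * W (h i) w) ^+ 2)%:E =
   (`|\sum_i a i *: h i| ^+ 2)%:E)%E.
Proof.
transitivity (\int[P]_w (\sum_i \sum_j
    (a i * a j)%:E * (W (h i) w * W (h j) w)%:E))%E.
  apply: eq_integral => w _; rewrite expr2 mulr_suml -sumEFin.
  apply: eq_bigr => i _; rewrite mulr_sumr -sumEFin; apply: eq_bigr => j _.
  by rewrite -EFinM mulrACA.
have intij i j : P.-integrable setT
    (fun w => ((a i * a j)%:E * (W (h i) w * W (h j) w)%:E)%E).
  exact/integrableZl/integrable_noiseM.
rewrite integral_sum//; last by move=> i; exact: integrable_sum.
rewrite -dotp_norm dotp_suml -sumEFin; apply: eq_bigr => i _.
rewrite integral_sum// dotp_sumr -sumEFin; apply: eq_bigr => j _.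
rewrite integralZl//; last exact: integrable_noiseM.
have := iso_gaussian_cov isoW (h i) (h j); rewrite unlock => ->.
by rewrite dotpZl dotpZr -EFinM mulrA.
Qed.

Lemma measurable_noise_comb (k : nat) (h : 'I_k -> V) (a : 'I_k -> R) :
  measurable_fun setT (fun w => \sum_i a i * W (h i) w).
Proof.
apply: measurable_sum => i; apply: measurable_funM => //.
exact: measurable_noise.
Qed.

(** The standard deviation of a combination, which the definition of the process
    leaves open, is determined by the second moment and hence by the covariance. *)
Lemma noise_comb_law (k : nat) (h : 'I_k -> V) (a : 'I_k -> R)
    (u : R -> \bar R) : measurable_fun setT u -> (forall x, 0 <= u x)%E ->
  let s := `|\sum_i a i *: h i| in
  (\int[P]_w u (\sum_i a i * W (h i) w)%R =
   if s == 0%R then u 0%R else \int[normal_prob 0 s]_x u x)%E.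
Proof.
move=> mfu u0 s.
have mX := measurable_noise_comb h a.
have [sigma sigma0 law] := iso_gaussian_normal isoW h a.
have tr (g : R -> \bar R) : measurable_fun setT g -> (forall x, 0 <= g x)%E ->
  (\int[P]_w g (\sum_i a i * W (h i) w)%R =
   if sigma == 0%R then g 0%R else \int[normal_prob 0 sigma]_x g x)%E.
  move=> mg g0; move: law; rewrite /centered_normal; case: ifPn => s0 law.
    rewrite (integral_law (nu := \d_(0 : measurableTypeR R)) mX)//.
    by rewrite integral_dirac// diracT mul1e.
  by rewrite (integral_law (nu := normal_prob 0 sigma) mX).
have sE : s = sigma; last by rewrite sE; exact: tr.
have : (`|\sum_i a i *: h i| ^+ 2)%:E = (sigma ^+ 2)%:E.
  rewrite -(noise_comb_sqr h a) (tr (fun x => (x ^+ 2)%:E))//; last 2 first.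
  - by apply/measurable_EFinP; exact: measurable_funX.
  - by move=> x; rewrite lee_fin sqr_ge0.
  case: ifPn => [/eqP ->//|sN0]; rewrite normal_second_moment//.
  by rewrite lt_neqAle eq_sym sN0.
by case=> /eqP; rewrite eqrXn2// => /eqP.
Qed.

Lemma noise_comb_expR (k : nat) (h : 'I_k -> V) (a : 'I_k -> R) :
  (\int[P]_w (expR (\sum_i a i * W (h i) w))%:E =
   (expR (`|\sum_i a i *: h i| ^+ 2 / 2))%:E)%E.
Proof.
rewrite (noise_comb_law (u := fun x => (expR x)%:E) h a)//; last first.
  exact/measurable_EFinP.
case: ifPn => [/eqP ->|sN0]; first by rewrite expr0n mul0r.
rewrite -[X in (X ^+ 2 / 2)%R]mul1r -normal_expRZ ?lt_neqAle ?normr_ge0 1?eq_sym ?sN0//.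
by apply: eq_integral => x _; rewrite mul1r.
Qed.

(** A combination of variance zero vanishes; this is the linearity of the noise,
    which therefore holds only almost surely. *)
Lemma noise_comb_ae0 (k : nat) (h : 'I_k -> V) (a : 'I_k -> R) :
  \sum_i a i *: h i = 0 -> {ae P, forall w, \sum_i a i * W (h i) w = 0}.
Proof.
move=> s0; have := noise_comb_sqr h a; rewrite s0 normr0 expr0n => I0.
have mX := measurable_noise_comb h a.
have : (\int[P]_(w in setT) `|((\sum_i a i * W (h i) w) ^+ 2)%:E| = 0)%E.
  by under eq_integral do rewrite gee0_abs ?lee_fin ?sqr_ge0//.
move/ae_eq_integral_abs => /(_ measurableT).
case; first by apply/measurable_EFinP/measurable_funX.
move=> N [mN PN sN]; exists N; split => // w nw; apply: sN => /=.
by move=> /(_ I) [/eqP]; rewrite sqrf_eq0 => /eqP.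
Qed.

End gaussian_process.

(** * Nets from the entropy integral *)

Section entropy_nets.
Context {R : realType} {V : normedModType R}.
Implicit Types (B : set V) (e : R).

Let cover B e := [set k : nat | exists c : 'I_k -> V, B `<=` \bigcup_i ball (c i) e].

Lemma covering_numberP B e : covering_number B e = +oo%E \/
  exists k (c : 'I_k -> V), B `<=` \bigcup_i ball (c i) e /\
    covering_number B e = k%:R%:E.
Proof.
have [[k0 Ak0]|A0] := pselect (exists k, cover B e k); last first.
  left; rewrite /covering_number -/(cover B e).
  suff -> : cover B e = set0 by rewrite image_set0 ereal_inf0.
  by apply/seteqP; split => // k Ak; apply: A0; exists k.
right; have ex : exists k, `[< cover B e k >] by exists k0; apply/asboolP.
case: (ex_minnP ex) => k /asboolP [c Bc] kmin; exists k, c; split=> //.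
apply/eqP; rewrite eq_le; apply/andP; split.
  by apply: ereal_inf_lbound; exists k => //; exists c.
apply: le_ereal_inf_tmp => _ [l Al <-]; rewrite lee_fin ler_nat; apply: kmin.
exact/asboolP.
Qed.

Lemma covering_number_ge1 B e : B !=set0 -> (1 <= covering_number B e)%E.
Proof.
move=> [b Bb]; have [->|[k [c [Bc ->]]]] := covering_numberP B e.
  exact: leey.
by rewrite lee_fin ler1n; case: k c Bc => // c /(_ _ Bb) [[]].
Qed.

Lemma covering_number_nonincreasing B e e' : e <= e' ->
  (covering_number B e' <= covering_number B e)%E.
Proof.
move=> ee'; apply: ereal_inf_le_tmp => _ [k [c Bc] <-]; exists k => //.
by exists c => b /Bc [i _ bi]; exists i => //; apply: le_ball bi.
Qed.

Let f B e : \bar R := sqrte (lne (covering_number B e)).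

Let f_nonincreasing B e e' : B !=set0 -> e <= e' -> (f B e' <= f B e)%E.
Proof.
move=> B0 ee'; have n1 := covering_number_ge1 _ B0.
have n0 x : (0 <= covering_number B x)%E by rewrite (le_trans _ (n1 x)).
rewrite /f lee_sqrt ?lne_ge0// lee_lne ?in_itv/= ?leey ?andbT//.
exact: covering_number_nonincreasing.
Qed.

Let measurable_f B D : B !=set0 -> measurable D ->
  measurable_fun (D : set R) (f B).
Proof.
move=> B0 mD; apply: (measurability _ (ErealGenOInfty.measurableE R)) => //.
move=> _ [_ [x ->] <-]; apply: measurableI => //.
apply: is_interval_measurable => s t /=.
rewrite !in_itv/= !andbT => fs ft u /andP[su ut].
by rewrite in_itv/= andbT (lt_le_trans ft)// f_nonincreasing.
Qed.

Local Notation h j := ((2^-1 : R) ^+ j.+1).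

Let h0 j : 0 < h j. Proof. by rewrite exprn_gt0. Qed.

Let hS j : h j.+1 = h j / 2. Proof. by rewrite exprS mulrC. Qed.

Let h1 j : h j < 1. Proof. by rewrite exprn_ilt1//; lra. Qed.

(** The integral over the dyadic pieces bounds the sum at the dyadic scales,
    because covering numbers decrease with the radius. *)
Lemma entropy_nets B : B !=set0 -> (entropy_integral B < +oo)%E ->
  exists (N : nat -> nat) (c : forall j, 'I_(N j) -> V) (C : R),
    [/\ forall j, (0 < N j)%N,
        forall j, B `<=` \bigcup_i ball (c j i) (h j) &
        forall m, \sum_(j < m) h j * Num.sqrt (ln (N j)%:R) <= C].
Proof.
move=> B0 Ifin.
have fge0 x : (0 <= f B x)%E by exact: sqrte_ge0.
have piece j : (f B (h j) * (h j / 2)%:E <= \int[lebesgue_measure]_(e in `]h j.+1, h j]) f B e)%E.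
  have -> : (h j / 2)%:E = lebesgue_measure `]h j.+1, h j]%classic.
    rewrite lebesgue_measure_itv/= lte_fin ifT; last by rewrite hS; have := h0 j; lra.
    by rewrite -EFinB; congr EFin; rewrite hS; lra.
  rewrite -integral_cst//; apply: ge0_le_integral => //.
  - by move=> x _; exact: sqrte_ge0.
  - exact: measurable_f.
  - move=> x /=; rewrite in_itv/= => /andP[_ xh]; exact: f_nonincreasing.
have sums m : (\sum_(j < m) f B (h j) * (h j / 2)%:E <= \int[lebesgue_measure]_(e in `]h m, h 0]) f B e)%E.
  elim: m => [|m IH]; first by rewrite big_ord0 integral_ge0.
  have hm0 : h m <= h 0.
    by apply: ler_wiXn2l => //; lra.
  have hm : h m.+1 <= h m by rewrite hS; have := h0 m; lra.
  have -> : `]h m.+1, h 0]%classic = `]h m.+1, h m]%classic `|` `]h m, h 0]%classic.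
    by rewrite -itv_bndbnd_setU// bnd_simp.
  rewrite ge0_integral_setU//; last 2 first.
  - by apply: measurable_f => //; exact: measurableU.
  - apply/disj_setPS => x [] /=; rewrite !in_itv/= => /andP[_ a] /andP[b _].
    by have := lt_le_trans b a; rewrite ltxx.
  by rewrite big_ord_recr/= addeC leeD.
have fin m k : (\int[lebesgue_measure]_(e in `]h m, h k]) f B e <= entropy_integral B)%E.
  apply: ge0_subset_integral => //; first exact: measurable_f.
  move=> x /=; rewrite !in_itv/= => /andP[a b]; apply/andP; split.
    exact: lt_trans (h0 m) a.
  exact: le_lt_trans b (h1 k).
have fin_h j : covering_number B (h j) != +oo%E.
  apply/eqP => cy; have := le_lt_trans (le_trans (piece j) (fin j.+1 j)) Ifin.
  by rewrite /f cy /= gt0_mulye ?ltxx// lte_fin divr_gt0.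
have ex j : exists Nc : {N & 'I_N -> V},
    B `<=` \bigcup_i ball (projT2 Nc i) (h j) /\
    covering_number B (h j) = (projT1 Nc)%:R%:E.
  case: (covering_numberP B (h j)) => [cy|[k [c [Bc cE]]]].
    by move: (fin_h j); rewrite cy eqxx.
  by exists (existT _ k c).
have [F FP] := choice ex.
exists (fun j => projT1 (F j)), (fun j => projT2 (F j)).
exists (2 * fine (entropy_integral B)); split.
- move=> j; have [_ cE] := FP j; have := covering_number_ge1 (h j) B0.
  by rewrite cE lee_fin ler1n.
- by move=> j; have [] := FP j.
- move=> m; have I0 : (0 <= entropy_integral B)%E by apply: integral_ge0 => x _; exact: fge0.
  rewrite -ler_pdivrMl// -lee_fin fineK ?ge0_fin_numE//.
  apply: le_trans (fin m 0%N); apply: le_trans (sums m).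
  rewrite mulr_sumr -sumEFin; apply: lee_sum => j _.
  have [_ cE] := FP j; rewrite /f cE lne_EFin ?ltr0n; last first.
    by have := covering_number_ge1 (h j) B0; rewrite cE lee_fin ler1n.
  by rewrite /= -EFinM lee_fin; rewrite (_ : _ * _ = Num.sqrt (ln (projT1 (F j))%:R) * (h j / 2)) //; ring.
Qed.

End entropy_nets.

(** * Comparisons and tail bounds *)

Section measurable_comparison.
Context {R : realType} {d : measure_display} {T : measurableType d}.
Implicit Types (D : set T) (f g : T -> R).

Lemma measurable_set_ltr D f g : measurable D ->
  measurable_fun D f -> measurable_fun D g ->
  measurable (D `&` [set x | f x < g x]).
Proof.
move=> mD mf mg.
have -> : D `&` [set x | f x < g x] = D `\` (D `&` [set x | g x <= f x]).
  apply/seteqP; split=> x [Dx] /=.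
    by move=> fg; split => // -[_]; rewrite leNgt fg.
  by move/not_andP => [//|/negP]; rewrite -ltNge.
by apply: measurableD => //; exact: measurable_fun_le.
Qed.

Lemma measurable_setT_ler f g : measurable_fun setT f -> measurable_fun setT g ->
  measurable [set x | f x <= g x].
Proof. by move=> mf mg; rewrite -[X in measurable X]setTI; exact: measurable_fun_le. Qed.

Lemma measurable_setT_ltr f g : measurable_fun setT f -> measurable_fun setT g ->
  measurable [set x | f x < g x].
Proof. by move=> mf mg; rewrite -[X in measurable X]setTI; exact: measurable_set_ltr. Qed.

End measurable_comparison.

Lemma markov_ge0 {R : realType} {d : measure_display} {T : measurableType d}
    (mu : {measure set T -> \bar R}) (g : T -> R) (a : R) :
  measurable_fun setT g -> (forall x, 0 <= g x) -> 0 < a ->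
  (mu [set x | (a <= g x)%R] <= a^-1%:E * \int[mu]_x (g x)%:E)%E.
Proof.
move=> mg g0 a0; rewrite lee_pdivlMl//.
have mgE : measurable_fun setT (EFin \o g) by exact/measurable_EFinP.
apply: le_trans (le_trans (le_integral_abse mu measurableT mgE a0) _).
- rewrite le_eqVlt; apply/orP; left; apply/eqP; congr (_ * mu _)%E.
  by apply/seteqP; split => x /=; rewrite lee_fin ger0_norm// => -[].
- rewrite le_eqVlt; apply/orP; left; apply/eqP; apply: eq_integral => x _.
  by rewrite /= ger0_norm.
Qed.

Section noise_sums.
Context {R : realType} {V : hilbertType R} {d : measure_display}
  {Omega : measurableType d} (P : probability Omega R) (W : V -> Omega -> R).
Hypothesis isoW : iso_gaussian P W.
Implicit Types (s : seq (R * V)) (h : V).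

(** Finite linear combinations as lists of coefficient-vector pairs, so that
    concrete identities between noise variables are list literals. *)
Definition vec_sum s : V := \sum_(p <- s) p.1 *: p.2.
Definition noise_sum s (w : Omega) : R := \sum_(p <- s) p.1 * W p.2 w.

Let vec_sumE s : vec_sum s =
  \sum_(i < size s) (tnth (in_tuple s) i).1 *: (tnth (in_tuple s) i).2.
Proof. by rewrite /vec_sum big_tnth. Qed.

Let noise_sumE s w : noise_sum s w =
  \sum_(i < size s) (tnth (in_tuple s) i).1 * W (tnth (in_tuple s) i).2 w.
Proof. by rewrite /noise_sum big_tnth. Qed.

Lemma measurable_noise_sum s : measurable_fun setT (noise_sum s).
Proof.
apply: measurable_sum => p; apply: measurable_funM => //.
exact: measurable_noise isoW _.
Qed.

Lemma noise_sum_sqr s :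
  (\int[P]_w (noise_sum s w ^+ 2)%:E = (`|vec_sum s| ^+ 2)%:E)%E.
Proof.
rewrite vec_sumE -(noise_comb_sqr isoW); apply: eq_integral => w _.
by rewrite noise_sumE.
Qed.

Lemma noise_sum_ae0 s : vec_sum s = 0 ->
  {ae P, forall w, noise_sum s w = 0}.
Proof.
rewrite vec_sumE => /(noise_comb_ae0 isoW).
by apply: filterS => w; rewrite noise_sumE.
Qed.

Lemma noise_sum_expR s :
  (\int[P]_w (expR (noise_sum s w))%:E = (expR (`|vec_sum s| ^+ 2 / 2))%:E)%E.
Proof.
rewrite vec_sumE -(noise_comb_expR isoW (fun i => (tnth (in_tuple s) i).2)
  (fun i => (tnth (in_tuple s) i).1)); apply: eq_integral => w _.
by rewrite noise_sumE.
Qed.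

(** Chernoff's bound, applied to both signs. *)
Lemma noise_sum_tail s (r u : R) : 0 < r -> 0 <= u -> `|vec_sum s| <= r ->
  (P [set w | (r * u < `|noise_sum s w|)%R] <= (2 * expR (- (u ^+ 2 / 2)))%R%:E)%E.
Proof.
move=> r0 u0 sr.
have one (t : seq (R * V)) : `|vec_sum t| <= r ->
    (P [set w | (r * u <= noise_sum t w)%R] <= (expR (- (u ^+ 2 / 2)))%R%:E)%E.
  move=> tr; pose t' := [seq ((u / r) * p.1, p.2) | p <- t].
  have nE w : noise_sum t' w = u / r * noise_sum t w.
    rewrite /noise_sum big_map mulr_sumr; apply: eq_bigr => p _.
    by rewrite mulrA.
  have vE : vec_sum t' = (u / r) *: vec_sum t.
    rewrite /vec_sum big_map scaler_sumr; apply: eq_bigr => p _.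
    by rewrite scalerA.
  have sub : [set w | r * u <= noise_sum t w] `<=`
      [set w | expR (u ^+ 2) <= expR (noise_sum t' w)].
    move=> w /= rw; rewrite ler_expR nE mulrAC ler_pdivlMr// expr2 -mulrA.
    by rewrite ler_wpM2l// mulrC.
  have mt := measurable_noise_sum t; have mt' := measurable_noise_sum t'.
  have me : measurable_fun setT (fun w => expR (noise_sum t' w)).
    exact: measurableT_comp.
  apply: le_trans (le_measure P _ _ sub) _.
  - by rewrite inE; exact: measurable_setT_ler.
  - by rewrite inE; exact: measurable_setT_ler.
  apply: le_trans (markov_ge0 P me _ _) _.
  - by move=> w; exact: expR_ge0.
  - exact: expR_gt0.
  rewrite noise_sum_expR -EFinM lee_fin -expRN -expRD ler_expR vE normrZ.
  rewrite ger0_norm ?divr_ge0 ?(ltW r0)// exprMn.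
  have : (u / r) ^+ 2 * `|vec_sum t| ^+ 2 <= u ^+ 2.
    rewrite exprMn exprVn mulrAC ler_pdivrMr ?exprn_gt0//.
    by rewrite ler_wpM2l ?sqr_ge0// lerXn2r ?nnegrE ?(ltW r0).
  lra.
pose s' := [seq (- p.1, p.2) | p <- s].
have n'E w : noise_sum s' w = - noise_sum s w.
  rewrite /noise_sum big_map -sumrN; apply: eq_bigr => p _.
  by rewrite mulNr.
have v'E : vec_sum s' = - vec_sum s.
  rewrite /vec_sum big_map -sumrN; apply: eq_bigr => p _.
  by rewrite scaleNr.
have sub : [set w | r * u < `|noise_sum s w|] `<=`
    [set w | r * u <= noise_sum s w] `|` [set w | r * u <= noise_sum s' w].
  move=> w /=; rewrite n'E lter_normr => /orP[/ltW|/ltW]; [left|right] => //.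
have m1 t : measurable [set w | r * u <= noise_sum t w].
  by apply: measurable_setT_ler => //; exact: measurable_noise_sum.
apply: le_trans (le_measure P _ _ sub) _.
- rewrite inE; apply: measurable_setT_ltr => //.
  by apply: measurableT_comp => //; exact: measurable_noise_sum.
- by rewrite inE; exact: measurableU.
apply: le_trans (measureU2 _ (m1 _) (m1 _)) _.
rewrite mulr_natl mulr2n EFinD leeD ?one// v'E normrN//.
Qed.

End noise_sums.

Lemma summable_tail {R : realType} (b : nat -> R) (C : R) :
  (forall j, 0 <= b j) -> (forall m, \sum_(j < m) b j <= C) ->
  forall e, 0 < e -> exists J, forall m, \sum_(j < m) b (J + j)%N <= e.
Proof.
move=> b0 bC e e0; pose A := [set \sum_(j < m) b j | m in [set: nat]].
have supA : has_sup A.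
  by split; [exists (\sum_(j < 0) b j); exists 0%N | exists C => _ [m _ <-]].
have [_ [J _ <-] hJ] := sup_adherent e0 supA; exists J => m.
have : \sum_(j < J + m) b j <= sup A by apply: ub_le_sup; [case: supA|exists (J + m)%N].
by rewrite big_split_ord/=; move: hJ; lra.
Qed.

Lemma measure_bigsetU_le {R : realType} {d : measure_display}
    {T : measurableType d} (mu : {measure set T -> \bar R}) (I : finType)
    (A : I -> set T) (x : R) :
  (forall i, measurable (A i)) -> (forall i, (mu (A i) <= x%:E)%E) ->
  (mu (\big[setU/set0]_i A i) <= (#|I|%:R * x)%:E)%E.
Proof.
move=> mA Ax.
suff h (s : seq I) : (mu (\big[setU/set0]_(i <- s) A i) <= ((size s)%:R * x)%:E)%E.
  by have := h (enum I); rewrite big_enum -cardE.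
elim: s => [|i s IH]; first by rewrite big_nil measure0 mul0r.
rewrite big_cons (le_trans (measureU2 _ _ _))//; first exact: bigsetU_measurable.
by rewrite /= -natr1 mulrDl mul1r addrC EFinD leeD.
Qed.

(** * The modulus of continuity of the noise *)

Section modulus.
Context {R : realType} {V : hilbertType R} {d : measure_display}
  {Omega : measurableType d} (P : probability Omega R) (W : V -> Omega -> R).
Hypothesis isoW : iso_gaussian P W.

Local Notation h j := ((2^-1 : R) ^+ j.+1).

Let h0 j : 0 < h j. Proof. by rewrite exprn_gt0. Qed.

Let hS j : h j.+1 = h j / 2. Proof. by rewrite exprS mulrC. Qed.

Let half_small (e : R) : 0 < e -> exists k, forall j, (k <= j)%N -> h j <= e.
Proof.
move=> e0; have half1 : `|2^-1 : R| < 1 by rewrite ger0_norm//; lra.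
have /cvgr0Pnorm_lt /(_ e e0) [k _ kh] := cvg_expr half1.
exists k => j kj; apply: ltW; have := kh j.+1 (leqW kj).
by rewrite /= ger0_norm// exprn_ge0.
Qed.

Let expRN_half j : expR (- j.+1%:R) <= h j :> R.
Proof.
have -> : - j.+1%:R = j.+1%:R * (- 1) :> R by rewrite mulrN1.
rewrite expRM_natl.
rewrite lerXn2r ?nnegrE ?expR_ge0// expRN lef_pV2 ?posrE ?expR_gt0//.
by have := expR_ge1Dx (1 : R); lra.
Qed.

Let sum_half m : \sum_(j < m) h j * j.+1%:R <= 2.
Proof.
suff -> : \sum_(j < m) h j * j.+1%:R = 2 - (m.+2)%:R * 2^-1 ^+ m.
  by rewrite lerBlDr lerDl mulr_ge0// exprn_ge0.
elim: m => [|m IH]; first by rewrite big_ord0 expr0 mulr1 subrr.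
rewrite big_ord_recr/= IH -[m.+3]addn3 -[m.+2]addn2 -[m.+1]addn1 !natrD exprD.
by rewrite expr1; field.
Qed.

Let sum_half1 m : \sum_(j < m) h j <= 1.
Proof.
suff -> : \sum_(j < m) h j = 1 - 2^-1 ^+ m.
  by rewrite lerBlDr lerDl exprn_ge0.
elim: m => [|m IH]; first by rewrite big_ord0 expr0 subrr.
by rewrite big_ord_recr/= IH exprS; field.
Qed.

Let thr (N N' j : nat) : R :=
  2 * h j * (2 * Num.sqrt (ln N%:R) + 2 * Num.sqrt (ln N'%:R) + 2 * j.+1%:R).

Let diff (x y : V) : seq (R * V) := [:: (1, x); (-1, y)].

(** The exceptional event that two centres of consecutive nets lie close but
    carry very different noise. *)
Let link (N N' j : nat) (c : 'I_N -> V) (c' : 'I_N' -> V) : set Omega :=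
  \big[setU/set0]_(p : 'I_N * 'I_N')
    if `|c' p.2 - c p.1| <= 2 * h j
    then [set w | thr N N' j < `|noise_sum W (diff (c' p.2) (c p.1)) w|]
    else set0.

Let measurable_link N N' j c c' : measurable (@link N N' j c c').
Proof.
apply: bigsetU_measurable => p _; case: ifP => // _.
apply: measurable_setT_ltr => //; apply: measurableT_comp => //.
exact: (measurable_noise_sum isoW).
Qed.

Let link_prob N N' j c c' : (0 < N)%N -> (0 < N')%N ->
  (P (@link N N' j c c') <= (2 * h j)%R%:E)%E.
Proof.
move=> N0 N'0; pose u : R := 2 * Num.sqrt (ln N%:R) + 2 * Num.sqrt (ln N'%:R) + 2 * j.+1%:R.
have u0 : 0 <= u by rewrite !addr_ge0// mulr_ge0// sqrtr_ge0.
apply: le_trans (@measure_bigsetU_le _ _ _ P _ _ (2 * expR (- (u ^+ 2 / 2))) _ _) _.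
- move=> p; case: ifP => // _; apply: measurable_setT_ltr => //.
  by apply: measurableT_comp => //; exact: (measurable_noise_sum isoW).
- move=> p; case: ifP => [cc|_]; last first.
    by rewrite measure0 lee_fin mulr_ge0// expR_ge0.
  apply: (@noise_sum_tail _ _ _ _ _ _ isoW (diff (c' p.2) (c p.1)) (2 * h j)) => //.
  by rewrite /vec_sum !big_cons big_nil addr0 scale1r scaleN1r.
rewrite card_prod !card_ord lee_fin natrM mulrCA ler_pM2l//.
apply: le_trans (expRN_half j).
rewrite -[X in X * _ * _]lnK ?posrE ?ltr0n// -[X in _ * X * _]lnK ?posrE ?ltr0n//.
rewrite -!expRD ler_expR.
have sq M : (0 < M)%N -> Num.sqrt (ln M%:R) ^+ 2 = ln M%:R :> R.
  by move=> M0; rewrite sqr_sqrtr// ln_ge0// ler1n.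
rewrite -(sq N)// -(sq N')// /u.
have := sqrtr_ge0 (ln (N%:R : R)); have := sqrtr_ge0 (ln (N'%:R : R)).
have : 1 <= j.+1%:R :> R by rewrite ler1n.
move: (Num.sqrt (ln N%:R)) (Num.sqrt (ln N'%:R)) (j.+1%:R) => x y z z1 y0 x0.
have xy : 0 <= x * y by rewrite mulr_ge0.
have xz : 0 <= x * z by rewrite mulr_ge0//; lra.
have yz : 0 <= y * z by rewrite mulr_ge0//; lra.
have zz : z <= z * z by rewrite ler_peMl//; lra.
nra.
Qed.

Let sum_thr (N : nat -> nat) (C : R) m : 0 <= C ->
  (forall m, \sum_(j < m) h j * Num.sqrt (ln (N j)%:R) <= C) ->
  \sum_(j < m) thr (N j) (N j.+1) j <= 12 * C + 8.
Proof.
move=> C0 NC.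
have -> : \sum_(j < m) thr (N j) (N j.+1) j =
    4 * (\sum_(j < m) h j * Num.sqrt (ln (N j)%:R)) +
    8 * (\sum_(j < m) h j.+1 * Num.sqrt (ln (N j.+1)%:R)) +
    4 * \sum_(j < m) h j * j.+1%:R.
  rewrite !mulr_sumr -!big_split/=; apply: eq_bigr => j _.
  by rewrite /thr hS; field.
have := NC m.+1; rewrite big_ord_recl/= => h1.
have : 0 <= h 0 * Num.sqrt (ln (N 0)%:R) by rewrite mulr_ge0 ?sqrtr_ge0.
by have := NC m; have := sum_half m; lra.
Qed.

(** Dudley's chaining bound, in the form of an event that does not depend on the
    index: the process has no separable version here, so that the bound can only
    hold almost surely for each index separately. *)
Lemma noise_modulus (B : set V) (delta kappa : R) :
  (entropy_integral B < +oo)%E -> 0 < delta -> 0 < kappa ->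
  exists sigma (G : set Omega),
    [/\ 0 < sigma, measurable G, (P (~` G) <= kappa%:E)%E &
        forall g, B g -> `|g| <= sigma ->
          P (G `&` [set w | delta < `|W g w|]) = 0%E].
Proof.
move=> Bfin d0 k0.
have [B0|B0] := pselect (B !=set0); last first.
  exists 1, setT; rewrite setCT measure0 lee_fin ltW//; split => // g Bg.
  by case: B0; exists g.
have [N [c [C [N0 cB NC]]]] := entropy_nets B0 Bfin.
have C0 : 0 <= C by have := NC 0%N; rewrite big_ord0.
pose b j := thr (N j) (N j.+1) j + h j.
have thr0 M M' j : 0 <= thr M M' j.
  by rewrite /thr mulr_ge0 ?addr_ge0 ?mulr_ge0 ?sqrtr_ge0// ltW.
have b0 j : 0 <= b j by rewrite addr_ge0// ltW.
have bC m : \sum_(j < m) b j <= 12 * C + 9.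
  by rewrite big_split/=; have := sum_thr m C0 NC; have := sum_half1 m; lra.
pose e := Num.min (delta / 4) (kappa / 8).
have e0 : 0 < e by rewrite lt_min !divr_gt0.
have [ed ek] : e <= delta / 4 /\ e <= kappa / 8 by rewrite !ge_min !lexx orbT.
have [J bJ] := summable_tail b0 bC e0.
have bJ1 : b J <= e by have := bJ 1%N; rewrite big_ord1 addn0.
pose z : 'I_1 -> V := fun=> 0.
pose F0 := link J z (c J).
pose F k := link (J + k) (c (J + k)%N) (c (J + k).+1).
have mF k : measurable (F k) by exact: measurable_link.
have mF0 : measurable F0 by exact: measurable_link.
have mU : measurable (\bigcup_k F k) by exact: bigcup_measurable.
have PU : (P (\bigcup_k F k) <= (2 * e)%:E)%E.
  apply: le_trans (measure_sigma_subadditive _ mF mU (@subset_refl _ _)) _.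
  apply: lime_le; first by apply: is_cvg_nneseries => *; exact: measure_ge0.
  apply: nearW => m; rewrite big_mkord.
  apply: (@le_trans _ _ (\sum_(k < m) (2 * b (J + k)%N)%:E)%E).
    apply: lee_sum => k _; apply: le_trans (link_prob _ _ _ _ _) _ => //.
    by rewrite lee_fin ler_pM2l// lerDr.
  by rewrite sumEFin lee_fin -mulr_sumr ler_pM2l.
have P0 : (P F0 <= (2 * e)%:E)%E.
  apply: le_trans (link_prob _ _ _ _ _) _ => //.
  rewrite lee_fin ler_pM2l// (le_trans _ bJ1)// lerDr//.
exists (h J), (~` (F0 `|` \bigcup_k F k)); split => //.
- by apply: measurableC; exact: measurableU.
- rewrite setCK (le_trans (measureU2 _ _ _))// (le_trans (leeD P0 PU))//.
  by rewrite -EFinD lee_fin; lra.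
move=> g Bg gJ; set G := ~` _.
have mG : measurable G by apply: measurableC; exact: measurableU.
have ex j : exists i : 'I_(N j), `|c j i - g| < h j.
  by have [i _] := cB j _ Bg; rewrite -ball_normE; exists i.
pose I j := projT1 (cid (ex j)).
have IP j : `|c j (I j) - g| < h j by exact: (projT2 (cid (ex j))).
pose cg j := c j (I j).
have step k w : G w -> `|W (cg (J + k)%N) w - W 0 w| <=
    thr 1 (N J) J + \sum_(j < k) thr (N (J + j)%N) (N (J + j).+1) (J + j)%N.
  move=> Gw; elim: k => [|k IH].
    rewrite big_ord0 addr0 addn0 leNgt; apply/negP => lt; apply: Gw; left.
    rewrite /F0 /link (bigD1 (ord0, I J))//=; left.
    rewrite subr0 ifT; last first.
      have := ler_normD (c J (I J) - g) g; rewrite subrK.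
      by have := IP J; move: gJ; lra.
    by rewrite /= /noise_sum !big_cons big_nil addr0 mul1r mulN1r.
  have st : `|W (cg (J + k).+1) w - W (cg (J + k)%N) w| <=
      thr (N (J + k)%N) (N (J + k).+1) (J + k)%N.
    rewrite leNgt; apply/negP => lt; apply: Gw; right; exists k => //.
    rewrite /F /link (bigD1 (I (J + k)%N, I (J + k).+1))//=; left.
    rewrite ifT; last first.
      have -> : c (J + k).+1 (I (J + k).+1) - c (J + k)%N (I (J + k)%N) =
        (c (J + k).+1 (I (J + k).+1) - g) - (c (J + k)%N (I (J + k)%N) - g).
        by rewrite opprB addrA subrK.
      apply: le_trans (ler_normB _ _) _; have := IP (J + k)%N.
      by have := IP (J + k).+1; rewrite hS; have := h0 (J + k)%N; lra.
    by rewrite /= /noise_sum !big_cons big_nil addr0 mul1r mulN1r.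
  rewrite big_ord_recr/= addnS.
  have := ler_normD (W (cg (J + k).+1) w - W (cg (J + k)%N) w)
    (W (cg (J + k)%N) w - W 0 w).
  by rewrite addrA subrK; move: IH st; lra.
have bound k w : G w -> `|W (cg (J + k)%N) w - W 0 w| <= delta / 2.
  move=> Gw; apply: le_trans (step k w Gw) _.
  have s1 : thr 1 (N J) J <= b J.
    apply: le_trans (_ : thr (N J) (N J.+1) J <= _); last first.
      by rewrite lerDl ltW.
    rewrite /thr ler_wpM2l ?mulr_ge0 ?(ltW (h0 J))//.
    by rewrite ln1 sqrtr0; have := sqrtr_ge0 (ln ((N J.+1)%:R : R)); lra.
  have : \sum_(j < k) thr (N (J + j)%N) (N (J + j).+1) (J + j)%N <= e.
    apply: le_trans (bJ k); apply: ler_sum => j _.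
    by rewrite lerDl ltW.
  by move: s1 bJ1 ed; lra.
pose s k := [:: (1, g); (-1, cg (J + k)%N); (1, 0)] : seq (R * V).
have mE : measurable (G `&` [set w | delta < `|W g w|]).
  apply: measurableI => //; apply: measurable_setT_ltr => //.
  by apply: measurableT_comp => //; exact: measurable_noise isoW _.
have small k : (P (G `&` [set w | (delta < `|W g w|)%R]) <=
    ((delta / 2) ^- 2 * h (J + k)%N)%R%:E)%E.
  have ms := measurable_noise_sum isoW (s k).
  have ms2 : measurable_fun setT (fun w => noise_sum W (s k) w ^+ 2).
    exact: measurable_funX.
  have d20 : 0 < (delta / 2) ^+ 2 by rewrite exprn_gt0// divr_gt0.
  apply: (@le_trans _ _ (P [set w | ((delta / 2) ^+ 2 <= noise_sum W (s k) w ^+ 2)%R])).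
    apply: le_measure; rewrite ?inE//; first exact: measurable_setT_ler.
    move=> w [Gw /= dw]; rewrite -[leRHS]real_normK ?num_real//.
    rewrite lerXn2r ?nnegrE ?divr_ge0 ?(ltW d0)//.
    rewrite /s /noise_sum !big_cons big_nil addr0 !mul1r mulN1r.
    have := ler_normD (W g w + (- W (cg (J + k)%N) w + W 0 w))
      (W (cg (J + k)%N) w - W 0 w).
    have := bound k w Gw; move: dw => /=.
    move: (W g w) (W (cg (J + k)%N) w) (W 0 w) => x y y0.
    by rewrite (_ : x + (- y + y0) + (y - y0) = x); [lra | ring].
  apply: le_trans (markov_ge0 P ms2 (fun=> sqr_ge0 _) d20) _.
  rewrite (noise_sum_sqr isoW)// -EFinM lee_fin ler_wpM2l ?invr_ge0 ?(ltW d20)//.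
  rewrite /vec_sum !big_cons big_nil !addr0 scaler0 addr0 scale1r scaleN1r.
  rewrite distrC.
  have := IP (J + k)%N; have h1 : h (J + k)%N <= 1 by rewrite exprn_ile1//; lra.
  rewrite -/(cg _); have := normr_ge0 (cg (J + k)%N - g); have := h0 (J + k)%N.
  move: `|_ - g| h1 => x h1 hk x0 xh; rewrite expr2.
  apply: le_trans (_ : h (J + k)%N * 1 <= _); last by rewrite mulr1.
  by rewrite ler_pM// ltW//; lra.
apply/eqP; rewrite eq_le measure_ge0 andbT.
apply/lee_addgt0Pr => x x0; rewrite add0e.
have d20 : 0 < (delta / 2) ^+ 2 by rewrite exprn_gt0// divr_gt0.
have [k hk] := half_small (mulr_gt0 x0 d20).
apply: le_trans (small k) _; rewrite lee_fin mulrC ler_pdivrMr//.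
by apply: hk; rewrite leq_addl.
Qed.

End modulus.

(** * Borel measurability in separable normed spaces *)

Section borel_measurability.
Context {R : realType}.

Lemma borel_ball {V : normedModType R} (c : V) (r : R) :
  measurable ([set x | `|x - c| < r] : set (borel V)).
Proof.
have [r0|r0] := ltP 0 r; last first.
  rewrite (_ : [set _ | _] = set0)//; apply/seteqP; split => x //=.
  by move=> xr; have := le_lt_trans (normr_ge0 _) xr; rewrite ltNge r0.
apply: sub_sigma_algebra; rewrite (_ : [set _ | _] = ball c r).
  exact: ball_open.
by rewrite -ball_normE; apply/seteqP; split => x /=; rewrite distrC.
Qed.

Lemma measurable_continuous {V V' : normedModType R} (f : V -> V') :
  continuous f -> measurable_fun setT (f : borel V -> borel V').
Proof.
move=> cf; apply: (@measurability _ _ (borel V) (borel V') setT f (@open V')) => //.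
move=> _ [U oU <-]; rewrite setTI; apply: sub_sigma_algebra.
by move/continuousP: cf => /(_ _ oU).
Qed.

Lemma measurable_borel_norm {V : normedModType R} (c : V) :
  measurable_fun setT ((fun x => `|x - c|) : borel V -> R).
Proof.
apply: (measurability (@RGenOInfty.G R)) => [|/= _ [_] [r] -> <-].
  exact: RGenOInfty.measurableE.
rewrite setTI (_ : _ @^-1` _ = ~` \bigcap_n [set x : borel V | `|x - c| < r + n.+1%:R^-1]).
  by apply: measurableC; apply: bigcapT_measurable => n; exact: borel_ball.
apply/seteqP; split => x /=; rewrite in_itv/= andbT.
  move=> /ltr_add_invr[k kx] h; have := h k I => /= /(lt_trans kx).
  by rewrite ltxx.
move=> h; rewrite ltNge; apply/negP => xr; apply: h => n _ /=.
by rewrite (le_lt_trans xr)// ltrDl invr_gt0.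
Qed.

Lemma separable_seq {V : normedModType R} : separable V ->
  exists s : nat -> V, forall x (e : R), 0 < e -> exists k, `|s k - x| < e.
Proof.
move=> [D /countable_injP[i iD] dD].
exists (fun k => xget 0 [set c | D c /\ i c = k]) => x e e0.
have [c [cx Dc]] : ball x e `&` D !=set0.
  by apply: dD; [exists x; exact: ballxx|exact: ball_open].
exists (i c); set y := xget _ _.
have [Dy iy] : D y /\ i y = i c.
  by apply: (@xgetPex _ 0 [set z | D z /\ i z = i c]); exists c.
have -> : y = c by apply: iD => //; rewrite inE.
by move: cx; rewrite -ball_normE/= distrC.
Qed.

(** In a separable space the Borel sets are generated by the balls. *)
Lemma measurable_borel_balls {d : measure_display} {T : measurableType d}
    {V : normedModType R} (sepV : separable V) (D : set T) (f : T -> V) :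
  measurable D ->
  (forall (c : V) (r : R), measurable (D `&` [set x | `|f x - c| < r])) ->
  measurable_fun D (f : T -> borel V).
Proof.
move=> mD fb; have [s sP] := separable_seq sepV.
apply: (@measurability _ _ T (borel V) D f (@open V)) => //.
move=> _ [U oU <-].
pose B (c : V) (r : rat) := [set x : V | `|x - c| < ratr r].
have -> : D `&` f @^-1` U = \bigcup_k \bigcup_r
    (if `[< B (s k) r `<=` U >] then D `&` [set x | `|f x - s k| < ratr r]
     else set0).
  apply/seteqP; split => [x [Dx Ux]|x [k _ [r _]]]; last first.
    by case: ifPn => // /asboolP rU [Dx fx]; split => //; exact: rU.
  have := oU; rewrite openE => /(_ _ Ux) /nbhs_ballP[e /= e0 eU].
  have e20 : 0 < e / 2 by rewrite divr_gt0.
  have [k sk] := sP (f x) _ e20; exists k => //.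
  have [r rI] := rat_in_itvoo sk.
  move: rI; rewrite in_itv/= => /andP[r1 r2]; exists r => //.
  rewrite ifT; first by split => //=; rewrite distrC.
  apply/asboolP => y yr; apply: eU; rewrite -ball_normE/=.
  have := ler_distD (s k) (f x) y; rewrite (distrC (s k) y).
  by move: yr; rewrite /B/= (distrC (f x) (s k)); move: r1 r2; lra.
apply: bigcup_measurable => k _; apply: bigcupT_measurable_rat => r.
by case: ifP.
Qed.

(** The Lipschitz bound lets the real variable range over countably many points:
    membership of [g x t] in a ball is witnessed, with some margin, at a chosen
    point of a small rational interval around [x]. *)
Lemma measurable_caratheodory {d : measure_display} {T : measurableType d}
    {V : normedModType R} (sepV : separable V)
    (D : set (measurableTypeR R)) (E : set T) (g : R -> T -> V) (N : T -> R) :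
  measurable D -> measurable E ->
  (forall x, D x -> measurable_fun E (g x : T -> borel V)) ->
  measurable_fun E N ->
  (forall x y t, D x -> D y -> E t -> `|g x t - g y t| <= `|x - y| * N t) ->
  measurable_fun (D `*` E) ((fun z => g z.1 z.2) : measurableTypeR R * T -> borel V).
Proof.
move=> mD mE mg mN gN.
pose A := [set ab : rat * rat | exists x, D x /\ ratr ab.1 < x < ratr ab.2].
pose s (ab : rat * rat) : R := xget 0 [set x | D x /\ ratr ab.1 < x < ratr ab.2].
have sP ab : A ab -> D (s ab) /\ ratr ab.1 < s ab < ratr ab.2.
  exact: xgetPex.
apply: measurable_borel_balls => //; first exact: measurableX.
move=> c r.
pose G (ab : rat * rat) (q : rat) : set (measurableTypeR R * T) :=
  if `[< A ab >] then
    [set z | D z.1 /\ E z.2 /\ `|z.1 - s ab| * N z.2 < ratr q /\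
             `|g (s ab) z.2 - c| < r - ratr q]
  else set0.
have -> : D `*` E `&` [set z | `|g z.1 z.2 - c| < r] =
    \bigcup_ab \bigcup_q G ab q.
  apply/seteqP; split => [[x t] [[/= Dx Et] xr]|[x t] [ab _ [q _]]]; last first.
    rewrite /G; case: ifPn => // /asboolP /sP [Ds _] /= [Dx [Et [xs sr]]].
    split => //=; have := ler_distD (g (s ab) t) (g x t) c.
    by have := gN _ _ _ Dx Ds Et; lra.
  have [m [m0 rm]] : exists m : R, 0 < m /\ `|g x t - c| + 5 * m < r.
    by exists ((r - `|g x t - c|) / 6); move: xr => /=; split; lra.
  have N1 : 0 < `|N t| + 1 by rewrite ltr_wpDl.
  pose e : R := m / (`|N t| + 1).
  have e0 : 0 < e by rewrite divr_gt0.
  have aE : (x : R) - e < x by rewrite ltrBlDr ltrDl.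
  have [a aI] := rat_in_itvoo aE.
  move: aI; rewrite in_itv/= => /andP[a1 a2].
  have bE : (x : R) < x + e by rewrite ltrDl.
  have [b bI] := rat_in_itvoo bE.
  move: bI; rewrite in_itv/= => /andP[b1 b2].
  have qE : 2 * m < 3 * m by lra.
  have [q qI] := rat_in_itvoo qE.
  move: qI; rewrite in_itv/= => /andP[q1 q2].
  have Aab : A (a, b) by exists x; rewrite a2 b1.
  exists (a, b) => //; exists q => //; rewrite /G ifT; last exact/asboolP.
  have [Ds /= /andP[s1 s2]] := sP _ Aab.
  have xs : `|x - s (a, b)| < 2 * e by rewrite ltr_norml; apply/andP; split; lra.
  have xN : `|x - s (a, b)| * `|N t| <= 2 * m.
    have : `|x - s (a, b)| * (`|N t| + 1) <= 2 * e * (`|N t| + 1).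
      by rewrite ler_pM2r// ltW.
    have -> : 2 * e * (`|N t| + 1) = 2 * m by rewrite -mulrA divfK ?gt_eqF.
    by rewrite mulrDr mulr1; have := normr_ge0 (x - s (a, b)); lra.
  have xN' : `|x - s (a, b)| * N t <= 2 * m.
    by apply: le_trans xN; rewrite ler_wpM2l// ler_norm.
  split => //; split => //; split => /=; first by lra.
  have := ler_distD (g x t) (g (s (a, b)) t) c; rewrite (distrC (g (s (a, b)) t) (g x t)).
  by have := gN _ _ _ Dx Ds Et; lra.
apply: countable_bigcupT_measurable => // -[a b].
apply: bigcupT_measurable_rat => q; rewrite /G; case: ifPn => // /asboolP /sP [Ds _].
have -> : [set z : measurableTypeR R * T | D z.1 /\ E z.2 /\
      `|z.1 - s (a, b)| * N z.2 < ratr q /\ `|g (s (a, b)) z.2 - c| < r - ratr q] =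
    (D `*` E `&` [set z | `|z.1 - s (a, b)| * N z.2 < ratr q]) `&`
    (setT `*` (E `&` [set x | `|g (s (a, b)) x - c| < r - ratr q])).
  apply/seteqP; split => z /=; first by move=> [? [? [? ?]]].
  by move=> [[[? ?] ?] [_ [? ?]]].
apply: measurableI.
  apply: measurable_set_ltr => //; first exact: measurableX.
  apply: measurable_funM.
    apply: measurable_funTS; apply: measurableT_comp => //.
    by apply: measurable_funD => //; exact: measurable_fst.
  apply: (measurable_comp mE _ mN) => /=; first by move=> _ [z [? ?] <-].
  by apply: measurable_funTS; exact: measurable_snd.
apply: measurableX => //.
apply: measurable_set_ltr => //.
apply: (measurable_comp _ _ (@measurable_borel_norm _ c)) => //.
exact: mg.
Qed.

End borel_measurability.

(** * Normed subspaces *)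

Section normed_subspaces.
Context {R : realType} {V : lmodType R} {E : set V} {N : V -> R}.
Hypothesis subE : normed_subspace E N.

Lemma subspaceD x y : E x -> E y -> E (x + y).
Proof. by move=> Ex Ey; have := subspace_lin subE 1 Ex Ey; rewrite scale1r. Qed.

Lemma subspaceZ a x : E x -> E (a *: x).
Proof. by move=> Ex; have := subspace_lin subE a Ex (subspace0 subE); rewrite addr0. Qed.

Lemma subspaceN x : E x -> E (- x).
Proof. by move=> Ex; rewrite -scaleN1r; exact: subspaceZ. Qed.

Lemma subspaceB x y : E x -> E y -> E (x - y).
Proof. by move=> Ex Ey; apply: subspaceD => //; exact: subspaceN. Qed.

Lemma subspace_normN x : E x -> N (- x) = N x.
Proof. by move=> Ex; rewrite -scaleN1r (subspace_normZ subE)// normrN1 mul1r. Qed.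

Lemma subspace_normB x y : E x -> E y -> N (x - y) <= N x + N y.
Proof.
move=> Ex Ey; rewrite -(subspace_normN Ey); apply: subspace_normD subE _ _ _ _ => //.
exact: subspaceN.
Qed.

Lemma subspace_norm_ge0 x : E x -> 0 <= N x.
Proof.
move=> Ex; have := subspace_normB Ex Ex; rewrite subrr.
have -> : N 0 = 0 by rewrite -(scale0r 0) (subspace_normZ subE _ (subspace0 subE)) normr0 mul0r.
lra.
Qed.

End normed_subspaces.

(** Vector identities are checked on inner products, where they are ring
    identities. *)
Lemma dotp_inj {R : realType} {V : hilbertType R} (x y : V) :
  (forall e, dotp x e = dotp y e) -> x = y.
Proof.
move=> xy; apply/eqP; rewrite -subr_eq0 -normr_eq0 -sqrf_eq0 -dotp_norm.
by rewrite dotpBl xy subrr.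
Qed.

Ltac vector := apply: dotp_inj => ?;
  rewrite ?(dotpBl, dotpDl, dotpNl, dotpZl, dotp0l); ring.

(** * The operators as functions of the parameter *)

Section operator_expansion.
Context {R : realType} {H1 H2 : hilbertType R} (Theta : set R)
  (K : R -> {linear H1 -> H2}) (H : set H1) (normH : H1 -> R)
  (subH : normed_subspace H normH) (Kdot : R -> H1 -> H2) (D1 c3 : R).
Hypotheses (c3_ge0 : 0 <= c3)
  (K_le : forall theta f, Theta theta -> H f -> `|Kdot theta f| <= D1 * `|f|)
  (K_taylor : forall theta theta1 f, Theta theta -> Theta theta1 -> H f ->
    `|K theta f - K theta1 f - (theta - theta1) *: Kdot theta1 f|
      <= c3 * `|theta - theta1| ^+ 2 * normH f).
Variables (theta0 r : R).
Hypotheses (r_gt0 : 0 < r) (rTheta : forall theta, `|theta - theta0| < r -> Theta theta).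

Let Theta0 : Theta theta0. Proof. by apply: rTheta; rewrite subrr normr0. Qed.

(** The Taylor bound determines the derivative up to a second order error, so
    that it inherits linearity from the operators. *)
Lemma Kdot_linear a f g : H f -> H g ->
  Kdot theta0 (a *: f + g) = a *: Kdot theta0 f + Kdot theta0 g.
Proof.
move=> Hf Hg; have Hfg := subspace_lin subH a Hf Hg.
set v := Kdot theta0 (a *: f + g); set w := _ + _.
apply/eqP; rewrite -subr_eq0 -normr_eq0 eq_le normr_ge0 andbT.
pose C := c3 * (normH (a *: f + g) + `|a| * normH f + normH g).
have N0 := subspace_norm_ge0 subH.
have C0 : 0 <= C * r by rewrite mulr_ge0 ?(ltW r_gt0)// mulr_ge0// !addr_ge0 ?mulr_ge0 ?N0.
apply: (le_of_perturbation C0) => e e0 e1; rewrite add0r.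
pose t := r * e; have t0 : 0 < t by rewrite mulr_gt0.
have Tt : Theta (theta0 + t).
  by apply: rTheta; rewrite addrAC subrr add0r gtr0_norm// /t gtr_pMr//; lra.
have tay h : H h -> `|K (theta0 + t) h - K theta0 h - t *: Kdot theta0 h| <= c3 * t ^+ 2 * normH h.
  by move=> Hh; have := K_taylor Tt Theta0 Hh; rewrite (_ : theta0 + t - theta0 = t) ?(gtr0_norm t0)//; ring.
have : t * `|v - w| <= c3 * t ^+ 2 * (normH (a *: f + g) + `|a| * normH f + normH g).
  rewrite -[X in X * _](gtr0_norm t0) -normrZ.
  have -> : t *: (v - w) =
     a *: (K (theta0 + t) f - K theta0 f - t *: Kdot theta0 f) +
     (K (theta0 + t) g - K theta0 g - t *: Kdot theta0 g) -
     (K (theta0 + t) (a *: f + g) - K theta0 (a *: f + g) - t *: v).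
    by rewrite !linearP /w; vector.
  apply: le_trans (ler_normB _ _) _.
  have := ler_normD (a *: (K (theta0 + t) f - K theta0 f - t *: Kdot theta0 f))
     (K (theta0 + t) g - K theta0 g - t *: Kdot theta0 g).
  have := tay _ Hf; have := tay _ Hg; have := tay _ Hfg; rewrite normrZ => q1 q2 q3 q4.
  have : `|a| * `|K (theta0 + t) f - K theta0 f - t *: Kdot theta0 f| <=
     `|a| * (c3 * t ^+ 2 * normH f) by rewrite ler_wpM2l.
  by rewrite /v; lra.
move=> h; rewrite -(ler_pM2l t0); apply: le_trans h _.
by rewrite /C /t le_eqVlt; apply/orP; left; apply/eqP; ring.
Qed.

Lemma KdotD a f g : H f -> H g ->
  Kdot theta0 (f + a *: g) = Kdot theta0 f + a *: Kdot theta0 g.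
Proof. by move=> Hf Hg; rewrite addrC Kdot_linear// addrC. Qed.

(** Subdividing the segment makes the second order terms disappear, so that the
    norm of [H] does not enter the bound. *)
Lemma K_lipschitz theta g : 0 <= D1 -> `|theta - theta0| < r -> H g ->
  `|K theta g - K theta0 g| <= D1 * `|theta - theta0| * `|g|.
Proof.
move=> D0 tr Hg; set t := theta - theta0.
have N0 := subspace_norm_ge0 subH Hg.
pose C := c3 * t ^+ 2 * normH g.
have C0 : 0 <= C by rewrite mulr_ge0// mulr_ge0// sqr_ge0.
apply: (le_of_perturbation C0) => e e0 e1.
have [n ne] : exists n : nat, n.+1%:R^-1 < e.
  by have [n] := ltr_add_invr e0; rewrite add0r; exists n.
pose h := t / n.+1%:R; pose th i := theta0 + i%:R * h.
have n0 : (n.+1%:R : R) != 0 by [].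
have thT i : (i <= n.+1)%N -> Theta (th i).
  move=> i_n; apply: rTheta; rewrite /th addrAC subrr add0r /h mulrCA normrM.
  apply: le_lt_trans tr; rewrite ler_piMr// ger0_norm ?divr_ge0//.
  by rewrite ler_pdivrMr// mul1r ler_nat.
have st i : (i < n.+1)%N -> `|K (th i.+1) g - K (th i) g| <=
    `|h| * (D1 * `|g|) + c3 * h ^+ 2 * normH g.
  move=> i_n; have := K_taylor (thT _ i_n) (thT _ (ltnW i_n)) Hg.
  have -> : th i.+1 - th i = h by rewrite /th -natr1; ring.
  rewrite real_normK ?num_real// => q.
  have := ler_normD (K (th i.+1) g - K (th i) g - h *: Kdot (th i) g) (h *: Kdot (th i) g).
  rewrite subrK normrZ.
  have : `|h| * `|Kdot (th i) g| <= `|h| * (D1 * `|g|).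
    by rewrite ler_wpM2l// K_le//; exact: thT (ltnW i_n).
  lra.
have sum m : (m <= n.+1)%N -> `|K (th m) g - K theta0 g| <=
    m%:R * (`|h| * (D1 * `|g|) + c3 * h ^+ 2 * normH g).
  elim: m => [|m IH] mn; first by rewrite /th !mul0r addr0 subrr normr0.
  have := ler_normD (K (th m.+1) g - K (th m) g) (K (th m) g - K theta0 g).
  rewrite addrA subrK -natr1 mulrDl mul1r.
  by have := IH (ltnW mn); have := st _ mn; lra.
have := sum _ (leqnn _); have -> : th n.+1 = theta.
  by rewrite /th /h mulrCA divff// mulr1 /t addrC subrK.
move/le_trans; apply.
have -> : n.+1%:R * (`|h| * (D1 * `|g|) + c3 * h ^+ 2 * normH g) =
    D1 * `|t| * `|g| + C * n.+1%:R^-1.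
  rewrite /h normrM normfV (ger0_norm (ler0n R n.+1)) /C.
  by move: (n.+1%:R : R) n0 => N n0; field.
by rewrite lerD2l ler_wpM2l// ltW.
Qed.

End operator_expansion.

(** The quadratic part of the local expansion of the log-likelihood ratio. The
    orthogonality of [v] and [a] is what makes [v] the efficient direction. *)
Lemma quadratic_remainder {R : realType} {V : hilbertType R}
    (n t c g rho al d1 : R) (a v u w k : V) :
  0 <= n -> dotp a v = 0 -> `|a| <= al -> `|k| <= g -> `|w| <= c * t ^+ 2 ->
  `|u + w - t *: k| <= `|t| * rho ->
  n * `|dotp a u| <= d1 * (1 + n * t ^+ 2) ->
  0 <= c -> 0 <= g -> 0 <= rho -> 0 <= al ->
  `|n / 2 * (`|a + t *: v + (u + w - t *: k)| ^+ 2 - `|a| ^+ 2 - t ^+ 2 * `|v| ^+ 2)|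
    <= (d1 + al * c + Num.sqrt n * al * g + `|v| * rho + rho ^+ 2) * (1 + n * t ^+ 2).
Proof.
move=> n0 av aal kg wc Rrho au c0 g0 rho0 al0.
set m := u + w - t *: k.
have mrho : `|m| <= `|t| * rho by [].
have -> : n / 2 * (`|a + t *: v + m| ^+ 2 - `|a| ^+ 2 - t ^+ 2 * `|v| ^+ 2) =
    n * dotp a u + n * dotp a w - n * t * dotp a k + n * t * dotp v m + n / 2 * `|m| ^+ 2.
  rewrite !normD_dotp dotpDl dotpZl dotpZr av normZ_dotp {1}/m.
  by rewrite dotpBr dotpDr dotpZr; field.
set q := 1 + n * t ^+ 2.
have q0 : 0 <= n * t ^+ 2 by rewrite mulr_ge0 ?sqr_ge0.
have e1 : `|n * dotp a u| <= d1 * q by rewrite normrM ger0_norm.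
have e2 : `|n * dotp a w| <= al * c * q.
  rewrite normrM (ger0_norm n0).
  have : `|dotp a w| <= al * (c * t ^+ 2).
    by apply: le_trans (cauchy_schwarz _ _) _; rewrite ler_pM.
  move/(ler_wpM2l n0) => h; apply: le_trans h _.
  have -> : n * (al * (c * t ^+ 2)) = al * c * (n * t ^+ 2) by ring.
  by rewrite ler_wpM2l ?mulr_ge0// /q; lra.
have sn : Num.sqrt n * `|t| <= q.
  have := sqr_sqrtr n0; have := sqrtr_ge0 n; rewrite /q -(real_normK (num_real t)).
  move: (Num.sqrt n) (`|t|) => x y x0 <-.
  have := sqr_ge0 (x * y - 1); rewrite -exprMn; move: (x * y) => z; nra.
have e3 : `|n * t * dotp a k| <= Num.sqrt n * al * g * q.
  rewrite !normrM (ger0_norm n0).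
  have : `|dotp a k| <= al * g.
    by apply: le_trans (cauchy_schwarz _ _) _; rewrite ler_pM.
  have nt0 : 0 <= n * `|t| by rewrite mulr_ge0.
  move/(ler_wpM2l nt0) => h; apply: le_trans h _.
  have -> : n * `|t| * (al * g) = Num.sqrt n * al * g * (Num.sqrt n * `|t|).
    by rewrite -{1}(sqr_sqrtr n0); ring.
  by rewrite ler_wpM2l// !mulr_ge0// sqrtr_ge0.
have e4 : `|n * t * dotp v m| <= `|v| * rho * q.
  rewrite !normrM (ger0_norm n0).
  have : `|dotp v m| <= `|v| * (`|t| * rho).
    by apply: le_trans (cauchy_schwarz _ _) _; rewrite ler_pM.
  have nt0 : 0 <= n * `|t| by rewrite mulr_ge0.
  move/(ler_wpM2l nt0) => h; apply: le_trans h _.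
  have -> : n * `|t| * (`|v| * (`|t| * rho)) = `|v| * rho * (n * t ^+ 2).
    by rewrite -(real_normK (num_real t)); ring.
  by rewrite ler_wpM2l ?mulr_ge0// /q; lra.
have e5 : `|n / 2 * `|m| ^+ 2| <= rho ^+ 2 * q.
  rewrite ger0_norm ?mulr_ge0 ?divr_ge0 ?sqr_ge0//.
  have : `|m| ^+ 2 <= (`|t| * rho) ^+ 2 by rewrite lerXn2r ?nnegrE ?mulr_ge0.
  have n20 : 0 <= n / 2 by rewrite divr_ge0.
  move/(ler_wpM2l n20) => h; apply: le_trans h _.
  rewrite exprMn real_normK ?num_real//.
  have -> : n / 2 * (t ^+ 2 * rho ^+ 2) = rho ^+ 2 * (n * t ^+ 2 / 2) by field.
  by rewrite ler_wpM2l ?sqr_ge0// /q; lra.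
move: e1 e2 e3 e4 e5.
move: (n * dotp a u) (n * dotp a w) (n * t * dotp a k) (n * t * dotp v m)
  (n / 2 * `|m| ^+ 2) => x1 x2 x3 x4 x5 e1 e2 e3 e4 e5.
have := ler_normD (x1 + x2 - x3 + x4) x5; have := ler_normD (x1 + x2 - x3) x4.
have := ler_normB (x1 + x2) x3; have := ler_normD x1 x2.
rewrite !mulrDl; lra.
Qed.

(** * Gaussian integrals over the parameter *)

Section gaussian_integral.
Context {R : realType}.
Local Notation mu := (@lebesgue_measure R).
Implicit Types (a b x t n i D L : R).

Definition gauss_exp a b t : R := expR (b * t - a * t ^+ 2 / 2).

Definition gauss_mass a b : R := Num.sqrt (pi *+ 2 / a) * expR (b ^+ 2 / (2 * a)).

Lemma gauss_mass_gt0 a b : 0 < a -> 0 < gauss_mass a b.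
Proof.
move=> a0; rewrite mulr_gt0 ?expR_gt0// sqrtr_gt0 divr_gt0//.
by rewrite mulrn_wgt0// pi_gt0.
Qed.

Lemma gauss_expE a b x m : 0 < a ->
  gauss_exp a b (x - m) = gauss_mass a b * normal_pdf (m + b / a) (Num.sqrt a^-1) x.
Proof.
move=> a0; have aN0 : a != 0 by rewrite gt_eqF.
have sN0 : Num.sqrt a^-1 != 0 by rewrite gt_eqF// sqrtr_gt0 invr_gt0.
have s2 : Num.sqrt a^-1 ^+ 2 = a^-1 by rewrite sqr_sqrtr// invr_ge0 ltW.
rewrite normal_pdfE// /normal_peak /normal_fun s2 /gauss_mass.
rewrite (_ : a^-1 * pi *+ 2 = pi *+ 2 / a); last by rewrite -mulrnAr mulrC.
have pN0 : Num.sqrt (pi *+ 2 / a) != 0 :> R.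
  by rewrite gt_eqF// sqrtr_gt0 divr_gt0// mulrn_wgt0// pi_gt0.
rewrite mulrACA mulrV ?unitfE// mul1r -expRD; congr expR.
by field.
Qed.

Lemma measurable_gauss_exp a b m : measurable_fun setT (fun x => gauss_exp a b (x - m)).
Proof.
rewrite /gauss_exp; apply: measurableT_comp => //.
have mB : measurable_fun setT (fun x => x - m) by exact: measurable_funB.
apply: measurable_funB; first exact: measurable_funM.
by apply: measurable_funM => //; apply: measurable_funM => //; exact: measurable_funX.
Qed.

Lemma integral_gauss_exp a b m (F : set (measurableTypeR R)) : 0 < a -> measurable F ->
  (\int[mu]_(x in F) (gauss_exp a b (x - m))%:E =
   (gauss_mass a b)%:E * normal_prob (m + b / a)%R (Num.sqrt a^-1) F)%E.
Proof.
move=> a0 mF; rewrite /normal_prob -ge0_integralZl//.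
- by apply: eq_integral => x _; rewrite gauss_expE.
- by apply: measurable_funTS; apply/measurable_EFinP; exact: measurable_normal_pdf.
- by move=> x _; rewrite lee_fin normal_pdf_ge0.
- by rewrite lee_fin ltW// gauss_mass_gt0.
Qed.

Lemma integralT_gauss_exp a b m : 0 < a ->
  (\int[mu]_x (gauss_exp a b (x - m))%:E = (gauss_mass a b)%:E)%E.
Proof. by move=> a0; rewrite integral_gauss_exp// probability_setT mule1. Qed.

Lemma gauss_mass_tilt n i d D : 0 < n -> 0 < i -> d <= i / 4 -> 0 <= d ->
  gauss_mass (n * (i - 2 * d)) (Num.sqrt n * D) <=
  gauss_mass (n * i) (Num.sqrt n * D) * expR (d * (4 / i + 2 * D ^+ 2 / i ^+ 2)).
Proof.
move=> n0 i0 di d0; have id0 : 0 < i - 2 * d by lra.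
have iN0 : i != 0 by rewrite gt_eqF.
have idN0 : i - 2 * d != 0 by rewrite gt_eqF.
have nN0 : n != 0 by rewrite gt_eqF.
pose Y := i / (i - 2 * d).
have Y1 : 1 <= Y by rewrite ler_pdivlMr//; lra.
have sY : Num.sqrt Y <= expR (d * (4 / i)).
  have : Num.sqrt Y <= Y.
    rewrite -[leRHS]ger0_norm ?(le_trans _ Y1)// -sqrtr_sqr ler_sqrt ?sqr_ge0//.
    by rewrite expr2 ler_peMl// (le_trans _ Y1).
  have : Y <= 1 + d * (4 / i).
    rewrite /Y ler_pdivrMr// -subr_ge0.
    have -> : (1 + d * (4 / i)) * (i - 2 * d) - i = 2 * d * (1 - 4 * d / i) by field.
    rewrite mulr_ge0 ?mulr_ge0// subr_ge0 ler_pdivrMr// mul1r; lra.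
  by have := expR_ge1Dx (d * (4 / i)); lra.
have AB : D ^+ 2 / (2 * (i - 2 * d)) <= D ^+ 2 / (2 * i) + d * (2 * D ^+ 2 / i ^+ 2).
  rewrite -subr_ge0.
  have -> : D ^+ 2 / (2 * i) + d * (2 * D ^+ 2 / i ^+ 2) - D ^+ 2 / (2 * (i - 2 * d)) =
      D ^+ 2 * d * (i - 4 * d) / (i ^+ 2 * (i - 2 * d)).
    by field; rewrite idN0 iN0.
  have i4 : 0 <= i - 4 * d by lra.
  apply: divr_ge0; apply: mulr_ge0 => //; last exact: ltW.
    by apply: mulr_ge0 => //; exact: sqr_ge0.
  exact: sqr_ge0.
rewrite /gauss_mass !exprMn sqr_sqrtr ?(ltW n0)//.
have -> : n * D ^+ 2 / (2 * (n * (i - 2 * d))) = D ^+ 2 / (2 * (i - 2 * d)).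
  by field; rewrite nN0 idN0.
have -> : n * D ^+ 2 / (2 * (n * i)) = D ^+ 2 / (2 * i) by field; rewrite nN0 iN0.
have -> : pi *+ 2 / (n * (i - 2 * d)) = (pi *+ 2 / (n * i)) * Y :> R.
  by rewrite /Y; field; rewrite nN0 iN0 idN0.
have X0 : 0 <= pi *+ 2 / (n * i) :> R.
  by apply: divr_ge0; [rewrite mulrn_wge0 ?pi_ge0 | exact: ltW (mulr_gt0 n0 i0)].
rewrite sqrtrM//.
have h : Num.sqrt Y * expR (D ^+ 2 / (2 * (i - 2 * d))) <=
    expR (d * (4 / i)) * expR (D ^+ 2 / (2 * i) + d * (2 * D ^+ 2 / i ^+ 2)).
  by rewrite ler_pM ?sqrtr_ge0 ?expR_ge0 ?ler_expR.
rewrite -mulrA; apply: le_trans (ler_wpM2l (sqrtr_ge0 _) h) _.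
by rewrite mulrDr !expRD le_eqVlt; apply/orP; left; apply/eqP; ring.
Qed.

(** The three ways in which the Gaussian weights of the proof differ from the
    limit law are made small at once, uniformly in bounded [D]. *)
Lemma gauss_local (i C e : R) : 0 < i -> 0 <= C -> 0 < e -> e <= 1 ->
  exists L d : R, [/\ 0 < L, 0 < d, d <= i / 4,
    expR (- (d * (1 + L ^+ 2))) >= 1 - e &
    forall n D m : R, 0 < n -> `|D| <= C ->
      expR d * gauss_mass (n * (i - 2 * d)) (Num.sqrt n * D) <=
        (1 + e) * gauss_mass (n * i) (Num.sqrt n * D) /\
      (normal_prob (m + Num.sqrt n * D / (n * i))%R (Num.sqrt (n * i)^-1)
        [set x | (L / Num.sqrt n < `|x - m|)%R] <= e%:E)%E].
Proof.
move=> i0 C0 e0 e1; have iN0 : i != 0 by rewrite gt_eqF.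
pose c := 4 / i + 2 * C ^+ 2 / i ^+ 2.
have c0 : 0 <= c.
  apply: addr_ge0; apply: divr_ge0; rewrite ?sqr_ge0 ?(ltW i0)//.
  by apply: mulr_ge0 => //; exact: sqr_ge0.
pose T := expR (i / 4 * c).
have T0 : 0 < T by exact: expR_gt0.
have Te0 : 0 < T / e by rewrite divr_gt0.
have i40 : 0 < 4 / i by rewrite divr_gt0.
pose L := (4 / i + 1) * (T / e + 1).
have L0 : 0 < L by rewrite mulr_gt0// addr_gt0.
have LT : T / e <= i / 4 * L ^+ 2.
  have -> : i / 4 * L ^+ 2 = (1 + i / 4) * (4 / i + 1) * (T / e + 1) ^+ 2.
    by rewrite /L; field; rewrite iN0 gt_eqF.
  have : 1 <= (1 + i / 4) * (4 / i + 1).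
    by rewrite -[leLHS]mulr1 ler_pM//; lra.
  move=> u1; apply: (@le_trans _ _ ((T / e + 1) ^+ 2)); first by nra.
  by rewrite ler_peMl ?sqr_ge0.
pose d := Num.min (i / 4) (Num.min (e / (2 * (1 + c))) (e / (1 + L ^+ 2))).
have d0 : 0 < d.
  by rewrite !lt_min !divr_gt0//; [nra | lra].
have [di dc dL] : [/\ d <= i / 4, d <= e / (2 * (1 + c)) & d <= e / (1 + L ^+ 2)].
  by split; rewrite !ge_min lexx ?orbT.
have L1 : 0 < 1 + L ^+ 2 by nra.
exists L, d; split => //.
  by move: dL; rewrite ler_pdivlMr//; have := expR_ge1Dx (- (d * (1 + L ^+ 2))); lra.
move=> n D m n0 DC.
have Dc x : 0 <= x -> x * (4 / i + 2 * D ^+ 2 / i ^+ 2) <= x * c.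
  move=> x0; rewrite ler_wpM2l// /c lerD2l ler_pM2r ?invr_gt0 ?exprn_gt0//.
  rewrite ler_pM2l// -(real_normK (num_real D)).
  by rewrite lerXn2r ?nnegrE.
have ni0 : 0 < n * i by rewrite mulr_gt0.
have mass0 := gauss_mass_gt0 (Num.sqrt n * D) ni0.
split.
  have := gauss_mass_tilt D n0 i0 di (ltW d0) => h.
  apply: le_trans (ler_wpM2l (expR_ge0 d) h) _.
  rewrite mulrCA -expRD mulrC ler_pM2r//.
  apply: (@le_trans _ _ (expR (d * (1 + c)))).
    by rewrite ler_expR (mulrDr d 1) mulr1 lerD2l; apply: Dc; exact: ltW.
  have x2 : d * (1 + c) <= e / 2.
    by move: dc; rewrite ler_pdivlMr//; [nra | lra].
  have := expR_ge1Dx (- (d * (1 + c))); rewrite expRN.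
  have := expR_gt0 (d * (1 + c)); move: (d * (1 + c)) x2 => x x2 E0 E1.
  have h1 : 1 - x <= (expR x)^-1 by [].
  have : (1 - x) * expR x <= 1.
    by apply: le_trans (ler_wpM2r (ltW E0) h1) _; rewrite mulVf// gt_eqF.
  move: (expR x) E0 {E1 h1} => E E0; nra.
set F := [set x | _].
have mF : measurable (F : set (measurableTypeR R)).
  apply: measurable_setT_ltr => //; apply: measurableT_comp => //.
  exact: measurable_funB.
have i4 : 0 < i / 4 by rewrite divr_gt0.
have ni2 : 0 < n * (i - 2 * (i / 4)) by rewrite mulr_gt0//; lra.
have : (\int[mu]_(x in F) (gauss_exp (n * i) (Num.sqrt n * D) (x - m))%:E <=
    \int[mu]_(x in F) ((expR (- (i / 4 * L ^+ 2)))%:E *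
      (gauss_exp (n * (i - 2 * (i / 4))) (Num.sqrt n * D) (x - m))%:E))%E.
  apply: ge0_le_integral => //.
  - by move=> x _; rewrite lee_fin expR_ge0.
  - apply/measurable_EFinP; apply: measurable_funTS; exact: measurable_gauss_exp.
  - apply: emeasurable_funM => //; apply/measurable_EFinP; apply: measurable_funTS.
    exact: measurable_gauss_exp.
  - move=> x Fx; rewrite -EFinM lee_fin -expRD ler_expR.
    have : L ^+ 2 <= n * (x - m) ^+ 2.
      move: Fx; rewrite /F/= ltr_pdivrMr ?sqrtr_gt0// => Fx.
      rewrite -(real_normK (num_real (x - m))) -{1}(sqr_sqrtr (ltW n0)) mulrC -exprMn.
      have Fn : 0 <= `|x - m| * Num.sqrt n by rewrite mulr_ge0 ?sqrtr_ge0.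
      by move: (ltW Fx) (ltW L0) Fn; move: (_ * _) => z *; nra.
    by move/(ler_wpM2l (ltW i4)); lra.
rewrite integral_gauss_exp// ge0_integralZl//; last 2 first.
- by apply: measurable_funTS; apply/measurable_EFinP; exact: measurable_gauss_exp.
- by move=> x _; rewrite lee_fin expR_ge0.
rewrite integral_gauss_exp//.
set N := normal_prob _ _ F; set N' := normal_prob _ _ F => h.
have N'1 : (N' <= 1)%E by exact: probability_le1.
have Nfin : N \is a fin_num by exact: fin_num_measure.
have N'fin : N' \is a fin_num by exact: fin_num_measure.
have N'0 : (0 <= N')%E by exact: measure_ge0.
clearbody N N'; case: N Nfin h => // u _; case: N' N'fin N'0 N'1 => // v _.
rewrite -!EFinM !lee_fin => v0 v1 h.
have tilt := gauss_mass_tilt D n0 i0 (lexx _) (ltW i4).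
have ET : expR (- (i / 4 * L ^+ 2)) * T <= e.
  rewrite expRN mulrC ler_pdivrMr ?expR_gt0// mulrC -ler_pdivrMr//.
  by have := expR_ge1Dx (i / 4 * L ^+ 2); lra.
rewrite -(ler_pM2l mass0); apply: le_trans h _.
have E0 := expR_ge0 (- (i / 4 * L ^+ 2)).
apply: (@le_trans _ _ (expR (- (i / 4 * L ^+ 2)) *
   (gauss_mass (n * i) (Num.sqrt n * D) * T))).
  rewrite ler_wpM2l//; apply: (@le_trans _ _ (gauss_mass (n * (i - 2 * (i / 4))) (Num.sqrt n * D))).
    by rewrite ler_piMr// ltW// gauss_mass_gt0.
  apply: le_trans tilt _; rewrite ler_pM2l// ler_expR; apply: Dc; exact: ltW.
by rewrite mulrCA ler_pM2l.
Qed.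

End gaussian_integral.

(** * Integrated likelihoods and translations of the prior *)

Section tonelli.
Context {R : realType} {d1 d2 : measure_display} {T1 : measurableType d1}
  {T2 : measurableType d2}.
Local Open Scope ereal_scope.

(** Tonelli's theorem lets an almost sure statement for each parameter be used as
    a statement for almost all parameters, outside one null set of outcomes. *)
Lemma ae_null_sections (m1 : {sigma_finite_measure set T1 -> \bar R})
    (m2 : {sigma_finite_measure set T2 -> \bar R}) (N : set (T1 * T2)) :
  measurable N -> (forall x, m2 (xsection N x) = 0) ->
  {ae m2, forall y, m1 (ysection N y) = 0}.
Proof.
move=> mN N0.
have I0 : \int[m2]_(y in setT) `|m1 (ysection N y)| = 0.
  transitivity (\int[m2]_y fubini_G m1 (EFin \o (\1_N : T1 * T2 -> R)) y).
    apply: eq_integral => y _; rewrite indic_fubini_tonelli_GE//=.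
    by rewrite gee0_abs.
  rewrite -indic_fubini_tonelli//; apply: integral0_eq => x _.
  by rewrite indic_fubini_tonelli_FE//= N0.
have mG : measurable_fun setT (fun y => m1 (ysection N y)).
  exact: measurable_fun_ysection.
have [X [mX X0 sX]] := (ae_eq_integral_abs m2 measurableT mG).1 I0.
by exists X; split => // y ny; apply: sX => /= /(_ I).
Qed.

Variables (m1 : {sigma_finite_measure set T1 -> \bar R})
  (m2 : {sigma_finite_measure set T2 -> \bar R}).
Variables (L : T1 * T2 -> R) (L0 : T2 -> R) (sh : T1 -> T2 -> T2)
  (phi psi : T1 -> R) (U : set T1) (A' B : set T2).
Hypotheses (mL : measurable_fun setT L) (L_ge0 : forall z, (0 <= L z)%R)
  (mL0 : measurable_fun setT L0) (L0_ge0 : forall f, (0 <= L0 f)%R)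
  (msh : measurable_fun setT (fun z => sh z.1 z.2))
  (mphi : measurable_fun setT phi) (phi_ge0 : forall x, (0 <= phi x)%R)
  (mpsi : measurable_fun setT psi) (psi_gt0 : forall x, (0 < psi x)%R)
  (mU : measurable U) (mA' : measurable A') (mB : measurable B).

Let u g : R := (\1_A' g * L0 g)%R.

Let mu_ : measurable_fun setT u.
Proof. by apply: measurable_funM => //; exact: measurable_indic. Qed.

Let u_ge0 g : (0 <= u g)%R. Proof. by rewrite mulr_ge0. Qed.

Let Iu D : measurable D -> \int[m2]_(g in D) (u g)%:E = \int[m2]_(g in A' `&` D) (L0 g)%:E.
Proof.
move=> mD; rewrite [LHS]integral_mkcond [RHS]integral_mkcond.
apply: eq_integral => g _; rewrite !patchE in_setI /u indicE.
by case: ifP; case: (g \in A'); rewrite ?mul1r ?mul0r.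
Qed.

Let musx x : measurable_fun setT (fun f => u (sh x f)).
Proof.
apply: measurableT_comp => //.
exact: (measurable_fun_pair2 (f := fun z => sh z.1 z.2) x msh).
Qed.

(** An upper bound for the likelihood over a product set, from a pointwise bound
    by a product after the shift [sh] and the effect of the shift on [m2]. *)
Lemma likelihood_upper (A : set T2) : measurable A ->
  (forall x f, U x -> A f -> A' (sh x f)) ->
  {ae m1 \x m2, forall z, U z.1 -> A z.2 -> (L z <= phi z.1 * L0 (sh z.1 z.2))%R} ->
  (forall x (v : T2 -> R), U x -> measurable_fun setT v -> (forall f, (0 <= v f)%R) ->
    \int[m2]_(f in ~` B) (v (sh x f))%:E <= (psi x)%:E * \int[m2]_f (v f)%:E) ->
  \int[m1 \x m2]_(z in U `*` (A `\` B)) (L z)%:E <=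
    (\int[m1]_(x in U) (phi x * psi x)%R%:E) * \int[m2]_(g in A') (L0 g)%:E.
Proof.
move=> mA AA' aeL cv.
have mD : measurable (U `*` (A `\` B)) by apply: measurableX => //; exact: measurableD.
pose g z := (\1_U z.1 * phi z.1 * (\1_(~` B) z.2 * u (sh z.1 z.2)))%R.
have mg : measurable_fun setT (fun z => (g z)%:E).
  apply/measurable_EFinP; apply: measurable_funM.
    apply: measurable_funM; last exact: (measurableT_comp mphi measurable_fst).
    apply: (measurableT_comp (measurable_indic _) measurable_fst) => //.
  apply: measurable_funM.
    apply: (measurableT_comp (measurable_indic _) measurable_snd) => //.
    exact: measurableC.
  exact: measurableT_comp mu_ msh.
have g0 z : 0 <= (g z)%:E.
  by rewrite lee_fin mulr_ge0// mulr_ge0.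
apply: (@le_trans _ _ (\int[m1 \x m2]_(z in U `*` (A `\` B)) (g z)%:E)).
  apply: ae_ge0_le_integral => //.
  - by move=> z _; rewrite lee_fin.
  - by apply: measurable_funTS; exact/measurable_EFinP.
  - exact: measurable_funTS.
  - apply: filterS aeL => -[x f] /= h [/= Ux [Af Bf]]; rewrite lee_fin.
    have Us := AA' _ _ Ux Af.
    rewrite /g /u !indicE !mem_set//= !mul1r; exact: h.
apply: (@le_trans _ _ (\int[m1 \x m2]_z (g z)%:E)).
  by apply: ge0_subset_integral.
rewrite fubini_tonelli1//; set I := \int[m2]_(g in A') _.
have IE : I = \int[m2]_g (u g)%:E by rewrite Iu// setIT.
have I0 : 0 <= I by apply: integral_ge0 => f _; rewrite lee_fin.
have mpp : measurable_fun U (fun x => (phi x * psi x)%R%:E).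
  by apply/measurable_EFinP; apply: measurable_funTS; exact: measurable_funM.
rewrite -ge0_integralZr//; last by move=> x _; rewrite lee_fin mulr_ge0// ltW.
rewrite [leRHS]integral_mkcond; apply: ge0_le_integral => //.
- by move=> x _; apply: integral_ge0.
- exact: measurable_fun_fubini_tonelli_F.
- by apply/(measurable_restrictT _ _).1 => //; exact: emeasurable_funM.
move=> x _; rewrite /fubini_F /g /= patchE.
under eq_integral do rewrite EFinM.
rewrite ge0_integralZl//; last 3 first.
- apply/measurable_EFinP; apply: measurable_funM => //.
  by apply: measurable_indic; exact: measurableC.
- by move=> f _; rewrite lee_fin mulr_ge0.
- by rewrite lee_fin mulr_ge0.
case: ifPn => [xU|/negbTE xU]; rewrite indicE xU; last by rewrite mul0r mul0e.
have Ux : U x by rewrite -in_setE.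
rewrite mul1r EFinM -muleA; apply: lee_wpmul2l; first by rewrite lee_fin.
rewrite IE; apply: le_trans (cv x u Ux mu_ u_ge0).
rewrite [leRHS]integral_mkcond le_eqVlt; apply/orP; left; apply/eqP.
apply: eq_integral => f _; rewrite patchE indicE.
by case: ifP; rewrite ?mul1r ?mul0r.
Qed.

(** The corresponding lower bound, over a set [U `*` setT] because the shift may
    leave the set of functions on which the expansion is first established. *)
Lemma likelihood_lower :
  {ae m1 \x m2, forall z, U z.1 -> A' (sh z.1 z.2) -> (phi z.1 * L0 (sh z.1 z.2) <= L z)%R} ->
  (forall x (v : T2 -> R), U x -> measurable_fun setT v -> (forall f, (0 <= v f)%R) ->
    (psi x)%:E * \int[m2]_(f in ~` B) (v f)%:E <= \int[m2]_f (v (sh x f))%:E) ->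
  (\int[m1]_(x in U) (phi x * psi x)%R%:E) * \int[m2]_(g in A' `\` B) (L0 g)%:E <=
  \int[m1 \x m2]_(z in U `*` setT) (L z)%:E.
Proof.
move=> aeL cv.
have mD : measurable (U `*` [set: T2]) by exact: measurableX.
pose g z := (\1_U z.1 * phi z.1 * u (sh z.1 z.2))%R.
have mg : measurable_fun setT (fun z => (g z)%:E).
  apply/measurable_EFinP; apply: measurable_funM.
    apply: measurable_funM; last exact: (measurableT_comp mphi measurable_fst).
    apply: (measurableT_comp (measurable_indic _) measurable_fst) => //.
  exact: measurableT_comp mu_ msh.
have g0 z : 0 <= (g z)%:E by rewrite lee_fin mulr_ge0// mulr_ge0.
apply: (@le_trans _ _ (\int[m1 \x m2]_(z in U `*` setT) (g z)%:E)); last first.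
  apply: ae_ge0_le_integral => //.
  - exact: measurable_funTS.
  - by move=> z _; rewrite lee_fin.
  - by apply: measurable_funTS; exact/measurable_EFinP.
  - apply: filterS aeL => -[x f] /= h [/= Ux _]; rewrite lee_fin.
    rewrite /g /u !indicE (mem_set Ux) mul1r.
    case: (boolP (sh x f \in A')) => [|_]; last by rewrite mul0r mulr0.
    by rewrite inE => Af; rewrite mul1r; exact: h.
have -> : \int[m1 \x m2]_(z in U `*` setT) (g z)%:E = \int[m1 \x m2]_z (g z)%:E.
  rewrite integral_mkcond; apply: eq_integral => -[x f] _; rewrite patchE.
  case: ifPn => //; rewrite in_setX in_setT andbT => /negbTE xU.
  by rewrite /g indicE /= xU !mul0r.
rewrite fubini_tonelli1//; set I := \int[m2]_(g in A' `\` B) _.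
have IE : I = \int[m2]_(g in ~` B) (u g)%:E by rewrite Iu//; exact: measurableC.
have I0 : 0 <= I by apply: integral_ge0 => f _; rewrite lee_fin.
have mpp : measurable_fun U (fun x => (phi x * psi x)%R%:E).
  by apply/measurable_EFinP; apply: measurable_funTS; exact: measurable_funM.
rewrite -ge0_integralZr//; last by move=> x _; rewrite lee_fin mulr_ge0// ltW.
rewrite [leLHS]integral_mkcond; apply: ge0_le_integral => //.
- move=> x _; rewrite patchE; case: ifP => // _.
  by rewrite mule_ge0// lee_fin mulr_ge0// ltW.
- by apply/(measurable_restrictT _ _).1 => //; exact: emeasurable_funM.
- exact: measurable_fun_fubini_tonelli_F.
move=> x _; rewrite /fubini_F /g /= patchE.
under [leRHS]eq_integral do rewrite EFinM.
rewrite ge0_integralZl//; last 3 first.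
- exact/measurable_EFinP.
- by move=> f _; rewrite lee_fin.
- by rewrite lee_fin mulr_ge0.
case: ifPn => [xU|/negbTE xU]; rewrite indicE xU; last by rewrite mul0r mul0e.
have Ux : U x by rewrite -in_setE.
rewrite mul1r EFinM -muleA; apply: lee_wpmul2l; first by rewrite lee_fin.
rewrite IE; exact: cv.
Qed.

End tonelli.

(** * Events of vanishing probability *)

Section rare_events.
Context {R : realType} {d : measure_display} {Omega : measurableType d}
  (P : probability Omega R).
Implicit Types (bad : nat -> set Omega) (k : R).
Local Notation Pext := (mu_ext P).

(** The sequences of events whose outer probability is eventually at most [k];
    the events of the proof need not be measurable. *)
Definition rare k bad := \forall n \near \oo, (Pext (bad n) <= k%:E)%E.

Definition vanishing bad := forall k, 0 < k -> rare k bad.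

Lemma rare_sub k bad bad' : (\forall n \near \oo, bad n `<=` bad' n) ->
  rare k bad' -> rare k bad.
Proof.
by apply: filterS2 => n s /(le_trans _) -> //; exact: le_outer_measure.
Qed.

Lemma vanishing_sub bad bad' : (\forall n \near \oo, bad n `<=` bad' n) ->
  vanishing bad' -> vanishing bad.
Proof. by move=> s v k k0; exact: rare_sub s (v k k0). Qed.

Lemma rareU k1 k2 bad1 bad2 : rare k1 bad1 -> rare k2 bad2 ->
  rare (k1 + k2) (fun n => bad1 n `|` bad2 n).
Proof.
apply: filterS2 => n b1 b2; apply: le_trans (outer_measureU2 _ _ _) _.
by rewrite EFinD leeD.
Qed.

Lemma vanishingU bad1 bad2 : vanishing bad1 -> vanishing bad2 ->
  vanishing (fun n => bad1 n `|` bad2 n).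
Proof.
move=> v1 v2 k k0; have k20 : 0 < k / 2 by rewrite divr_gt0.
by have := rareU (v1 _ k20) (v2 _ k20); rewrite -splitr.
Qed.

Lemma vanishing_measurable bad : (forall n, measurable (bad n)) ->
  (forall k, 0 < k -> \forall n \near \oo, (P (bad n) <= k%:E)%E) -> vanishing bad.
Proof.
move=> mb b k k0; apply: filterS (b k k0) => n.
by rewrite measurable_mu_extE.
Qed.

Lemma vanishing_cvg (Z : nat -> Omega -> R) e : cvg_in_prob0 P Z -> 0 < e ->
  vanishing (fun n => [set w | e < `|Z n w|]).
Proof.
move=> Z0 e0 k k0; have /fine_cvgP[fin /cvgr0Pnorm_lt/(_ k k0)] := Z0 e e0.
apply: filterS2 fin => n fin /= lt; rewrite -(fineK fin) lee_fin.
by apply/ltW; apply: le_lt_trans lt; exact: ler_norm.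
Qed.

Lemma cvg_of_rare (Z : nat -> Omega -> R) :
  (forall e k, 0 < e -> 0 < k -> rare k (fun n => [set w | e < `|Z n w|])) ->
  cvg_in_prob0 P Z.
Proof.
move=> h e e0; have fin : \forall n \near \oo,
    Pext [set w | e < `|Z n w|] \is a fin_num.
  apply: filterS (h e 1 e0 ltr01) => n le1; rewrite ge0_fin_numE ?outer_measure_ge0//.
  by apply: le_lt_trans le1 _; rewrite ltry.
apply/fine_cvgP; split => //; apply/cvgr0Pnorm_le => k k0.
apply: filterS2 fin (h e k e0 k0) => n fin le /=.
by rewrite ger0_norm ?fine_ge0 ?outer_measure_ge0// -lee_fin fineK.
Qed.

Lemma vanishing_ae (Q : nat -> Omega -> Prop) :
  (forall n, {ae P, forall w, Q n w}) -> vanishing (fun n => [set w | ~ Q n w]).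
Proof.
move=> aeQ k k0; apply: nearW => n; have [N [mN N0 sN]] := aeQ n.
apply: (@le_trans _ _ (Pext N)); first exact: le_outer_measure.
have -> : Pext N = P N by exact: measurable_mu_extE.
by rewrite N0 lee_fin ltW.
Qed.

Lemma vanishing_markov (Z : nat -> Omega -> \bar R) (a : nat -> R) :
  (forall n, measurable_fun setT (Z n)) -> (forall n w, (0 <= Z n w)%E) ->
  (\forall n \near \oo, 0 < a n) ->
  (forall k, 0 < k -> \forall n \near \oo, (\int[P]_w Z n w <= (k * a n)%:E)%E) ->
  vanishing (fun n => [set w | ((a n)%:E <= Z n w)%E]).
Proof.
move=> mZ Z0 a0 Za; apply: vanishing_measurable => [n|k k0].
  by rewrite -[X in measurable X]setTI; exact: emeasurable_fun_c_infty.
apply: filterS2 a0 (Za k k0) => n an Zk.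
have := le_integral_abse P measurableT (mZ n) an.
have -> : [set: Omega] `&` [set x | ((a n)%:E <= `|Z n x|)%E] = [set w | ((a n)%:E <= Z n w)%E].
  by rewrite setTI; apply/seteqP; split => w /=; rewrite gee0_abs.
under eq_integral do rewrite gee0_abs//.
move=> h; rewrite -(@lee_pmul2l _ (a n)%:E) ?lte_fin//.
by apply: le_trans h _; rewrite -EFinM mulrC.
Qed.

End rare_events.

(** * Likelihood ratios *)

Section likelihood_ratio.
Context {R : realType} {V : hilbertType R} {d : measure_display}
  {Omega : measurableType d} (P : probability Omega R) (W : V -> Omega -> R).
Hypothesis isoW : iso_gaussian P W.
Variables (n : nat) (v0 : V).

(** The likelihood at [v] relative to the truth [v0], and its logarithm. *)
Definition log_lratio (v : V) (w : Omega) : R :=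
  Num.sqrt n%:R * (W v w - W v0 w) - n%:R / 2 * `|v - v0| ^+ 2.

Definition lratio v w : R := expR (log_lratio v w).

Lemma lratio_gt0 v w : 0 < lratio v w. Proof. exact: expR_gt0. Qed.

Lemma lratio_ge0 v w : 0 <= lratio v w. Proof. exact: expR_ge0. Qed.

Lemma likelihood_lratio v w : (0 < n)%N ->
  likelihood n (observation W v0 n w) v =
  expR (n%:R / 2 * `|v0| ^+ 2 + Num.sqrt n%:R * W v0 w) * lratio v w.
Proof.
move=> n0; rewrite /likelihood /observation /lratio /log_lratio -expRD; congr expR.
have s0 : Num.sqrt n%:R != 0 :> R by rewrite gt_eqF// sqrtr_gt0 ltr0n.
have ss := sqr_sqrtr (ler0n R n).
rewrite normB_dotp (dotpC v v0) mulrDr mulrA -{2}ss expr2 mulfK//.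
by field.
Qed.

Lemma measurable_log_lratio : measurable_fun setT
  ((fun vw => log_lratio vw.1 vw.2) : borel V * Omega -> R).
Proof.
apply: measurable_funB.
  apply: measurable_funM => //; apply: measurable_funB.
    exact: iso_gaussian_measurable isoW.
  exact: measurableT_comp (measurable_noise isoW v0) measurable_snd.
apply: measurable_funM => //; apply: measurable_funX.
exact: measurableT_comp (measurable_borel_norm v0) measurable_fst.
Qed.

Let expR_diff c v :
  (\int[P]_w (expR (c * (W v w - W v0 w)))%:E =
   (expR (c ^+ 2 * `|v - v0| ^+ 2 / 2))%:E)%E.
Proof.
have := noise_sum_expR isoW [:: (c, v); (- c, v0)].
rewrite /vec_sum !big_cons big_nil addr0 /= scaleNr -scalerBr normZ_dotp => <-.
apply: eq_integral => w _; rewrite /noise_sum !big_cons big_nil addr0 /=.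
by rewrite mulNr mulrBr.
Qed.

Let measurable_expR_diff c v :
  measurable_fun setT (fun w => (expR (c * (W v w - W v0 w)))%:E).
Proof.
apply/measurable_EFinP; apply: measurableT_comp => //; apply: measurable_funM => //.
by apply: measurable_funB; exact: measurable_noise isoW _.
Qed.

Lemma integral_lratio v : (\int[P]_w (lratio v w)%:E = 1)%E.
Proof.
rewrite /lratio /log_lratio; under eq_integral do rewrite expRD EFinM.
rewrite ge0_integralZr//.
rewrite expR_diff -EFinM -expRD sqr_sqrtr//.
by rewrite (_ : _ + _ = 0) ?expR0//; field.
Qed.

Lemma integral_lratioV v :
  (\int[P]_w ((lratio v w)^-1)%:E = (expR (n%:R * `|v - v0| ^+ 2))%:E)%E.
Proof.
rewrite /lratio /log_lratio; under eq_integral do rewrite -expRN opprB addrC -mulNr expRD EFinM.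
rewrite ge0_integralZr//.
rewrite expR_diff -EFinM -expRD sqrrN sqr_sqrtr//.
by congr (expR _)%:E; field.
Qed.

Context {d' : measure_display} {T : measurableType d'}
  (m : {sigma_finite_measure set T -> \bar R}) (F : T -> V).
Hypothesis mF : measurable_fun setT (F : T -> borel V).
Implicit Types E : set T.

Lemma measurable_log_lratio_comp :
  measurable_fun setT (fun xw : T * Omega => log_lratio (F xw.1) xw.2).
Proof.
have mFw : measurable_fun setT ((fun xw => (F xw.1, xw.2)) : T * Omega -> borel V * Omega).
  apply: measurable_fun_pair; last exact: measurable_snd.
  exact: measurableT_comp mF measurable_fst.
exact: measurableT_comp measurable_log_lratio mFw.
Qed.

Lemma measurable_lratio_comp :
  measurable_fun setT (fun xw : T * Omega => lratio (F xw.1) xw.2).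
Proof. by apply: measurableT_comp => //; exact: measurable_log_lratio_comp. Qed.

Lemma measurable_lratio1 w : measurable_fun setT (fun x => lratio (F x) w).
Proof. exact: measurable_fun_pair1 measurable_lratio_comp. Qed.

Let measurable_indicM E (g : T * Omega -> R) : measurable E -> measurable_fun setT g ->
  measurable_fun setT (fun xw : T * Omega => (\1_E xw.1 * g xw)%:E).
Proof.
move=> mE mg; apply/measurable_EFinP; apply: measurable_funM => //.
apply: (measurableT_comp (measurable_indic _) measurable_fst) => //.
Qed.

Let IE E (g : T -> R) : measurable E ->
  (\int[m]_(x in E) (g x)%:E = \int[m]_x (\1_E x * g x)%:E)%E.
Proof.
move=> mE; rewrite integral_mkcond; apply: eq_integral => x _.
by rewrite patchE indicE; case: ifP; rewrite ?mul1r ?mul0r.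
Qed.

Lemma measurable_integral_lratio E : measurable E ->
  measurable_fun setT (fun w => (\int[m]_(x in E) (lratio (F x) w)%:E)%E).
Proof.
move=> mE; under eq_fun do rewrite IE//.
have mg := measurable_indicM mE measurable_lratio_comp.
have g0 (xw : T * Omega) : (0 <= (\1_E xw.1 * lratio (F xw.1) xw.2)%:E)%E.
  by rewrite lee_fin mulr_ge0// lratio_ge0.
exact: (measurable_fun_fubini_tonelli_G (m1 := m) _ mg g0).
Qed.

(** Likelihood ratios have mean one, so that exchanging the integrals leaves the
    prior mass; sets of small prior mass have small integrated likelihood. *)
Lemma integral_integral_lratio E : measurable E ->
  (\int[P]_w \int[m]_(x in E) (lratio (F x) w)%:E = m E)%E.
Proof.
move=> mE; under eq_integral do rewrite IE//.
have mg := measurable_indicM mE measurable_lratio_comp.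
have g0 (xw : T * Omega) : (0 <= (\1_E xw.1 * lratio (F xw.1) xw.2)%:E)%E.
  by rewrite lee_fin mulr_ge0// lratio_ge0.
rewrite -(fubini_tonelli (m1 := m) (m2 := P) _ mg g0)/=.
rewrite -[RHS]mul1e -integral_cst// [RHS]integral_mkcond.
apply: eq_integral => x _; rewrite patchE.
under eq_integral do rewrite EFinM.
rewrite ge0_integralZl//; last 2 first.
- apply/measurable_EFinP; exact: measurable_fun_pair2 measurable_lratio_comp.
- by move=> w _; rewrite lee_fin lratio_ge0.
by rewrite integral_lratio mule1 indicE; case: ifP.
Qed.

Let measurable_lratioV :
  measurable_fun setT (fun xw : T * Omega => (lratio (F xw.1) xw.2)^-1).
Proof.
rewrite (_ : (fun _ => _) = (fun xw : T * Omega => expR (- log_lratio (F xw.1) xw.2))).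
  apply: measurableT_comp => //; apply: measurableT_comp => //.
  exact: measurable_log_lratio_comp.
by apply/funext => xw; rewrite expRN.
Qed.

Lemma measurable_integral_lratioV E : measurable E ->
  measurable_fun setT (fun w => (\int[m]_(x in E) ((lratio (F x) w)^-1)%:E)%E).
Proof.
move=> mE; under eq_fun do rewrite IE//.
have mg := measurable_indicM mE measurable_lratioV.
have g0 (xw : T * Omega) : (0 <= (\1_E xw.1 * (lratio (F xw.1) xw.2)^-1)%:E)%E.
  by rewrite lee_fin mulr_ge0// invr_ge0 lratio_ge0.
exact: (measurable_fun_fubini_tonelli_G (m1 := m) _ mg g0).
Qed.

Lemma integral_integral_lratioV E e : measurable E ->
  (forall x, E x -> `|F x - v0| <= e) ->
  (\int[P]_w \int[m]_(x in E) ((lratio (F x) w)^-1)%:E <=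
   (expR (n%:R * e ^+ 2))%:E * m E)%E.
Proof.
move=> mE Ee; under eq_integral do rewrite IE//.
have mg := measurable_indicM mE measurable_lratioV.
have g0 (xw : T * Omega) : (0 <= (\1_E xw.1 * (lratio (F xw.1) xw.2)^-1)%:E)%E.
  by rewrite lee_fin mulr_ge0// invr_ge0 lratio_ge0.
rewrite -(fubini_tonelli (m1 := m) (m2 := P) _ mg g0)/=.
rewrite -integral_cst// [leRHS]integral_mkcond.
apply: ge0_le_integral => //.
- move=> x _; apply: integral_ge0 => w _.
  by rewrite lee_fin mulr_ge0// invr_ge0 lratio_ge0.
- exact: (measurable_fun_fubini_tonelli_F (m2 := P) _ mg g0).
- by apply/(measurable_restrictT _ _).1.
move=> x _; rewrite patchE.
under eq_integral do rewrite EFinM.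
rewrite ge0_integralZl//; last 2 first.
- apply/measurable_EFinP; exact: measurable_fun_pair2 measurable_lratioV.
- by move=> w _; rewrite lee_fin invr_ge0 lratio_ge0.
rewrite integral_lratioV indicE; case: ifPn => [|_]; last by rewrite mul0e.
rewrite inE mul1e lee_fin ler_expR => /Ee xe; rewrite ler_wpM2l//.
by rewrite lerXn2r ?nnegrE// (le_trans _ xe).
Qed.

(** The integrated likelihood is not too small: a second moment bound for its
    harmonic counterpart replaces the usual argument by Jensen's inequality. *)
Lemma integrated_lratio_lower E e c q : measurable E ->
  (forall x, E x -> `|F x - v0| <= e) -> 0 < c -> 0 < q -> m E = q%:E ->
  (P [set w | \int[m]_(x in E) (lratio (F x) w)%:E < (c * q)%R%:E] <=
   (c * expR (n%:R * e ^+ 2))%:E)%E.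
Proof.
move=> mE Ee c0 q0 mEq; pose Y w := (\int[m]_(x in E) ((lratio (F x) w)^-1)%:E)%E.
have mY : measurable_fun setT Y by exact: measurable_integral_lratioV.
have Y0 w : (0 <= Y w)%E.
  by apply: integral_ge0 => x _; rewrite lee_fin invr_ge0 lratio_ge0.
have qc0 : 0 < q / c by rewrite divr_gt0.
have sub : [set w | \int[m]_(x in E) (lratio (F x) w)%:E < (c * q)%R%:E]%E `<=`
    [set w | (q / c)%R%:E <= Y w]%E.
  move=> w /= lt; rewrite leNgt; apply/negP => Yw; move: lt; apply/negP; rewrite -leNgt.
  have h : ((2 * c * q)%R%:E <= \int[m]_(x in E) (lratio (F x) w)%:E + (c ^+ 2)%:E * Y w)%E.
    have -> : (2 * c * q)%R%:E = (\int[m]_(x in E) (cst (2 * c)%R%:E x))%E.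
      by rewrite EFinM -mEq; apply/esym; exact: integral_cst.
    have ml := measurable_lratio1 w.
    have mlV : measurable_fun setT (fun x => (lratio (F x) w)^-1).
      exact: measurable_fun_pair1 measurable_lratioV.
    have l0 x : E x -> (0 <= ((lratio (F x) w)^-1)%:E)%E.
      by move=> _; rewrite lee_fin invr_ge0 lratio_ge0.
    have mlE : measurable_fun E (fun x => ((lratio (F x) w)^-1)%:E).
      by apply: measurable_funTS; exact/measurable_EFinP.
    have mlE' : measurable_fun E (fun x => (lratio (F x) w)%:E).
      by apply: measurable_funTS; exact/measurable_EFinP.
    rewrite /Y -ge0_integralZl ?lee_fin ?sqr_ge0// -ge0_integralD//; last 3 first.
    - by move=> x _; rewrite lee_fin lratio_ge0.
    - by move=> x Ex; rewrite mule_ge0 ?l0// lee_fin sqr_ge0.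
    - exact: measurable_funeM.
    apply: ge0_le_integral => //.
    - by move=> x _; rewrite lee_fin mulr_ge0// ltW.
    - by apply: emeasurable_funD => //; exact: measurable_funeM.
    move=> x Ex /=; rewrite -EFinM -EFinD lee_fin.
    have L0 := lratio_gt0 (F x) w; move: (lratio (F x) w) L0 => l l0'.
    rewrite -subr_ge0; have -> : l + c ^+ 2 * l^-1 - 2 * c = (l - c) ^+ 2 / l.
      by field; rewrite gt_eqF.
    by rewrite divr_ge0 ?sqr_ge0// ltW.
  have Yfin : Y w \is a fin_num by rewrite ge0_fin_numE// (lt_trans Yw)// ltry.
  move: h Yw; rewrite -(fineK Yfin) -EFinM lte_fin.
  move: (\int[m]_(x in E) (lratio (F x) w)%:E)%E => [r| |]; rewrite ?leey//.
  rewrite -EFinD !lee_fin ltr_pdivlMr// => h Yw.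
  have : c * (fine (Y w) * c) <= c * q by rewrite ler_pM2l// ltW.
  by move: h; rewrite expr2; lra.
have mI := measurable_integral_lratio mE.
apply: le_trans (le_measure P _ _ sub) _.
- rewrite inE -[X in measurable X]setTI; exact: emeasurable_fun_infty_o.
- rewrite inE -[X in measurable X]setTI; exact: emeasurable_fun_c_infty.
have := le_integral_abse P measurableT mY qc0.
have -> : [set: Omega] `&` [set x | ((q / c)%R%:E <= `|Y x|)%E] = [set w | ((q / c)%R%:E <= Y w)%E].
  by rewrite setTI; apply/seteqP; split => w /=; rewrite gee0_abs.
under eq_integral do rewrite gee0_abs//.
move=> h; have := le_trans h (integral_integral_lratioV mE Ee).
rewrite mEq => h'; rewrite -(@lee_pmul2l _ (q / c)%:E) ?lte_fin//.
apply: le_trans h' _; rewrite -!EFinM lee_fin le_eqVlt; apply/orP; left; apply/eqP.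
by field; rewrite gt_eqF.
Qed.

End likelihood_ratio.

(** * Bayes' formula *)

Section posterior_ratio.
Context {R : realType} {H1 H2 : hilbertType R} (sepH2 : separable H2)
  (Theta : set (measurableTypeR R)) (H : set (borel H1)) (K : R -> {linear H1 -> H2})
  (mTheta : measurable Theta) (mH : measurable H) (N : H1 -> R)
  (mN : measurable_fun H (N : borel H1 -> R))
  (contK : forall theta, Theta theta -> continuous (K theta))
  (lipK : forall theta theta1 f, Theta theta -> Theta theta1 -> H f ->
    `|K theta f - K theta1 f| <= `|theta - theta1| * N f).

(** The operator family, extended by zero so that it is measurable on the whole
    parameter space. *)
Definition total_K (z : measurableTypeR R * borel H1) : H2 :=
  if z \in Theta `*` H then K z.1 z.2 else 0.

Lemma total_KE theta f : Theta theta -> H f -> total_K (theta, f) = K theta f.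
Proof. by move=> Tt Hf; rewrite /total_K mem_set. Qed.

Lemma measurable_total_K :
  measurable_fun setT (total_K : _ -> borel H2).
Proof.
have mD : measurable (Theta `*` H) by exact: measurableX.
have mK : measurable_fun (Theta `*` H)
    ((fun z => K z.1 z.2) : measurableTypeR R * borel H1 -> borel H2).
  apply: (@measurable_caratheodory R _ (borel H1) H2 sepH2 Theta H
    (fun x f => K x f) N mTheta mH _ mN lipK).
  move=> x Tx; apply: measurable_funTS; apply: measurable_continuous.
  exact: contK.
move=> _ B mB; rewrite setTI.
have -> : total_K @^-1` B = (Theta `*` H `&` (fun z => K z.1 z.2) @^-1` B) `|`
    (~` (Theta `*` H) `&` [set _ | B 0]).
  apply/seteqP; split => z; rewrite /= /total_K.
    by case: ifPn => [|/negP]; rewrite in_setE => zD Bz; [left | right].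
  by case: ifPn => [|/negP]; rewrite in_setE => zD [] [] //.
apply: measurableU; first exact: mK.
apply: measurableI; first exact: measurableC.
by have [B0|B0] := pselect (B 0); [rewrite (_ : [set _ | _] = setT)//|
  rewrite (_ : [set _ | _] = set0)//]; apply/seteqP; split.
Qed.

Context (pi_theta : probability (measurableTypeR R) R) (pi_f : probability (borel H1) R)
  (pi_Theta : pi_theta Theta = 1%E) (pi_fH : pi_f H = 1%E).

Local Notation Pi := (pi_theta \x pi_f)%E.

Lemma prior_outside : Pi (~` (Theta `*` H)) = 0%E.
Proof.
have mD : measurable (Theta `*` H) by exact: measurableX.
have P1 : Pi (Theta `*` H) = 1%E.
  have e : (pi_theta Theta * pi_f H = 1)%E by rewrite pi_Theta pi_fH mule1.
  exact: etrans (product_measure1E pi_theta pi_f mTheta mH) e.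
have PU : Pi (Theta `*` H `|` ~` (Theta `*` H)) =
    (Pi (Theta `*` H) + Pi (~` (Theta `*` H)))%E.
  exact: (measureU (Pi : measure _ _) mD (measurableC mD) (setICr _)).
have PT : Pi setT = 1%E.
  have e : (pi_theta setT * pi_f setT = 1)%E by rewrite !probability_setT mule1.
  by rewrite -setXTT; exact: etrans (product_measure1E pi_theta pi_f measurableT measurableT) e.
move: PU; rewrite setUv P1 PT.
case: (Pi _) => [r| |]//; rewrite -EFinD => -[] r0; congr EFin.
by apply: (@addrI _ (1 : R)); rewrite -r0 addr0.
Qed.

Context {d : measure_display} {Omega : measurableType d} (P : probability Omega R)
  (W : H2 -> Omega -> R) (isoW : iso_gaussian P W) (v0 : H2).

(** Bayes' formula with the likelihood taken relative to the truth; the common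
    factor cancels. *)
Lemma posterior_lratio n w (B : set (measurableTypeR R * borel H1)) : (0 < n)%N ->
  measurable (B `&` (Theta `*` H)) ->
  posterior K Theta H pi_theta pi_f n (observation W v0 n w) B =
  fine (\int[Pi]_(z in B `&` (Theta `*` H)) (lratio W n v0 (total_K z) w)%:E)%E /
  fine (\int[Pi]_z (lratio W n v0 (total_K z) w)%:E)%E.
Proof.
move=> n0 mB; rewrite /posterior /bayes.
pose c := expR (n%:R / 2 * `|v0| ^+ 2 + Num.sqrt n%:R * W v0 w).
have c0 : 0 < c by exact: expR_gt0.
have mD : measurable (Theta `*` H) by exact: measurableX.
have ml : measurable_fun setT (fun z => (lratio W n v0 (total_K z) w)%:E).
  by apply/measurable_EFinP; exact: (measurable_lratio1 isoW n v0 measurable_total_K w).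
have l0 z : (0 <= (lratio W n v0 (total_K z) w)%:E)%E by rewrite lee_fin lratio_ge0.
have E (A : set (measurableTypeR R * borel H1)) : measurable A -> A `<=` Theta `*` H ->
    (\int[Pi]_(z in A) (likelihood n (observation W v0 n w) (K z.1 z.2))%:E =
     c%:E * \int[Pi]_(z in A) (lratio W n v0 (total_K z) w)%:E)%E.
  move=> mA AD; transitivity (\int[Pi]_(z in A)
      (c%:E * (lratio W n v0 (total_K z) w)%:E))%E.
    apply: eq_integral => -[x f]; rewrite inE => /AD[/= Tx Hf].
    by rewrite likelihood_lratio// total_KE.
  by rewrite ge0_integralZl// ?lee_fin ?(ltW c0)//; exact: measurable_funTS.
have fineM (x : \bar R) : fine (c%:E * x)%E = c * fine x.
  by case: x => [r| |] //=; rewrite ?gt0_muley ?gt0_muleNy ?lte_fin//= mulr0.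
have DE : (\int[Pi]_z (lratio W n v0 (total_K z) w)%:E =
    \int[Pi]_(z in Theta `*` H) (lratio W n v0 (total_K z) w)%:E)%E.
  rewrite (ge0_negligible_integral (measurableC mD) measurableT)//.
  - by rewrite setDE setCK setTI.
  - exact: prior_outside.
rewrite (_ : fine _ / fine _ =
    fine (c%:E * \int[Pi]_(z in B `&` (Theta `*` H)) (lratio W n v0 (total_K z) w)%:E)%E /
    fine (c%:E * \int[Pi]_(z in Theta `*` H) (lratio W n v0 (total_K z) w)%:E)%E).
  rewrite !fineM DE.
  by rewrite invfM mulrACA divff ?mul1r// gt_eqF.
by congr (fine _ / fine _); apply: E => // z [].
Qed.

Variables (n : nat) (w : Omega).
Hypothesis n_gt0 : (0 < n)%N.
Local Notation post := (posterior K Theta H pi_theta pi_f n (observation W v0 n w)).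
Local Notation mass B := (\int[Pi]_(z in B) (lratio W n v0 (total_K z) w)%:E)%E.
Hypotheses (mass_gt0 : (0 < mass setT)%E) (mass_fin : (mass setT < +oo)%E).

Let fin : mass setT \is a fin_num.
Proof. by rewrite ge0_fin_numE// ltW. Qed.

Let ml : measurable_fun setT (fun z => (lratio W n v0 (total_K z) w)%:E).
Proof. by apply/measurable_EFinP; exact: (measurable_lratio1 isoW n v0 measurable_total_K w). Qed.

Let l0 z : (0 <= (lratio W n v0 (total_K z) w)%:E)%E.
Proof. by rewrite lee_fin lratio_ge0. Qed.

Let mD : measurable (Theta `*` H). Proof. exact: measurableX. Qed.

Lemma mass_setC B : measurable B -> (mass B + mass (~` B) = mass setT)%E.
Proof.
move=> mB; rewrite -(setUv B) ge0_integral_setU//.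
- exact: measurableC.
- exact: measurable_funTS.
- exact/disj_setPCl.
Qed.

Let mass_le B : measurable B -> (mass B <= mass setT)%E.
Proof. by move=> mB; exact: ge0_subset_integral. Qed.

Let mass_fin_num B : measurable B -> mass B \is a fin_num.
Proof.
move=> mB; rewrite ge0_fin_numE ?integral_ge0//.
exact: le_lt_trans (mass_le mB) mass_fin.
Qed.

Let D := fine (mass setT).
Let D_gt0 : 0 < D. Proof. by apply: fine_gt0; rewrite mass_gt0. Qed.

(** This turns concentration of the posterior into a bound on integrals that no
    longer involves a quotient. *)
Lemma posterior_missing B e : measurable (B `&` (Theta `*` H)) ->
  1 - post B <= e -> (mass (~` (B `&` (Theta `*` H))) <= e%:E * mass setT)%E.
Proof.
move=> mB; rewrite posterior_lratio// -/D.
have mC := measurableC mB.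
have := mass_setC mB; rewrite -(fineK (mass_fin_num mB)) -(fineK (mass_fin_num mC)) -(fineK fin).
rewrite -EFinD => -[]; rewrite -/D; move: (fine (mass _)) (fine (mass _)) => a b ab.
rewrite -EFinM lee_fin lerBlDr -ler_pdivrMr//.
have D0 : D != 0 by rewrite gt_eqF.
have -> : b / D = 1 - a / D by rewrite -ab; field; rewrite ab.
lra.
Qed.

Lemma posterior_ge B c : measurable B ->
  (c%:E * mass setT <= mass B)%E -> c <= post B.
Proof.
move=> mB; have mBD : measurable (B `&` (Theta `*` H)) by exact: measurableI.
rewrite posterior_lratio// -/D ler_pdivlMr// -lee_fin EFinM fineK//.
rewrite fineK; last exact: mass_fin_num.
move=> /le_trans; apply.
rewrite [leLHS](ge0_negligible_integral (measurableC mD) mB)//.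
- by rewrite setDE setCK.
- exact: measurable_funTS.
- exact: prior_outside.
Qed.

Lemma posterior_setC B : measurable B -> post (~` B) = 1 - post B.
Proof.
move=> mB; have mBD : measurable (B `&` (Theta `*` H)) by exact: measurableI.
have mCD : measurable (~` B `&` (Theta `*` H)) by apply: measurableI => //; exact: measurableC.
rewrite !posterior_lratio// -/D.
have h : (mass (B `&` (Theta `*` H)) + mass (~` B `&` (Theta `*` H)) = mass setT)%E.
  rewrite -ge0_integral_setU//.
  - rewrite -setIUl setUv setTI (ge0_negligible_integral (measurableC mD) measurableT)//.
    + by rewrite setDE setCK setTI.
    + exact: prior_outside.
  - exact: measurable_funTS.
  - by apply/disj_setPRL => z [nB _] [].
move: h; rewrite -(fineK (mass_fin_num mBD)) -(fineK (mass_fin_num mCD)) -(fineK fin).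
rewrite -EFinD => -[]; rewrite -/D; move: (fine (mass _)) (fine (mass _)) => a b ab.
have D0 : D != 0 by rewrite gt_eqF.
by rewrite /= -ab; field; rewrite ab.
Qed.

End posterior_ratio.
(** * The prior of the parameter *)

Section parameter_prior.
Context {R : realType} (Theta : set R) (cptTheta : compact Theta) (p : R -> R)
  (mp : measurable_fun (Theta : set (measurableTypeR R)) p)
  (p_gt0 : forall theta, Theta theta -> 0 < p theta)
  (pi_theta : probability (measurableTypeR R) R)
  (pi_thetaE : forall B : set (measurableTypeR R), measurable B ->
    pi_theta B = (\int[lebesgue_measure]_(x in B `&` Theta) (p x)%:E)%E)
  (theta0 : R) (theta0_int : interior Theta theta0)
  (p_cont : {for theta0, continuous p}).
Local Notation mu := (@lebesgue_measure R).

Lemma measurable_parameters : measurable (Theta : set (measurableTypeR R)).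
Proof.
by apply: closed_measurable; exact: compact_closed.
Qed.

Lemma prior_parameters : pi_theta Theta = 1%E.
Proof.
rewrite pi_thetaE; last exact: measurable_parameters.
by rewrite setIid -(setTI Theta) -pi_thetaE// probability_setT.
Qed.

Let prior_density : is_density mu pi_theta (p \_ Theta).
Proof.
have mT := measurable_parameters; split.
- exact: ((measurable_restrictT p mT).1 mp).
- by move=> x; rewrite patchE; case: ifPn => // /set_mem /p_gt0/ltW.
- move=> B mB; rewrite pi_thetaE// integral_mkcondr; apply: eq_integral => x _.
  by rewrite !patchE; case: ifP.
Qed.

Let prior_integral (F : set (measurableTypeR R)) (g : R -> R) : measurable F ->
  F `<=` Theta -> measurable_fun setT g -> (forall x, 0 <= g x) ->
  (\int[pi_theta]_(x in F) (g x)%:E = \int[mu]_(x in F) (g x * p x)%:E)%E.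
Proof.
move=> mF FT mg g0; rewrite integral_mkcond (integral_density prior_density).
- rewrite [RHS]integral_mkcond; apply: eq_integral => x _; rewrite !patchE.
  case: ifPn => xF; last by rewrite mul0e.
  by rewrite (mem_set (FT _ (set_mem xF))) EFinM.
- apply/(measurable_restrictT _ _).1 => //; exact/measurable_EFinP/measurable_funTS.
- by move=> x; rewrite patchE; case: ifP => _; rewrite ?lee_fin.
Qed.

(** Near an interior point the prior is almost a multiple of Lebesgue measure. *)
Lemma prior_local e : 0 < e -> exists r : R, [/\ 0 < r,
  forall x, `|x - theta0| < r -> Theta x &
  forall (F : set (measurableTypeR R)) (g : R -> R), measurable F ->
    (forall x, F x -> `|x - theta0| < r) ->
    measurable_fun setT g -> (forall x, 0 <= g x) ->
    (((1 - e) * p theta0)%:E * \int[mu]_(x in F) (g x)%:E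
       <= \int[pi_theta]_(x in F) (g x)%:E)%E /\
    (\int[pi_theta]_(x in F) (g x)%:E
       <= ((1 + e) * p theta0)%:E * \int[mu]_(x in F) (g x)%:E)%E].
Proof.
move=> e0; have T0 : Theta theta0 := interior_subset theta0_int.
have p0 := p_gt0 T0; have ep0 : 0 < e * p theta0 by rewrite mulr_gt0.
have /nbhs_ballP[r /= r0 near_r] : \forall x \near theta0,
    Theta x /\ `|p theta0 - p x| < e * p theta0.
  by apply: filterI => //; move/cvgrPdist_lt: p_cont; apply.
have ball_r x : `|x - theta0| < r -> Theta x /\ `|p theta0 - p x| < e * p theta0.
  by move=> xr; apply: near_r; rewrite /ball/= distrC.
exists r; split => // [x /ball_r[]//|F g mF Fr mg g0].
have FT : F `<=` Theta by move=> x /Fr/ball_r[].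
have mgF : measurable_fun F (fun x => (g x)%:E).
  by apply: measurable_funTS; exact/measurable_EFinP.
have mp' : measurable_fun F (fun x => (g x * p x)%:E).
  apply/measurable_EFinP; apply: measurable_funM; first exact: measurable_funTS.
  exact: (measurable_funS measurable_parameters FT mp).
have pF x : F x -> (1 - e) * p theta0 <= p x <= (1 + e) * p theta0.
  by move=> /Fr/ball_r[_]; rewrite ltr_norml => /andP[]; lra.
rewrite prior_integral//; split.
- have [e1|e1] := leP e 1; last first.
    apply: (@le_trans _ _ 0%E).
      rewrite mule_le0_ge0 ?lee_fin ?mulr_le0_ge0 ?(ltW p0)//; first lra.
      by apply: integral_ge0 => x _; rewrite lee_fin.
    apply: integral_ge0 => x Fx; rewrite lee_fin mulr_ge0//.
    exact: ltW (p_gt0 (FT _ Fx)).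
  have c0 : 0 <= (1 - e) * p theta0 by rewrite mulr_ge0 ?(ltW p0)//; lra.
  rewrite -ge0_integralZl//; last by move=> x _; rewrite lee_fin.
  apply: ge0_le_integral => //.
  + by move=> x _; rewrite -EFinM lee_fin mulr_ge0.
  + exact: measurable_funeM.
  + move=> x /pF/andP[px _]; rewrite -EFinM lee_fin mulrC; exact: ler_wpM2l.
- have c0 : 0 <= (1 + e) * p theta0 by rewrite mulr_ge0 ?(ltW p0)//; lra.
  rewrite -ge0_integralZl//; last by move=> x _; rewrite lee_fin.
  apply: ge0_le_integral => //.
  + move=> x Fx; rewrite lee_fin mulr_ge0//; exact: ltW (p_gt0 (FT _ Fx)).
  + exact: measurable_funeM.
  + move=> x /pF/andP[_ px]; rewrite -EFinM lee_fin [leRHS]mulrC; exact: ler_wpM2l.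
Qed.

Lemma measurable_near (e : R) :
  measurable ([set x | `|x - theta0| < e] : set (measurableTypeR R)).
Proof.
rewrite -[X in measurable X]setTI; apply: measurable_set_ltr => //.
by apply: measurableT_comp => //; exact: measurable_funB.
Qed.

Lemma prior_near : exists r : R, 0 < r /\ forall e : R, 0 <= e -> e <= r ->
  (pi_theta ([set x | (`|x - theta0| < e)%R] : set R) <= (4 * p theta0 * e)%R%:E)%E.
Proof.
have [r [r0 _ h]] := prior_local ltr01; exists r; split => // e e0 er.
have me := measurable_near e.
have er' x : `|x - theta0| < e -> `|x - theta0| < r by move/lt_le_trans; apply.
have [_] := h _ (cst 1) me er' (measurable_cst _) (fun _ => ler01).
have cstE (m : {measure set (measurableTypeR R) -> \bar R}) (A : set (measurableTypeR R)) :
    measurable A -> (\int[m]_(x in A) (cst 1%R x)%:E = m A)%E.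
  by move=> mA; rewrite -[RHS]mul1e -integral_cst.
rewrite !cstE// => /le_trans; apply.
rewrite (_ : [set x | _] = ball theta0 e); last first.
  by apply/seteqP; split => x /=; rewrite /ball/= distrC.
have b : (mu (ball theta0 e) <= (e *+ 2)%:E)%E by rewrite lebesgue_measure_ball.
have c0 : (0 <= ((1 + 1) * p theta0)%:E)%E.
  by rewrite lee_fin mulr_ge0// ltW// p_gt0//; exact: interior_subset theta0_int.
apply: le_trans (lee_wpmul2l c0 b) _; rewrite -EFinM lee_fin le_eqVlt; apply/orP; left; apply/eqP; ring.
Qed.

End parameter_prior.
(** * Local expansion of the log-likelihood ratio *)

Section local_expansion.
Context {R : realType} {H1 H2 : hilbertType R} (Theta : set R)
  (K : R -> {linear H1 -> H2}) (H : set H1) (normH : H1 -> R)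
  (subH : normed_subspace H normH) (Kdot : R -> H1 -> H2)
  (S : set H2) (normS : H2 -> R) (subS : normed_subspace S normS)
  (Cs D1 D2 D3 : R).
Hypotheses (Cs_ge0 : 0 <= Cs) (D1_ge0 : 0 <= D1) (D2_ge0 : 0 <= D2) (D3_ge0 : 0 <= D3)
  (strongS : forall h, S h -> `|h| <= Cs * normS h)
  (K_le : forall theta f, Theta theta -> H f -> `|K theta f| <= D1 * `|f|)
  (Kdot_le : forall theta f, Theta theta -> H f -> `|Kdot theta f| <= D1 * `|f|)
  (K_lip : forall theta theta1 f, Theta theta -> Theta theta1 -> H f ->
    let v := K theta f - K theta1 f in
    S v /\ normS v <= D2 * `|theta - theta1| * normH f)
  (K_taylorS : forall theta theta1 f, Theta theta -> Theta theta1 -> H f ->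
    let v := K theta f - K theta1 f - (theta - theta1) *: Kdot theta1 f in
    S v /\ normS v <= D3 * `|theta - theta1| ^+ 2 * normH f).
Variables (theta0 r : R).
Hypotheses (r_gt0 : 0 < r) (rTheta : forall theta, `|theta - theta0| < r -> Theta theta).
Variables (f0 gamma : H1).
Hypotheses (Hf0 : H f0) (Hgamma : H gamma).

(** The derivative of the mean in the parameter minus its projection on the
    directions available through [f]; its squared norm is the efficient
    information. *)
Definition efficient_direction := Kdot theta0 f0 - K theta0 gamma.
Local Notation v := efficient_direction.
Hypothesis orth : forall h, H h -> dotp v (K theta0 h) = 0.

Variables (M Gb : R) (g : H1).
Hypotheses (M_ge0 : 0 <= M) (Hg : H g) (g_le : `|g| <= Gb).

(** Constants of the expansion, uniform in the sample size. *)
Definition taylor_const := Cs * D3.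
Local Notation c3 := taylor_const.
Definition radius_const := M + normH f0.
Local Notation N := radius_const.
Definition entropy_scale := D2 * N + D3 * normH f0 + 1.
Local Notation CS := entropy_scale.
Definition small_const := 1 + c3 * N + c3 * normH f0.
Definition shift_const := 1 + c3 * N + 2 * D1 * Gb.
Local Notation Cu := shift_const.

Let Theta0 : Theta theta0. Proof. by apply: rTheta; rewrite subrr normr0. Qed.

Let N0_ge0 : 0 <= normH f0. Proof. exact (subspace_norm_ge0 subH Hf0). Qed.

Let N_ge0 : 0 <= N. Proof. exact: addr_ge0. Qed.

Let c3_ge0 : 0 <= c3. Proof. exact: mulr_ge0. Qed.

Let Gb_ge0 : 0 <= Gb. Proof. exact: le_trans g_le. Qed.

Let D2N_ge0 : 0 <= D2 * N. Proof. exact: mulr_ge0. Qed.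
Let D3N_ge0 : 0 <= D3 * normH f0. Proof. exact: mulr_ge0. Qed.
Let c3N_ge0 : 0 <= c3 * N. Proof. exact: mulr_ge0. Qed.
Let c3N0_ge0 : 0 <= c3 * normH f0. Proof. exact: mulr_ge0. Qed.
Let D1G_ge0 : 0 <= D1 * Gb. Proof. exact: mulr_ge0. Qed.

Lemma entropy_scale_gt0 : 0 < CS.
Proof. by rewrite /entropy_scale; have := D2N_ge0; have := D3N_ge0; lra. Qed.

Lemma shift_const_ge0 : 0 <= Cu.
Proof. by rewrite /shift_const; have := c3N_ge0; have := D1G_ge0; lra. Qed.

Lemma small_const_ge0 : 0 <= small_const.
Proof. by rewrite /small_const; have := c3N_ge0; have := c3N0_ge0; lra. Qed.

Let taylor theta theta1 f : Theta theta -> Theta theta1 -> H f ->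
  `|K theta f - K theta1 f - (theta - theta1) *: Kdot theta1 f|
    <= c3 * `|theta - theta1| ^+ 2 * normH f.
Proof.
move=> Tt Tt1 Hf; have [Sv vS] := K_taylorS Tt Tt1 Hf.
apply: le_trans (strongS Sv) _.
by rewrite /taylor_const -(mulrA Cs) -(mulrA Cs) ler_wpM2l.
Qed.

Variables (e x : R) (theta : R) (f' : H1) (y : R).
Local Notation t := (theta - theta0).
Local Notation D h := (K theta h - K theta0 h).
Hypotheses (e_le1 : e <= 1) (e_ltr : e <= r) (e_lex : e <= x) (te : `|t| < e)
  (Hf' : H f') (f'K : `|K theta0 (f' - f0)| <= e) (f'Kdot : `|Kdot theta0 (f' - f0)| <= x)
  (f'M : normH f' <= M) (yt : `|y + t| <= e).

Let f := f' + y *: g.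
Let e_gt0 : 0 < e. Proof. exact: le_lt_trans te. Qed.
Let x_gt0 : 0 < x. Proof. exact: lt_le_trans e_lex. Qed.
Let Tt : Theta theta. Proof. by apply: rTheta; exact: lt_le_trans e_ltr. Qed.
Let t_ltr : `|t| < r. Proof. exact: lt_le_trans e_ltr. Qed.
Let Hf'0 : H (f' - f0). Proof. exact: (subspaceB subH Hf' Hf0). Qed.
Let f'N : normH (f' - f0) <= N.
Proof. by apply: le_trans (subspace_normB subH Hf' Hf0) _; rewrite lerD2r. Qed.
Let tt : `|t| ^+ 2 <= `|t| * e.
Proof. by rewrite expr2 ler_wpM2l// ltW. Qed.
Let tx : `|t| * e <= `|t| * x. Proof. by rewrite ler_wpM2l. Qed.

(** The part of the increment of the operator that is of order [t] in [S] but of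
    smaller order in [H2]. *)
Let sm := D (f' - f0) + (D f0 - t *: Kdot theta0 f0).

Let Df'0 : `|D (f' - f0)| <= `|t| * (x + c3 * N * e).
Proof.
have := ler_normD (D (f' - f0) - t *: Kdot theta0 (f' - f0)) (t *: Kdot theta0 (f' - f0)).
rewrite subrK normrZ => /le_trans; apply.
have h1 := taylor Tt Theta0 Hf'0.
have h2 : `|t| * `|Kdot theta0 (f' - f0)| <= `|t| * x by rewrite ler_wpM2l.
have h3 : c3 * `|t| ^+ 2 * normH (f' - f0) <= c3 * (`|t| * e) * N.
  have n0 := subspace_norm_ge0 subH Hf'0.
  rewrite ler_pM//; first by rewrite mulr_ge0// exprn_ge0.
  exact: ler_wpM2l.
lra.
Qed.

Let w_le : `|D f0 - t *: Kdot theta0 f0| <= c3 * normH f0 * t ^+ 2.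
Proof.
apply: le_trans (taylor Tt Theta0 Hf0) _.
by rewrite real_normK ?num_real// mulrAC.
Qed.

Let sm_le : `|sm| <= `|t| * (small_const * x).
Proof.
apply: le_trans (ler_normD _ _) _.
have h1 := Df'0; have h2 := w_le.
have h3 : c3 * normH f0 * t ^+ 2 <= c3 * normH f0 * (`|t| * x).
  by rewrite ler_wpM2l// -real_normK ?num_real// (le_trans tt).
have h4 : c3 * N * (`|t| * e) <= c3 * N * (`|t| * x) by rewrite ler_wpM2l.
by rewrite /small_const; lra.
Qed.

Let smS : S sm /\ normS sm <= `|t| * CS.
Proof.
have [S1 n1] := K_lip Tt Theta0 Hf'0; have [S2 n2] := K_taylorS Tt Theta0 Hf0.
split; first exact: (subspaceD subS S1 S2).
apply: le_trans (subspace_normD subS S1 S2) _.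
have h1 : D2 * `|t| * normH (f' - f0) <= D2 * `|t| * N by rewrite ler_wpM2l// mulr_ge0.
have h2 : D3 * `|t| ^+ 2 * normH f0 <= D3 * `|t| * normH f0.
  rewrite ler_wpM2r// ler_wpM2l// (le_trans tt)// ler_piMr//.
have := normr_ge0 t.
by rewrite /entropy_scale; lra.
Qed.

(** Moving [f] by [t *: g] compensates the change of the parameter up to the
    efficient direction. The remainder is a multiple [t * CS] of an element of the
    unit ball of [S] that is small in [H2], where the modulus of continuity of the
    noise applies, and of two explicit terms. *)
Lemma increment_split : exists s, [/\ S s, normS s <= 1,
  `|s| <= small_const * x / CS &
  K theta f = K theta0 (f + t *: g) + t *: v + (t * CS) *: s
    - t *: K theta0 (g - gamma) + y *: D g].
Proof.
have CS0 := entropy_scale_gt0; have [Ss nS] := smS.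
have [t0|t0] := eqVneq t 0.
  have sm0 : sm = 0.
    have th : theta = theta0 by apply/eqP; rewrite -subr_eq0 t0.
    by rewrite /sm th !subrr scale0r subr0 addr0.
  exists 0; split; first exact: subspace0 subS.
  - by rewrite -(scale0r 0) (subspace_normZ subS _ (subspace0 subS)) normr0 mul0r.
  - by rewrite normr0 divr_ge0 ?mulr_ge0 ?small_const_ge0// ltW.
  - have th : theta = theta0 by apply/eqP; rewrite -subr_eq0 t0.
    by rewrite t0 th mul0r !scale0r subrr scaler0 !addr0 subr0.
have T0 : 0 < `|t| by rewrite normr_gt0.
have TC : 0 < `|t| * CS by rewrite mulr_gt0.
have nt : `|(t * CS)^-1| = (`|t| * CS)^-1 by rewrite normfV normrM (gtr0_norm CS0).
exists ((t * CS)^-1 *: sm); split.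
- exact: (subspaceZ subS).
- by rewrite (subspace_normZ subS)// nt mulrC ler_pdivrMr// mul1r.
- by rewrite normrZ nt mulrC ler_pdivrMr// mulrA mulrAC divfK ?gt_eqF// mulrC.
- have tC0 : t * CS != 0 by rewrite mulf_neq0// gt_eqF.
  have -> : (t * CS) *: ((t * CS)^-1 *: sm) = sm by rewrite scalerA divff// scale1r.
  rewrite /sm /efficient_direction /f.
  by rewrite !(linearD, linearN, linearZ) /=; vector.
Qed.

Let a := K theta0 (f + t *: g - f0).
Let u := D (f - f0).

Let al := (1 + D1 * Gb) * e.

Let Hf0g : H (f + t *: g - f0).
Proof.
apply: (subspaceB subH) => //; apply: (subspaceD subH); last exact: (subspaceZ subH).
by apply: (subspaceD subH) => //; exact: (subspaceZ subH).
Qed.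

Let Kg : `|K theta0 g| <= D1 * Gb.
Proof. by apply: le_trans (K_le Theta0 Hg) _; rewrite ler_wpM2l. Qed.

Let a_le : `|a| <= al.
Proof.
have -> : a = K theta0 (f' - f0) + (y + t) *: K theta0 g.
  by rewrite /a /f !(linearD, linearN, linearZ) /=; vector.
apply: le_trans (ler_normD _ _) _; rewrite normrZ /al.
have : `|y + t| * `|K theta0 g| <= e * (D1 * Gb) by rewrite ler_pM.
have := f'K; lra.
Qed.

Let y_le : `|y| <= 2 * e.
Proof.
have : `|y| <= `|y + t| + `|t| by rewrite -{1}(addrK t y); exact: ler_normB.
by have := ltW te; have := yt; lra.
Qed.

Let u_le : `|u| <= `|t| * (Cu * x).
Proof.
have -> : u = D (f' - f0) + y *: D g.
  by rewrite /u /f !(linearD, linearN, linearZ) /=; vector.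
apply: le_trans (ler_normD _ _) _; rewrite normrZ.
have h1 := Df'0.
have h2 : `|y| * `|D g| <= 2 * e * (D1 * `|t| * Gb).
  rewrite ler_pM// (le_trans (K_lipschitz subH c3_ge0 Kdot_le taylor rTheta D1_ge0 t_ltr Hg))//.
  by rewrite ler_wpM2l// mulr_ge0.
have h3 : D1 * Gb * (`|t| * e) <= D1 * Gb * (`|t| * x) by rewrite ler_wpM2l.
have h4 : c3 * N * (`|t| * e) <= c3 * N * (`|t| * x) by rewrite ler_wpM2l.
by rewrite /shift_const; lra.
Qed.

Variables (n kb d1 : R).
Hypotheses (n_ge0 : 0 <= n) (kb_le : `|K theta0 (g - gamma)| <= kb).

Hypothesis cross_le :
  Num.sqrt n * al * (Cu * x) <= d1 \/
  (forall (h : H1) th th1, Theta th -> Theta th1 -> `|K th h| = `|K th1 h|) /\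
    (Cu * x) ^+ 2 / 2 + D1 * Gb * (Cu * x) <= d1.

Let Cux_ge0 : 0 <= Cu * x. Proof. by rewrite mulr_ge0 ?shift_const_ge0// ltW. Qed.

Let nt2 : 0 <= n * t ^+ 2. Proof. by rewrite mulr_ge0 ?sqr_ge0. Qed.

Let sqrt_nt : Num.sqrt n * `|t| <= 1 + n * t ^+ 2.
Proof.
have h : n * t ^+ 2 = (Num.sqrt n * `|t|) ^+ 2.
  by rewrite exprMn sqr_sqrtr// real_normK ?num_real.
rewrite h; have : 0 <= Num.sqrt n * `|t| by rewrite mulr_ge0 ?sqrtr_ge0.
move: (Num.sqrt n * `|t|) => z z0; have := sqr_ge0 (z - 1); lra.
Qed.

Let al_ge0 : 0 <= al. Proof. by rewrite mulr_ge0 ?(ltW e_gt0)//; have := D1G_ge0; lra. Qed.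

Let cross : n * `|dotp a u| <= d1 * (1 + n * t ^+ 2).
Proof.
have sn := sqrtr_ge0 n; have nt0 := nt2.
case: cross_le => [d1_ge|[const d1_ge]].
  have h : `|dotp a u| <= al * (`|t| * (Cu * x)).
    by apply: le_trans (cauchy_schwarz _ _) _; rewrite ler_pM.
  have h1 : n * `|dotp a u| <= n * (al * (`|t| * (Cu * x))) by rewrite ler_wpM2l.
  have h2 : n * (al * (`|t| * (Cu * x))) =
      (Num.sqrt n * al * (Cu * x)) * (Num.sqrt n * `|t|).
    by rewrite -{1}(sqr_sqrtr n_ge0); ring.
  have p0 : 0 <= Num.sqrt n * al * (Cu * x) by rewrite mulr_ge0// mulr_ge0.
  apply: le_trans h1 _; rewrite h2; apply: (@le_trans _ _ (Num.sqrt n * al * (Cu * x) * (1 + n * t ^+ 2))).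
    by rewrite ler_wpM2l.
  by rewrite ler_wpM2r//; lra.
have E : dotp a u = - (`|u| ^+ 2 / 2) + t * dotp (K theta0 g) u.
  have c : `|K theta0 (f - f0) + u| ^+ 2 = `|K theta0 (f - f0)| ^+ 2.
    by rewrite /u addrC subrK (const (f - f0) theta theta0).
  have -> : a = K theta0 (f - f0) + t *: K theta0 g.
    by rewrite /a !(linearD, linearN, linearZ) /=; vector.
  by move: c; rewrite normD_dotp dotpDl dotpZl; lra.
have g1 : `|dotp (K theta0 g) u| <= D1 * Gb * (`|t| * (Cu * x)).
  by apply: le_trans (cauchy_schwarz _ _) _; rewrite ler_pM.
have u2 : `|u| ^+ 2 <= (`|t| * (Cu * x)) ^+ 2 by rewrite lerXn2r ?nnegrE// (le_trans _ u_le).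
have tE : `|t| * `|t| = t ^+ 2 by rewrite -expr2 real_normK ?num_real.
have h : `|dotp a u| <= t ^+ 2 * ((Cu * x) ^+ 2 / 2 + D1 * Gb * (Cu * x)).
  rewrite E; apply: le_trans (ler_normD _ _) _; rewrite normrN [X in _ + X]normrM.
  rewrite (@ger0_norm _ (_ / 2)) ?divr_ge0 ?sqr_ge0//.
  have : `|t| * `|dotp (K theta0 g) u| <= `|t| * (D1 * Gb * (`|t| * (Cu * x))) by rewrite ler_wpM2l.
  have -> : `|t| * (D1 * Gb * (`|t| * (Cu * x))) = t ^+ 2 * (D1 * Gb * (Cu * x)) by rewrite -tE; ring.
  by move: u2; rewrite [(`|t| * _) ^+ 2]exprMn (real_normK (num_real t)); lra.
have h1 := ler_wpM2l n_ge0 h.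
have p0 : 0 <= (Cu * x) ^+ 2 / 2 + D1 * Gb * (Cu * x).
  by rewrite addr_ge0// ?divr_ge0 ?sqr_ge0//; exact: mulr_ge0.
move: h1 d1_ge p0; move: (_ / 2 + _) => X h1 d1_ge p0.
apply: le_trans h1 _; rewrite mulrA mulrC; apply: ler_pM => //.
by rewrite lerDr.
Qed.

Definition shift_rate := Cu * x + c3 * normH f0 * e + kb.
Local Notation rho := shift_rate.
Definition expansion_error := d1 + al * (c3 * normH f0) + Num.sqrt n * al * kb
  + `|v| * rho + rho ^+ 2.

Let kb_ge0 : 0 <= kb. Proof. exact: le_trans kb_le. Qed.

(** The cross term between [a] and [u] is the only one that needs a rate: either
    the bound on [u] is fast enough, or constancy of the norms makes the leading
    part of the cross term a square. *)
Lemma quadratic_expansion :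
  `|n / 2 * (`|K theta f - K theta0 f0| ^+ 2 - `|a| ^+ 2 - t ^+ 2 * `|v| ^+ 2)|
    <= expansion_error * (1 + n * t ^+ 2).
Proof.
pose w := D f0 - t *: Kdot theta0 f0; pose k := K theta0 (g - gamma).
have -> : K theta f - K theta0 f0 = a + t *: v + (u + w - t *: k).
  by rewrite /a /u /w /k /efficient_direction !(linearD, linearN, linearZ) /=; vector.
apply: quadratic_remainder => //.
- by rewrite dotpC orth.
- rewrite mulrDr mulrDr; apply: le_trans (ler_normB _ _) _; rewrite normrZ.
  have h1 := ler_normD u w; have h2 := u_le; have h3 := w_le.
  have h4 : `|t| * `|k| <= `|t| * kb by rewrite ler_wpM2l.
  have h5 : c3 * normH f0 * t ^+ 2 <= c3 * normH f0 * (`|t| * e).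
    by rewrite ler_wpM2l// -real_normK ?num_real.
  by move: h3; rewrite -/w; lra.
- by rewrite addr_ge0// addr_ge0// mulr_ge0// ltW.
Qed.

Context {d : measure_display} {Omega : measurableType d} (P : probability Omega R)
  (W : H2 -> Omega -> R) (isoW : iso_gaussian P W) (m : nat) (nE : n = m%:R).
Variables (G : set Omega) (del sig : R).
Hypotheses (modG : forall s, S s -> normS s <= 1 -> `|s| <= sig ->
    P (G `&` [set w | del < `|W s w|]) = 0%E)
  (mG : measurable G) (sig_ge : small_const * x / CS <= sig) (del_ge0 : 0 <= del).

(** Local asymptotic normality along the least favourable direction: relative to
    the shifted function at the true parameter, the log-likelihood ratio is the
    Gaussian one up to an error that is small compared with [1 + n t^2]. The term
    with [y] is not uniformly small and is dealt with in the mean. *)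
Lemma log_lratio_expansion : {ae P, forall w, G w ->
  `|log_lratio W m (K theta0 f0) (K theta f) w
    - log_lratio W m (K theta0 f0) (K theta0 (f + t *: g)) w
    - (Num.sqrt n * W v w * t - n * `|v| ^+ 2 * t ^+ 2 / 2)|
  <= (expansion_error + CS * del + `|W (K theta0 (g - gamma)) w|) * (1 + n * t ^+ 2)
     + Num.sqrt n * `|y| * `|W (D g) w|}.
Proof.
have [s [Ss s1 ssig sE]] := increment_split.
have ae1 : {ae P, forall w, G w -> `|W s w| <= del}.
  exists (G `&` [set w | del < `|W s w|]); split.
  - apply: measurableI => //; rewrite -[X in measurable X]setTI.
    apply: measurable_set_ltr => //.
    by apply: measurableT_comp => //; exact: measurable_noise isoW _.
  - by apply: modG => //; exact: le_trans sig_ge.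
  - by move=> w /= /not_implyP[Gw /negP]; rewrite -ltNge.
have ae2 := noise_sum_ae0 isoW (s := [:: (1, K theta f); (-1, K theta0 (f + t *: g));
   (- t, v); (- (t * CS), s); (t, K theta0 (g - gamma)); (- y, D g)]).
have {}ae2 := ae2 _.
apply: filterS2 ae1 (ae2 _); last first.
  by rewrite /vec_sum !big_cons big_nil /= sE; vector.
move=> w del_w; rewrite /noise_sum !big_cons big_nil /= => E Gw.
have {del_w} Ws := del_w Gw.
set k := W (K theta0 (g - gamma)) w; set z := W (D g) w.
have {}E : W (K theta f) w - W (K theta0 (f + t *: g)) w =
   t * W v w + t * CS * W s w - t * k + y * z by rewrite /k /z; lra.
rewrite /log_lratio -nE.
set q1 := W (K theta f) w in E *; set q2 := W (K theta0 (f + t *: g)) w in E *.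
have aE : K theta0 (f + t *: g) - K theta0 f0 = a by rewrite /a linearB.
rewrite aE; set Q := n / 2 * (`|K theta f - K theta0 f0| ^+ 2 - `|a| ^+ 2 - t ^+ 2 * `|v| ^+ 2).
have -> : Num.sqrt n * (q1 - W (K theta0 f0) w) - n / 2 * `|K theta f - K theta0 f0| ^+ 2 -
   (Num.sqrt n * (q2 - W (K theta0 f0) w) - n / 2 * `|a| ^+ 2) -
   (Num.sqrt n * W v w * t - n * `|v| ^+ 2 * t ^+ 2 / 2) =
   Num.sqrt n * t * (CS * W s w - k) + Num.sqrt n * y * z - Q.
  have -> : q1 = q2 + (t * W v w + t * CS * W s w - t * k + y * z) by rewrite -E; ring.
  by rewrite /Q; field.
apply: le_trans (ler_normB _ _) _.
have h1 := ler_normD (Num.sqrt n * t * (CS * W s w - k)) (Num.sqrt n * y * z).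
have h2 : `|Q| <= expansion_error * (1 + n * t ^+ 2) := quadratic_expansion.
have h3 : `|Num.sqrt n * t * (CS * W s w - k)| <= (1 + n * t ^+ 2) * (CS * del + `|k|).
  rewrite normrM normrM (ger0_norm (sqrtr_ge0 n)) ler_pM ?mulr_ge0//.
  apply: le_trans (ler_normB _ _) _; rewrite lerD2r normrM gtr0_norm ?entropy_scale_gt0//.
  by rewrite ler_wpM2l// ltW// entropy_scale_gt0.
have h4 : `|Num.sqrt n * y * z| = Num.sqrt n * `|y| * `|z|.
  by rewrite !normrM (ger0_norm (sqrtr_ge0 n)).
rewrite h4 in h1.
lra.
Qed.

End local_expansion.
(** * Measurability and translations of the prior *)

Lemma measurable_hull {R : realType} {d : measure_display} {T : measurableType d}
    (mu : {measure set T -> \bar R}) (A : set T) (c e : R) :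
  0 < e -> (mu_ext mu A <= c%:E)%E ->
  exists B, [/\ measurable B, A `<=` B & (mu B <= (c + e)%:E)%E].
Proof.
move=> e0 Ac; have fin : mu_ext mu A \is a fin_num.
  rewrite ge0_fin_numE; first by apply: le_lt_trans Ac _; rewrite ltry.
  exact: mu_ext_ge0.
have [_ [F [mF AF] <-] Fe] := lb_ereal_inf_adherent e0 fin.
exists (\bigcup_k F k); split => //; first exact: bigcup_measurable.
apply: (@le_trans _ _ (\sum_(0 <= k <oo) mu (F k))%E).
  apply: measure_sigma_subadditive => //; exact: bigcup_measurable.
by apply: ltW; apply: lt_le_trans Fe _; rewrite EFinD leeD2r.
Qed.

Lemma measurable_lipschitz {R : realType} {V : normedModType R} (D : set (borel V))
    (phi : V -> R) (C : R) : measurable D -> 0 <= C ->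
  (forall x y, D x -> D y -> phi x <= phi y + C * `|x - y|) ->
  measurable_fun D (phi : borel V -> R).
Proof.
move=> mD C0 lip.
apply: (measurability (@RGenInftyO.G R)) => [|/= _ [_] [a] -> <-].
  exact: RGenInftyO.measurableE.
rewrite (_ : D `&` _ = D `&` \bigcup_(y in [set y | D y /\ phi y < a])
    ball y ((a - phi y) / (C + 1))).
  apply: measurableI => //; apply: sub_sigma_algebra.
  apply: bigcup_open => y [Dy ya]; exact: ball_open.
have C1 : 0 < C + 1 by lra.
apply/seteqP; split => x [Dx]/=.
  rewrite in_itv/= => xa; split => //; exists x => //.
  by apply: ballxx; rewrite divr_gt0// subr_gt0.
move=> [y [Dy ya]]; rewrite -ball_normE/= => xy; split => //; rewrite in_itv/=.
apply: le_lt_trans (lip x y Dx Dy) _.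
move: xy; rewrite ltr_pdivlMr// distrC mulrDr mulr1 mulrC.
have := normr_ge0 (x - y); lra.
Qed.

(** The translation is a Caratheodory function of the parameter and the function. *)
Lemma measurable_translation {R : realType} {V : normedModType R} (g : V) (x0 : R) :
  separable V ->
  measurable_fun setT ((fun z => z.2 + (z.1 - x0) *: g) : measurableTypeR R * borel V -> borel V).
Proof.
move=> sepV; rewrite -setXTT.
apply: (@measurable_caratheodory R _ (borel V) V sepV setT setT
  (fun x f => f + (x - x0) *: g) (cst `|g|)) => //.
- move=> x _; apply: measurable_continuous => f.
  by apply: cvgD; [exact: cvg_id|exact: cvg_cst].
- move=> x y f _ _ _; rewrite opprD addrACA subrr add0r -scalerBl normrZ.
  by rewrite opprB addrA subrK.
Qed.

Lemma lne_bound {R : realType} (x c : R) : 0 <= x -> (`|lne x%:E| <= c%:E)%E ->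
  expR (- c) <= x <= expR c.
Proof.
move=> x0; rewrite /lne; case: ifPn => [_|xn0]; first by rewrite leNgt ltry.
have {}x0 : 0 < x by rewrite ltNge.
rewrite lee_fin ler_norml => /andP[l1 l2].
have e : expR (ln x) = x by rewrite lnK ?posrE.
by rewrite -e !ler_expR l1.
Qed.

(** Outside [B] the densities of the translated priors are within a factor
    [expR c] of one, which changes integrals by at most this factor. The upper
    bound starts from the prior translated by [- t *: g], the lower bound from the
    prior itself. *)
Section prior_translation.
Context {R : realType} {V : normedModType R} (pi : probability (borel V) R) (g : V).
Variables (t c : R) (B : set (borel V)) (r1 r2 : borel V -> R).
Hypotheses (mB : measurable B)
  (r1E : is_density (shift_law pi (- t *: g)) (shift_law pi ((- t + t) *: g)) r1)
  (r2E : is_density (shift_law pi (0 *: g)) (shift_law pi ((0 + t) *: g)) r2)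
  (r1_le : forall f, ~ B f -> r1 f <= expR c)
  (r2_ge : forall f, ~ B f -> expR (- c) <= r2 f).
Variable u : borel V -> R.
Hypotheses (mu_ : measurable_fun setT u) (u_ge0 : forall f, 0 <= u f).

Let mtr (h : V) : measurable_fun setT ((fun f => f + h) : borel V -> borel V).
Proof.
by apply: measurable_continuous => f; apply: cvgD; [exact: cvg_id|exact: cvg_cst].
Qed.

Let law h := image_measure pi (mtr h).

Let integral_shift h (k : borel V -> \bar R) : measurable_fun setT k ->
  (forall f, 0 <= k f)%E -> (\int[law h]_f k f = \int[pi]_f k ((f : V) + h)%R)%E.
Proof.
move=> mk k0; apply/esym/(integral_law (nu := law h) (mtr h)) => //.
Qed.

Let integral_noshift h (k : borel V -> \bar R) : h = 0 -> measurable_fun setT k ->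
  (forall f, 0 <= k f)%E -> (\int[law h]_f k f = \int[pi]_f k f)%E.
Proof.
move=> h0 mk k0; rewrite integral_shift//; apply: eq_integral => f _.
by congr k; rewrite h0; exact: (addr0 (f : V)).
Qed.

Let mC : measurable (~` B). Proof. exact: measurableC. Qed.

Let ind (f : borel V) : R := \1_(~` B) f.

Let mind : measurable_fun setT ind.
Proof. exact: measurable_indic. Qed.

Let restr (k : borel V -> R) : (\int[pi]_(f in ~` B) (k f)%:E = \int[pi]_f (ind f * k f)%:E)%E.
Proof.
rewrite integral_mkcond; apply: eq_integral => f _; rewrite patchE /ind indicE.
by case: ifP; rewrite ?mul1r ?mul0r.
Qed.

Lemma prior_translation_upper :
  (\int[pi]_(f in ~` B) (u ((f : V) + t *: g)%R)%:E <= (expR c)%:E * \int[pi]_f (u f)%:E)%E.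
Proof.
have mut : measurable_fun setT ((fun f : V => u (f + t *: g)) : borel V -> R) by exact: (measurableT_comp mu_ (mtr (t *: g))).
rewrite restr.
have := integral_density (mu := law (- t *: g)) (nu := law ((- t + t) *: g)) r1E.
have mk : measurable_fun setT ((fun f : V => (ind f * u (f + t *: g))%:E) : borel V -> \bar R).
  by apply/measurable_EFinP; exact: measurable_funM.
have k0 (f : V) : (0 <= (ind f * u (f + t *: g))%:E)%E by rewrite lee_fin mulr_ge0// /ind indicE.
move/(_ _ mk k0); rewrite integral_noshift ?addNr ?scale0r// => ->.
have mr1 := density_measurable r1E.
apply: (@le_trans _ _ (\int[law (- t *: g)]_f ((expR c * u ((f : V) + t *: g))%R%:E))%E).
  apply: ge0_le_integral => //.
  - by move=> f _; rewrite mule_ge0// lee_fin; exact: density_ge0 r1E f.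
  - by apply: emeasurable_funM => //; exact/measurable_EFinP.
  - by apply/measurable_EFinP; exact: measurable_funM.
  move=> f _; rewrite -EFinM lee_fin /ind indicE.
  have [Bf|nBf] := pselect ((~` B) f); last by rewrite memNset// !mul0r mulr_ge0// expR_ge0.
  rewrite mem_set// mul1r mulrC; apply: ler_wpM2r => //; exact: r1_le.
rewrite integral_shift//; last 2 first.
- by apply/measurable_EFinP; exact: measurable_funM.
- by move=> f; rewrite lee_fin mulr_ge0// expR_ge0.
have E (f : V) : f + - t *: g + t *: g = f by rewrite scaleNr subrK.
under eq_integral do rewrite E EFinM.
rewrite ge0_integralZl//.
- exact/measurable_EFinP.
- by move=> f _; rewrite lee_fin.
Qed.

Lemma prior_translation_lower :
  ((expR (- c))%:E * \int[pi]_(f in ~` B) (u f)%:E <= \int[pi]_f (u ((f : V) + t *: g)%R)%:E)%E.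
Proof.
have muE : measurable_fun setT (fun f => (u f)%:E) by exact/measurable_EFinP.
have u0E f : (0 <= (u f)%:E)%E by rewrite lee_fin.
have := integral_density (mu := law (0 *: g)) (nu := law ((0 + t) *: g)) r2E muE u0E.
have mr2 := density_measurable r2E; have r20 := density_ge0 r2E.
rewrite integral_shift// add0r => ->.
rewrite integral_noshift ?scale0r//; last 2 first.
- by apply: emeasurable_funM => //; exact/measurable_EFinP.
- by move=> f; rewrite mule_ge0// lee_fin.
rewrite restr -ge0_integralZl//; last 2 first.
- by apply/measurable_EFinP; exact: measurable_funM.
- by move=> f _; rewrite lee_fin mulr_ge0// /ind indicE.
apply: ge0_le_integral => //.
- by move=> f _; rewrite -EFinM lee_fin !mulr_ge0// ?expR_ge0// /ind indicE.
- by apply: measurable_funeM; apply/measurable_EFinP; exact: measurable_funM.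
- by apply: emeasurable_funM => //; exact/measurable_EFinP.
move=> f _; rewrite -!EFinM lee_fin /ind indicE.
have [Bf|nBf] := pselect ((~` B) f); last by rewrite memNset// mul0r mulr0 mulr_ge0.
rewrite mem_set// mul1r mulrC; apply: ler_wpM2l => //; exact: r2_ge.
Qed.

End prior_translation.
Lemma decreases_to0_ge0 {R : realType} (u : nat -> R) n : decreases_to0 u -> 0 <= u n.
Proof.
move=> [du u0]; have cu : cvgn u by apply/cvg_ex; exists 0.
by have := nonincreasing_cvgn_ge du cu n; rewrite (cvg_lim _ u0).
Qed.

(** * Means of integrals *)

Lemma ge0_integral_setU_le {R : realType} {d : measure_display} {T : measurableType d}
    (mu : {measure set T -> \bar R}) (X Y : set T) (f : T -> \bar R) :
  measurable X -> measurable Y -> measurable_fun setT f -> (forall x, 0 <= f x)%E ->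
  (\int[mu]_(x in X `|` Y) f x <= \int[mu]_(x in X) f x + \int[mu]_(x in Y) f x)%E.
Proof.
move=> mX mY mf f0; rewrite -(setDUK (@subsetUl _ X Y)) ge0_integral_setU//.
- apply: leeD2l; apply: ge0_subset_integral => //.
  + by apply: measurableD => //; exact: measurableU.
  + exact: measurable_funTS.
  + by move=> x [[]].
- by apply: measurableD => //; exact: measurableU.
- exact: measurable_funTS.
- exact/disj_setPRL.
Qed.

Lemma vanishingI {R : realType} {d : measure_display} {Omega : measurableType d}
    (P : probability Omega R) (Q1 Q2 : nat -> Omega -> Prop) :
  vanishing P (fun n => [set w | ~ Q1 n w]) -> vanishing P (fun n => [set w | ~ Q2 n w]) ->
  vanishing P (fun n => [set w | ~ (Q1 n w /\ Q2 n w)]).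
Proof.
move=> v1 v2; apply: vanishing_sub (vanishingU v1 v2); apply: nearW => n w /=.
by move=> /not_andP.
Qed.

Section mean_of_integral.
Context {R : realType} {d d' : measure_display} {T : measurableType d'} {Omega : measurableType d}
  (P : probability Omega R) (m : {sigma_finite_measure set T -> \bar R})
  (h : T * Omega -> R) (E : set T).
Hypotheses (mh : measurable_fun setT h) (h_ge0 : forall z, 0 <= h z) (mE : measurable E).

Let g (z : T * Omega) : \bar R := (\1_E z.1 * h z)%:E.

Let mg : measurable_fun setT g.
Proof.
apply/measurable_EFinP; apply: measurable_funM => //.
exact: (measurableT_comp (measurable_indic _) measurable_fst).
Qed.

Let g_ge0 z : (0 <= g z)%E. Proof. by rewrite lee_fin mulr_ge0. Qed.

Let gE w : (\int[m]_(x in E) (h (x, w))%:E = \int[m]_x g (x, w))%E.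
Proof.
rewrite integral_mkcond; apply: eq_integral => x _.
by rewrite patchE /g indicE; case: ifP; rewrite ?mul1r ?mul0r.
Qed.

Lemma measurable_section_integral :
  measurable_fun setT (fun w => (\int[m]_(x in E) (h (x, w))%:E)%E).
Proof.
under eq_fun do rewrite gE.
exact: (measurable_fun_fubini_tonelli_G (m1 := m) _ mg g_ge0).
Qed.

Lemma mean_integral_le (c : R) : 0 <= c ->
  (forall x, E x -> \int[P]_w (h (x, w))%:E <= c%:E)%E ->
  (\int[P]_w \int[m]_(x in E) (h (x, w))%:E <= c%:E * m E)%E.
Proof.
move=> c0 hc; under eq_integral do rewrite gE.
rewrite -(fubini_tonelli (m1 := m) (m2 := P) _ mg g_ge0)/=.
rewrite -integral_cst// [leRHS]integral_mkcond.
apply: ge0_le_integral => //.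
- by move=> x _; apply: integral_ge0 => w _; exact: g_ge0.
- exact: (measurable_fun_fubini_tonelli_F (m2 := P) _ mg g_ge0).
- by apply/(measurable_restrictT _ _).1.
move=> x _; rewrite /fubini_F patchE.
case: ifPn => [xE|/negbTE xE].
  apply: le_trans (hc x (set_mem xE)); rewrite le_eqVlt; apply/orP; left; apply/eqP.
  by apply: eq_integral => w _; rewrite /g indicE xE mul1r.
by rewrite integral0_eq// => w _; rewrite /g indicE xE mul0r.
Qed.

End mean_of_integral.

Lemma noise_abs_mean {R : realType} {V : hilbertType R} {d : measure_display}
    {Omega : measurableType d} (P : probability Omega R) (W : V -> Omega -> R)
    (isoW : iso_gaussian P W) (h : V) (b : R) : 0 < b -> `|h| <= b ->
  (\int[P]_w (`|W h w|)%:E <= b%:E)%E.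
Proof.
move=> b0 hb; have mW := measurable_noise isoW h.
have mW2 : measurable_fun setT (fun w => (W h w ^+ 2)%:E).
  by apply/measurable_EFinP; exact: measurable_funX.
have b2 : 0 <= (2 * b)^-1 by rewrite invr_ge0 mulr_ge0// ltW.
apply: (@le_trans _ _ (\int[P]_w ((2 * b)^-1%:E * (W h w ^+ 2)%:E + (b / 2)%:E))%E).
  apply: ge0_le_integral => //.
  - by apply/measurable_EFinP; exact: measurableT_comp.
  - by apply: emeasurable_funD => //; exact: measurable_funeM.
  move=> w _; rewrite -EFinM -EFinD lee_fin -[W h w ^+ 2]real_normK ?num_real//.
  move: `|W h w| => z; rewrite -subr_ge0.
  have -> : (2 * b)^-1 * z ^+ 2 + b / 2 - z = (2 * b)^-1 * (z - b) ^+ 2 by field; rewrite gt_eqF.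
  by rewrite mulr_ge0 ?sqr_ge0.
rewrite ge0_integralD//; last 3 first.
- by move=> w _; rewrite -EFinM lee_fin mulr_ge0 ?sqr_ge0.
- exact: measurable_funeM.
- by move=> w _; rewrite lee_fin divr_ge0// ltW.
rewrite ge0_integralZl//; last by move=> w _; rewrite lee_fin sqr_ge0.
have -> : (\int[P]_w (b / 2)%:E = (b / 2)%:E)%E.
  by rewrite -[RHS]mule1 -(probability_setT P); exact: integral_cst.
rewrite (noise_sqr isoW) -EFinM -EFinD lee_fin.
have : (2 * b)^-1 * `|h| ^+ 2 <= (2 * b)^-1 * b ^+ 2.
  by rewrite ler_wpM2l// lerXn2r ?nnegrE// ltW.
have -> : (2 * b)^-1 * b ^+ 2 = b / 2 by field; rewrite gt_eqF.
lra.
Qed.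

Lemma tv_dist_ge0 {R : realType} (p q : set (measurableTypeR R) -> R) : 0 <= tv_dist p q.
Proof.
rewrite /tv_dist mulr_ge0//; set X := [set _ | _ in _].
have [hs|hs] := pselect (has_sup X); last by rewrite sup_out.
apply: le_trans (ub_le_sup hs.2 (x := `|p set0 - q set0|) _); first exact: normr_ge0.
by exists set0.
Qed.

(** Naming the product fixes its structure of a probability measure. *)
Definition prior_product {R : realType} {d1 d2 : measure_display}
    {T1 : measurableType d1} {T2 : measurableType d2}
    (P1 : probability T1 R) (P2 : probability T2 R) : probability (T1 * T2)%type R :=
  (P1 \x P2)%E.

(** * The posterior distribution under contraction *)

Section posterior_asymptotics.
Context {R : realType} {H1 H2 : hilbertType R} (sepH1 : separable H1) (sepH2 : separable H2)
  (Theta : set (measurableTypeR R)) (cptTheta : compact (Theta : set R))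
  (K : R -> {linear H1 -> H2})
  (contK : forall theta, Theta theta -> continuous (K theta))
  (H : set (borel H1)) (normH : H1 -> R) (subH : normed_subspace (H : set H1) normH)
  (Kdot : R -> H1 -> H2)
  (S : set H2) (normS : H2 -> R) (subS : normed_subspace S normS)
  (entropyS : (entropy_integral [set h | (S h /\ normS h <= 1)%R] < +oo)%E)
  (Cs D1 D2 D3 : R) (Cs_ge0 : 0 <= Cs) (D1_ge0 : 0 <= D1) (D2_ge0 : 0 <= D2)
  (D3_ge0 : 0 <= D3)
  (strongS : forall h, S h -> `|h| <= Cs * normS h)
  (K_le : forall theta (f : H1), Theta theta -> H f -> `|K theta f| <= D1 * `|f|)
  (Kdot_le : forall theta (f : H1), Theta theta -> H f -> `|Kdot theta f| <= D1 * `|f|)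
  (K_lip : forall theta theta1 (f : H1), Theta theta -> Theta theta1 -> H f ->
    let v := K theta f - K theta1 f in
    S v /\ normS v <= D2 * `|theta - theta1| * normH f)
  (K_taylorS : forall theta theta1 (f : H1), Theta theta -> Theta theta1 -> H f ->
    let v := K theta f - K theta1 f - (theta - theta1) *: Kdot theta1 f in
    S v /\ normS v <= D3 * `|theta - theta1| ^+ 2 * normH f)
  (mH : measurable (H : set (borel H1))) (mnormH : measurable_fun H (normH : borel H1 -> R))
  (pi_theta : probability (measurableTypeR R) R) (p : R -> R) (mp : measurable_fun Theta p)
  (p_gt0 : forall theta, Theta theta -> 0 < p theta)
  (pi_thetaE : forall B : set (measurableTypeR R), measurable B ->
    pi_theta B = (\int[lebesgue_measure]_(x in B `&` Theta) (p x)%:E)%E)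
  (pi_f : probability (borel H1) R) (pi_fH : pi_f H = 1%E)
  (d : measure_display) (Omega : measurableType d) (P : probability Omega R)
  (W : H2 -> Omega -> R) (isoW : iso_gaussian P W)
  (theta0 : R) (f0 : H1) (theta0_int : interior (Theta : set R) theta0) (Hf0 : H f0)
  (p_cont : {for theta0, continuous p}).

Local Notation Pi := (prior_product pi_theta pi_f).
Local Notation Kt := (total_K Theta H K).
Local Notation v0 := (K theta0 f0).
Local Notation mass n w B := (\int[Pi]_(z in B) (lratio W n v0 (Kt z) w)%:E)%E.
Local Notation post n w B := (posterior K Theta H pi_theta pi_f n (observation W v0 n w) B).

Let mTheta : measurable Theta. Proof. exact: measurable_parameters. Qed.

Let Theta0 : Theta theta0. Proof. exact: interior_subset theta0_int. Qed.

Let pi_Theta : pi_theta Theta = 1%E. Proof. exact: (prior_parameters cptTheta pi_thetaE). Qed.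

Let N (f : borel H1) : R := Cs * D2 * normH f.

Let mN : measurable_fun H N.
Proof. exact: measurable_funM. Qed.

Let lipK theta theta1 (f : H1) : Theta theta -> Theta theta1 -> H f ->
  `|K theta f - K theta1 f| <= `|theta - theta1| * N f.
Proof.
move=> Tt Tt1 Hf; have [Sv vS] := K_lip Tt Tt1 Hf.
apply: le_trans (strongS Sv) _; apply: le_trans (ler_wpM2l Cs_ge0 vS) _.
by rewrite /N le_eqVlt; apply/orP; left; apply/eqP; ring.
Qed.

Let mKt : measurable_fun setT (Kt : _ -> borel H2).
Proof. exact: (measurable_total_K sepH2 mTheta mH mN contK lipK). Qed.

Let mK0 : measurable_fun setT (K theta0 : borel H1 -> borel H2).
Proof. by apply: measurable_continuous; exact: contK. Qed.

Let mTH : measurable (Theta `*` H). Proof. exact: measurableX. Qed.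

Let ml n w : measurable_fun setT (fun z => (lratio W n v0 (Kt z) w)%:E).
Proof. by apply/measurable_EFinP; exact: (measurable_lratio1 isoW n v0 mKt w). Qed.

Let l_ge0 n w z : (0 <= (lratio W n v0 (Kt z) w)%:E)%E.
Proof. by rewrite lee_fin lratio_ge0. Qed.

Lemma mean_mass n B : measurable B -> (\int[P]_w mass n w B = Pi B)%E.
Proof. exact: (integral_integral_lratio isoW n v0 Pi mKt). Qed.

Lemma measurable_mass n B : measurable B -> measurable_fun setT (fun w => mass n w B).
Proof. exact: (measurable_integral_lratio isoW n v0 Pi mKt). Qed.

Lemma mass_ge0 n w B : (0 <= mass n w B)%E.
Proof. by apply: integral_ge0 => z _; exact: l_ge0. Qed.

Lemma vanishing_infinite : vanishing P (fun n => [set w | mass n w setT = +oo%E]).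
Proof.
apply: (@vanishing_sub _ _ _ _ _ (fun n => [set w | (n.+1%:R%:E <= mass n w setT)%E])).
  by apply: nearW => n w /= ->; rewrite leey.
apply: vanishing_markov.
- by move=> n; exact: measurable_mass.
- by move=> n w; exact: mass_ge0.
- by apply: nearW => n; rewrite ltr0n.
move=> k k0; have [m _ mk] := near_infty_natSinv_lt (PosNum k0).
exists m => // n /mk /= /ltW nk; rewrite mean_mass// probability_setT lee_fin.
by rewrite -ler_pdivrMr ?ltr0n// mul1r.
Qed.

(** * The rate of contraction *)

Context (eps : nat -> R) (eps0 : decreases_to0 eps)
  (contract_eps : cvg_in_prob0 P (fun n w => 1 - post n w
    [set q | `|q.1 - theta0| + `|K theta0 (q.2 - f0)| < eps n]))
  (prior_mass : forall n, (0 < n)%N ->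
    ((expR (- (n%:R * eps n ^+ 2 / 64)))%R%:E <=
     Pi [set q : measurableTypeR R * borel H1 |
         [/\ Theta q.1, H q.2 & (`|K q.1 q.2 - K theta0 f0| <= eps n)%R]])%E).

Let massC n w B : measurable B -> (mass n w B + mass n w (~` B) = mass n w setT)%E.
Proof.
move=> mB; exact (mass_setC sepH2 mTheta mH mN contK lipK pi_theta pi_f isoW v0 n w mB).
Qed.

Let missing n w B e : (0 < n)%N -> (0 < mass n w setT)%E -> (mass n w setT < +oo)%E ->
  measurable (B `&` (Theta `*` H)) -> 1 - post n w B <= e ->
  (mass n w (~` (B `&` (Theta `*` H))) <= e%:E * mass n w setT)%E.
Proof.
move=> n0 D0 Doo.
exact: (posterior_missing sepH2 mTheta mH mN contK lipK pi_Theta pi_fH isoW n0 D0 Doo).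
Qed.

Let eps_ge0 n : 0 <= eps n. Proof. exact: decreases_to0_ge0. Qed.

(** It suffices to integrate over the neighbourhood whose prior mass is assumed. *)
Lemma mass_lower n c : (0 < n)%N -> 0 < c ->
  (P [set w | mass n w setT < (c * expR (- (n%:R * eps n ^+ 2 / 64)))%R%:E] <=
   (c * expR (n%:R * eps n ^+ 2))%:E)%E.
Proof.
move=> n0 c0; pose E := [set q : measurableTypeR R * borel H1 |
         [/\ Theta q.1, H q.2 & (`|K q.1 q.2 - K theta0 f0| <= eps n)%R]].
have EE : E = (Theta `*` H) `&` [set q | `|Kt q - v0| <= eps n].
  apply/seteqP; split => -[x f] /=.
    by move=> [Tx Hf]; rewrite /= total_KE.
  by move=> [[/= Tx Hf]]; rewrite /= total_KE.
have mE : measurable E.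
  rewrite EE; apply: measurableI => //; apply: measurable_setT_ler => //.
  exact: measurableT_comp (measurable_borel_norm v0) mKt.
have Eeps q : E q -> `|Kt q - v0| <= eps n by rewrite EE => -[].
have := prior_mass n0; rewrite -/E => qE.
have Efin : Pi E \is a fin_num.
  by rewrite ge0_fin_numE// (le_lt_trans (probability_le1 _ mE))// ltry.
have q0 : 0 < fine (Pi E) by rewrite -lte_fin fineK//; apply: lt_le_trans qE; rewrite lte_fin expR_gt0.
have := integrated_lratio_lower isoW n (m := Pi) mKt mE Eeps c0 q0 (esym (fineK Efin)).
apply: le_trans; apply: le_measure.
- rewrite inE -[X in measurable X]setTI; apply: emeasurable_fun_infty_o => //.
  exact: measurable_mass.
- rewrite inE -[X in measurable X]setTI; apply: emeasurable_fun_infty_o => //.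
  exact: measurable_mass.
move=> w /= lt; apply: le_lt_trans (lt_le_trans lt _).
  by apply: ge0_subset_integral => //; exact: ml.
by rewrite lee_fin ler_wpM2l ?(ltW c0)// -lee_fin fineK.
Qed.

Let mK0_dist : measurable_fun setT ((fun f => `|K theta0 (f - f0)|) : borel H1 -> R).
Proof.
have := measurableT_comp (measurable_borel_norm v0) mK0.
by congr (measurable_fun _ _); apply/funext => f /=; rewrite linearB.
Qed.

Let near0 n : set (measurableTypeR R * borel H1) :=
  [set x : measurableTypeR R | `|(x : R) - theta0| < eps n] `*` setT.

Let mnear0 n : measurable (near0 n).
Proof. by apply: measurableX => //; exact: measurable_near. Qed.

Let A1 n : set (measurableTypeR R * borel H1) :=
  [set q | `|q.1 - theta0| + `|K theta0 (q.2 - f0)| < eps n].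

Let mA1 n : measurable (A1 n).
Proof.
rewrite -[X in measurable X]setTI; apply: measurable_set_ltr => //.
apply: measurable_funD.
  apply: measurableT_comp => //; apply: measurable_funB => //.
exact: measurableT_comp mK0_dist measurable_snd.
Qed.

Let A1_near n q : A1 n q -> near0 n q.
Proof. by rewrite /A1 /near0 /= => h; split => //=; apply: le_lt_trans h; rewrite lerDl. Qed.

(** Contraction is not possible at the parametric rate or faster: if [n eps^2]
    stayed bounded, then with probability away from zero the integrated likelihood
    would not be small, while the part over the shrinking neighbourhood, whose mean
    is its prior mass, tends to zero. *)
Lemma rate_diverges (C : R) : \forall n \near \oo, C <= n%:R * eps n ^+ 2.
Proof.
(* Half of the lower bound for the denominator when the rate is below [C]. *)
pose b := expR (- C) / 8 * expR (- (C / 64)) / 2.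
have b0 : 0 < b by rewrite !mulr_gt0 ?expR_gt0.
have [r [r0 pr]] := prior_near cptTheta mp p_gt0 pi_thetaE theta0_int p_cont.
have p0 : 0 < p theta0 by exact: p_gt0.
pose bad1 n := [set w | 2^-1 < `|1 - post n w (A1 n)|].
pose bad2 n := [set w | (b%:E <= mass n w (near0 n))%E].
pose bad3 n := [set w | n%:R * eps n ^+ 2 < C /\
  (mass n w setT < (expR (- C) / 8 * expR (- (n%:R * eps n ^+ 2 / 64)))%R%:E)%E].
pose bad4 n := [set w | mass n w setT = +oo%E].
have e8 : 0 < 8^-1 :> R by rewrite invr_gt0.
have r1 : rare P (8^-1) bad1 by apply: vanishing_cvg.
have r2 : rare P (8^-1) bad2.
  suff : vanishing P bad2 by apply.
  apply: vanishing_markov.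
  - by move=> n; exact: measurable_mass.
  - by move=> n w; exact: mass_ge0.
  - exact: nearW.
  move=> k k0; have kb : 0 < k * b / (4 * p theta0) by apply: divr_gt0; exact: mulr_gt0.
  have [_ /cvgr0Pnorm_lt e0] := eps0.
  apply: filterS2 (e0 _ kb) (e0 _ r0) => n; rewrite !(ger0_norm (eps_ge0 n)) => e1 e2.
  rewrite mean_mass//.
  have -> : Pi (near0 n) = pi_theta [set x : measurableTypeR R | `|(x : R) - theta0| < eps n].
    have e : (pi_theta [set x : measurableTypeR R | (`|(x : R) - theta0| < eps n)%R] * pi_f setT =
       pi_theta [set x : measurableTypeR R | (`|(x : R) - theta0| < eps n)%R])%E.
      by rewrite probability_setT mule1.
    rewrite -[RHS]e; apply: product_measure1E => //; exact: measurable_near.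
  apply: le_trans (pr _ (eps_ge0 n) (ltW e2)) _; rewrite lee_fin.
  by move: e1; rewrite ltr_pdivlMr ?mulr_gt0//; lra.
have r3 : rare P (8^-1) bad3.
  exists 1%N => // n n1; have n0 : (0 < n)%N := n1.
  have [nC|nC] := ltP (n%:R * eps n ^+ 2) C; last first.
    have -> : bad3 n = set0 by apply/seteqP; split => w //= []; rewrite ltNge nC.
    by rewrite outer_measure0 lee_fin.
  have c0 : 0 < expR (- C) / 8 :> R by rewrite divr_gt0// expR_gt0.
  have := mass_lower n0 c0.
  have -> : bad3 n = [set w | (mass n w setT < (expR (- C) / 8 * expR (- (n%:R * eps n ^+ 2 / 64)))%R%:E)%E].
    by apply/seteqP; split => w [].
  rewrite measurable_mu_extE; last first.
    rewrite -[X in measurable X]setTI; apply: emeasurable_fun_infty_o => //.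
    exact: measurable_mass.
  move=> /le_trans; apply; rewrite lee_fin mulrAC -expRD ler_pdivrMr// mulVf// -[leRHS]expR0 ler_expR.
  by move: (ltW nC); lra.
have r4 : rare P (8^-1) bad4 by apply: vanishing_infinite.
have := rareU (rareU r1 r2) (rareU r3 r4); apply: filterS2 (nbhs_infty_ge 1) => n n1 le1.
have n0 : (0 < n)%N by [].
rewrite leNgt; apply/negP => nC; move: le1; apply/negP; rewrite -ltNge.
rewrite (_ : _ `|` _ = setT).
  have e : mu_ext P setT = 1%E by rewrite -(probability_setT P); exact: measurable_mu_extE.
  by apply: (@lt_le_trans _ _ 1%E); [rewrite lte_fin; lra | rewrite -e].
apply/seteqP; split => // w _; apply/not_notP => /not_orP[/not_orP[w1 w2] /not_orP[w3 w4]].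
have {w1} w1 : `|1 - post n w (A1 n)| <= 2^-1 by rewrite leNgt; apply/negP.
have {w2} w2 : (mass n w (near0 n) < b%:E)%E by rewrite ltNge; apply/negP.
have {w3} w3 : ((b + b)%:E <= mass n w setT)%E.
  rewrite leNgt; apply/negP => lt; apply: w3; split => //; apply: lt_le_trans lt _.
  rewrite lee_fin /b -splitr ler_wpM2l ?divr_ge0 ?expR_ge0// ler_expR.
  by rewrite lerN2 ler_pM2r//; exact: ltW.
have w4' : (mass n w setT < +oo)%E by rewrite ltey; apply/eqP.
have D0 : (0 < mass n w setT)%E by apply: lt_le_trans w3; rewrite lte_fin addr_gt0.
have mA := measurableI _ _ (mA1 n) mTH.
have := missing n0 D0 w4' mA (le_trans (ler_norm _) w1).
have := massC n w mA.
have : (mass n w (A1 n `&` (Theta `*` H)) <= mass n w (near0 n))%E.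
  apply: ge0_subset_integral => //; first exact: measurable_funTS.
  by move=> z [/A1_near].
have := mass_ge0 n w (A1 n `&` (Theta `*` H)).
have := mass_ge0 n w (~` (A1 n `&` (Theta `*` H))).
have := mass_ge0 n w (near0 n).
move: w2 w3 w4' D0.
case: (mass n w setT) => [D| |]//; case: (mass n w (near0 n)) => [a| |]//.
case: (mass n w (A1 n `&` _)) => [x| |]//; case: (mass n w _) => [y| |]//.
by rewrite -EFinD -EFinM !lee_fin !lte_fin => ? ? _ _ _ ? ? ? [] ?; lra.
Qed.

(** * Localization *)

Context (r : R) (r_gt0 : 0 < r) (rTheta : forall theta, `|theta - theta0| < r -> Theta theta)
  (gamma : H1)
  (orth : forall h : H1, H h -> dotp (efficient_direction K Kdot theta0 f0 gamma) (K theta0 h) = 0)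
  (xi : nat -> R) (xi0 : decreases_to0 xi) (eps_xi : forall n, eps n <= xi n)
  (M : R) (M_gt0 : 0 < M) (Gb : R)
  (gamman : nat -> H1) (Hgamman : forall n, H (gamman n)) (gamman_le : forall n, `|gamman n| <= Gb).

Local Notation v := (efficient_direction K Kdot theta0 f0 gamma).
Local Notation kb n := (`|K theta0 (gamman n - gamma)|).
Local Notation CS := (entropy_scale normH D2 D3 f0 M).
Local Notation Cu := (shift_const normH Cs D1 D3 f0 M Gb).

Context (d1 : nat -> R)
  (cross : forall n,
    Num.sqrt n%:R * ((1 + D1 * Gb) * eps n) * (Cu * xi n) <= d1 n \/
    (forall (h : H1) th th1, Theta th -> Theta th1 -> `|K th h| = `|K th1 h|) /\
      (Cu * xi n) ^+ 2 / 2 + D1 * Gb * (Cu * xi n) <= d1 n).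

Local Notation err n := (expansion_error K normH Kdot Cs D1 D3 theta0 f0 gamma M Gb
  (eps n) (xi n) n%:R (kb n) (d1 n)).

(** The functions on which the posterior concentrates. *)
Definition local_functions n : set (borel H1) := [set f : H1 |
  [/\ H f, `|K theta0 (f - f0)| < eps n, `|Kdot theta0 (f - f0)| < xi n & normH f < M]].
Local Notation A := local_functions.

Definition shift n (x : R) (f : H1) : H1 := f + (x - theta0) *: gamman n.

(** Their translates along the approximate least favourable direction; rational
    translations keep the union countable. *)
Definition shifted_functions n : set (borel H1) :=
  \bigcup_(q in [set q : rat | `|ratr q| < eps n]) [set f : H1 | A n (f - ratr q *: gamman n)].
Local Notation As := shifted_functions.

Let taylor theta theta1 (f : H1) : Theta theta -> Theta theta1 -> H f ->
  `|K theta f - K theta1 f - (theta - theta1) *: Kdot theta1 f|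
    <= Cs * D3 * `|theta - theta1| ^+ 2 * normH f.
Proof.
move=> Tt Tt1 Hf; have [Sv vS] := K_taylorS Tt Tt1 Hf.
apply: le_trans (strongS Sv) _.
by rewrite -(mulrA Cs) -(mulrA Cs) ler_wpM2l.
Qed.

Let c3_ge0 : 0 <= Cs * D3. Proof. exact: mulr_ge0. Qed.

Let Kdot_linear0 a (f g : H1) : H f -> H g ->
  Kdot theta0 (f + a *: g) = Kdot theta0 f + a *: Kdot theta0 g.
Proof. exact: (KdotD subH c3_ge0 taylor r_gt0 rTheta). Qed.

Let mKdot : measurable_fun H ((fun f => `|Kdot theta0 (f - f0)|) : borel H1 -> R).
Proof.
apply: (measurable_lipschitz mH D1_ge0) => /= f g Hf Hg.
have Hfg := subspaceB subH Hf Hg; have Hg0 := subspaceB subH Hg Hf0.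
have -> : f - f0 = (g - f0) + 1 *: (f - g) by rewrite scale1r; vector.
rewrite Kdot_linear0// scale1r; apply: le_trans (ler_normD _ _) _.
by rewrite lerD2l Kdot_le.
Qed.

Lemma measurable_local_functions n : measurable (A n).
Proof.
have -> : A n = (H `&` [set f : borel H1 | `|K theta0 ((f : H1) - f0)| < eps n]) `&`
    ((H `&` [set f : borel H1 | `|Kdot theta0 ((f : H1) - f0)| < xi n]) `&`
     (H `&` [set f : borel H1 | normH f < M])).
  by apply/seteqP; split => f /=; [move=> [? ? ? ?] | move=> [[? ?] [[? ?] [? ?]]]].
apply: measurableI; last apply: measurableI.
- by apply: measurable_set_ltr => //; exact: measurable_funTS.
- by apply: measurable_set_ltr.
- by apply: measurable_set_ltr.
Qed.

Let mtr (h : H1) : measurable_fun setT ((fun f => f + h) : borel H1 -> borel H1).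
Proof.
by apply: measurable_continuous => f; apply: cvgD; [exact: cvg_id|exact: cvg_cst].
Qed.

Lemma measurable_shifted_functions n : measurable (As n).
Proof.
rewrite /shifted_functions bigcup_mkcond; apply: bigcupT_measurable_rat => q.
case: ifPn => // _; have mA := measurable_local_functions n.
by have := mtr (- (ratr q *: gamman n)) measurableT mA; rewrite setTI.
Qed.

Lemma measurable_shift n : measurable_fun setT
  ((fun z => shift n z.1 z.2) : measurableTypeR R * borel H1 -> borel H1).
Proof. exact: measurable_translation. Qed.

(** The local sets are open in the direction of the translations. *)
Lemma shift_local n (x : R) (f : H1) : `|x - theta0| < eps n -> A n f -> As n (shift n x f).
Proof.
set t := x - theta0; set g := gamman n => te [Hf f1 f2 f3]; have Hg : H g := Hgamman n.
have Ng := subspace_norm_ge0 subH Hg.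
pose B := `|K theta0 g| + `|Kdot theta0 g| + normH g + 1.
have B0 : 0 < B by rewrite /B; have := normr_ge0 (K theta0 g); have := normr_ge0 (Kdot theta0 g); lra.
(* [s * (B + 1)] is the smallest distance to the four constraints. *)
pose s := Num.min (Num.min (eps n - `|K theta0 (f - f0)|) (xi n - `|Kdot theta0 (f - f0)|))
  (Num.min (M - normH f) (eps n - `|t|)) / (B + 1).
have B1 : 0 < B + 1 by lra.
have s0 : 0 < s by rewrite divr_gt0// !lt_min !subr_gt0 f1 f2 f3 te.
have sB : s * (B + 1) = Num.min (Num.min (eps n - `|K theta0 (f - f0)|) (xi n - `|Kdot theta0 (f - f0)|))
  (Num.min (M - normH f) (eps n - `|t|)) by rewrite /s divfK// gt_eqF.
have : s * (B + 1) <= s * (B + 1) by [].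
rewrite {2}sB !le_min => /andP[/andP[s1 s2] /andP[s3 s4]].
have [q qI] : exists q : rat, ratr q \in `]t - s, t + s[ by apply: rat_in_itvoo; lra.
move: qI; rewrite in_itv/= => /andP[q1 q2].
have qt : `|t - ratr q| < s by rewrite ltr_norml; apply/andP; split; lra.
exists q => /=.
  have : `|ratr q : R| <= `|t| + `|t - ratr q|.
    by rewrite -{1}(subKr t (ratr q)) ; apply: ler_normB.
  have : 0 <= s * B by apply: mulr_ge0; exact: ltW.
  move: s4; rewrite mulrDr mulr1; lra.
have e1 : shift n x f - ratr q *: g = f + (t - ratr q) *: g.
  by rewrite /shift /t /g; vector.
rewrite e1; set u := t - ratr q.
have e2 : f + u *: g - f0 = (f - f0) + u *: g by rewrite addrAC.
have us c : 0 <= c -> c <= B -> `|u| * c < s * (B + 1).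
  move=> c0 cB; apply: (@le_lt_trans _ _ (s * B)); last by rewrite ltr_pM2l//; lra.
  by apply: ler_pM => //; exact: ltW.
have Hff0 := subspaceB subH Hf Hf0.
have n1 := normr_ge0 (K theta0 g); have n2 := normr_ge0 (Kdot theta0 g).
split.
- by apply: (subspaceD subH) => //; exact: (subspaceZ subH).
- rewrite e2 linearD linearZ/=; apply: le_lt_trans (ler_normD _ _) _; rewrite normrZ.
  have : `|u| * `|K theta0 g| < s * (B + 1) by apply: us => //; rewrite /B; lra.
  lra.
- rewrite e2 Kdot_linear0//; apply: le_lt_trans (ler_normD _ _) _; rewrite normrZ.
  have : `|u| * `|Kdot theta0 g| < s * (B + 1) by apply: us => //; rewrite /B; lra.
  lra.
- apply: le_lt_trans (subspace_normD subH Hf (subspaceZ subH u Hg)) _.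
  rewrite (subspace_normZ subH u Hg).
  have : `|u| * normH g < s * (B + 1) by apply: us => //; rewrite /B; lra.
  lra.
Qed.

Local Notation llr n := (log_lratio W n v0).
Local Notation kt z := (z.1 - theta0).

Let drift n (w : Omega) (z : measurableTypeR R * borel H1) : R :=
  Num.sqrt n%:R * W v w * kt z - n%:R * `|v| ^+ 2 * kt z ^+ 2 / 2.

Let diff n (w : Omega) (z : measurableTypeR R * borel H1) : R :=
  llr n (Kt z) w - llr n (K theta0 (shift n z.1 z.2)) w - drift n w z.

Let bound n del Y (w : Omega) (z : measurableTypeR R * borel H1) : R :=
  (err n + CS * del + `|W (K theta0 (gamman n - gamma)) w|) * (1 + n%:R * kt z ^+ 2)
  + Num.sqrt n%:R * Y * `|W (Kt (z.1, gamman n) - K theta0 (gamman n)) w|.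

Let measurable_theta : measurable_fun setT
  ((fun q => kt q.1) : (measurableTypeR R * borel H1) * Omega -> R).
Proof.
apply: measurable_funB => //.
exact: measurableT_comp measurable_fst measurable_fst.
Qed.

Let measurable_noise_at (h : H2) : measurable_fun setT
  ((fun q => W h q.2) : (measurableTypeR R * borel H1) * Omega -> R).
Proof. exact: measurableT_comp (measurable_noise isoW h) measurable_snd. Qed.

Lemma measurable_shift_increment n : measurable_fun setT
  ((fun q => W (Kt (q.1, gamman n) - K theta0 (gamman n)) q.2)
    : measurableTypeR R * Omega -> R).
Proof.
have m1 : measurable_fun setT ((fun x => Kt (x, gamman n) - K theta0 (gamman n))
    : measurableTypeR R -> borel H2).
  have mB : measurable_fun setT ((fun h => h - K theta0 (gamman n)) : borel H2 -> borel H2).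
    by apply: measurable_continuous => h; apply: cvgB; [exact: cvg_id|exact: cvg_cst].
  have m0 : measurable_fun setT ((fun x => Kt (x, gamman n)) : measurableTypeR R -> borel H2).
    exact: (measurable_fun_pair1 (gamman n : borel H1) mKt).
  exact: (measurableT_comp mB m0).
have m2 : measurable_fun setT
    ((fun q => (Kt (q.1, gamman n) - K theta0 (gamman n), q.2))
    : measurableTypeR R * Omega -> borel H2 * Omega).
  apply: measurable_fun_pair; last exact: measurable_snd.
  exact: measurableT_comp m1 measurable_fst.
exact: measurableT_comp (iso_gaussian_measurable isoW) m2.
Qed.

Let measurable_diff n : measurable_fun setT (fun q : (measurableTypeR R * borel H1) * Omega => diff n q.2 q.1).
Proof.
apply: measurable_funB; first apply: measurable_funB.
- exact: (measurable_log_lratio_comp isoW n v0 mKt).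
- exact: (measurable_log_lratio_comp isoW n v0 (measurableT_comp mK0 (measurable_shift n))).
apply: measurable_funB.
- apply: measurable_funM => //; apply: measurable_funM => //; exact: measurable_noise_at.
- by apply: measurable_funM => //; apply: measurable_funM => //; exact: measurable_funX.
Qed.

Let measurable_bound n del Y : measurable_fun setT
  (fun q : (measurableTypeR R * borel H1) * Omega => bound n del Y q.2 q.1).
Proof.
apply: measurable_funD; apply: measurable_funM => //.
- apply: measurable_funD => //; apply: measurableT_comp => //; exact: measurable_noise_at.
- apply: measurable_funD => //; apply: measurable_funM => //; exact: measurable_funX.
- apply: measurableT_comp => //.
  have m3 : measurable_fun setT ((fun q => (q.1.1, q.2))
      : (measurableTypeR R * borel H1) * Omega -> measurableTypeR R * Omega).
    apply: measurable_fun_pair; last exact: measurable_snd.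
    exact: measurableT_comp measurable_fst measurable_fst.
  exact: measurableT_comp (measurable_shift_increment n) m3.
Qed.

(** The expansion for almost all parameters at once. It is used with [C] the
    product with the local functions and [Y = 0] for upper bounds, and with [C] the
    set that the shift maps to translated local functions for lower bounds. *)
Lemma expansion_ae n (C : set (measurableTypeR R * borel H1)) (Y del sig : R) (G : set Omega) :
  measurable C -> eps n <= 1 -> eps n <= r -> measurable G ->
  (forall s, S s -> normS s <= 1 -> `|s| <= sig -> P (G `&` [set w | del < `|W s w|]) = 0%E) ->
  small_const normH Cs D3 f0 M * xi n / CS <= sig -> 0 <= del -> 0 <= Y ->
  (forall z, near0 n z -> C z -> exists f' y, [/\ A n f', z.2 = f' + y *: gamman n,
     `|y + kt z| <= eps n & `|y| <= Y]) ->
  {ae P, forall w, G w -> {ae Pi, forall z, near0 n z -> C z ->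
    `|diff n w z| <= bound n del Y w z}}.
Proof.
move=> mC e1 er mG modG sigP del0 Y0 split_C.
pose Nn := [set q : (measurableTypeR R * borel H1) * Omega |
   [/\ near0 n q.1, C q.1, G q.2 & bound n del Y q.2 q.1 < `|diff n q.2 q.1| ]].
have mNn : measurable Nn.
  have -> : Nn = ((near0 n `&` C) `*` G) `&`
      [set q | bound n del Y q.2 q.1 < `|diff n q.2 q.1| ].
    by apply/seteqP; split => q /=; [case | case=> -[[]]].
  apply: measurableI; first by apply: measurableX => //; exact: measurableI.
  apply: measurable_setT_ltr; first exact: measurable_bound.
  by apply: measurableT_comp => //; exact: measurable_diff.
have null z : P (xsection Nn z) = 0%E.
  have [[zn zC]|zn] := pselect (near0 n z /\ C z); last first.
    rewrite (_ : xsection Nn z = set0) ?measure0//; apply/seteqP; split => w //.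
    by rewrite /xsection /= in_setE => -[]/= ? ?; case: zn.
  have [f' [y [[Hf' a1 a2 a3] zE yt yY]]] := split_C z zn zC.
  have zt : `|kt z| < eps n by case: zn.
  have Tz : Theta z.1 by apply: rTheta; exact: lt_le_trans er.
  have ae1 := log_lratio_expansion subH subS Cs_ge0 D1_ge0 D2_ge0 D3_ge0 strongS K_le Kdot_le
    K_lip K_taylorS r_gt0 rTheta Hf0 orth (ltW M_gt0) (Hgamman n) (gamman_le n)
    e1 er (eps_xi n) zt Hf' (ltW a1) (ltW a2) (ltW a3) yt (ler0n R n) (lexx _) (cross n)
    isoW erefl modG mG sigP.
  apply: measure_negligible; first exact: measurable_xsection.
  apply: negligibleS ae1 => w; rewrite /xsection /= in_setE => -[_ _ /= Gw lt] /(_ Gw).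
  apply/negP; rewrite -ltNge; apply: le_lt_trans (lt_le_trans lt _).
    rewrite /bound; have -> : Kt (z.1, gamman n) = K z.1 (gamman n) by rewrite total_KE.
    by rewrite lerD2l ler_wpM2r// ler_wpM2l// sqrtr_ge0.
  rewrite /diff /drift /shift zE.
  have -> // : Kt z = K z.1 (f' + y *: gamman n).
  have Hz : H (f' + y *: gamman n) by apply: (subspaceD subH) => //; exact: (subspaceZ subH).
  by move: Hz; rewrite -zE => Hz; move: Tz Hz; case: (z) => x f /=; exact: total_KE.
apply: filterS (ae_null_sections Pi mNn null) => w w0 Gw.
exists (ysection Nn w); split => //; first exact: measurable_ysection.
move=> z /= /not_implyP[zn /not_implyP[zC /negP]]; rewrite -ltNge => lt.
by rewrite /ysection /= inE.
Qed.

(** * Bounds for one observation *)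

Context (i : R) (iE : i = `|v| ^+ 2) (i_gt0 : 0 < i)
  (B : nat -> set (borel H1)) (mB : forall n, measurable (B n)) (eta : nat -> R)
  (tr_up : forall n (t : R) (u : borel H1 -> R), (0 < n)%N -> `|t| < eps n ->
    measurable_fun setT u -> (forall f, 0 <= u f) ->
    (\int[pi_f]_(f in ~` B n) (u ((f : H1) + t *: gamman n)%R)%:E
      <= (expR (eta n * (1 + n%:R * t ^+ 2)))%:E * \int[pi_f]_f (u f)%:E)%E)
  (tr_low : forall n (t : R) (u : borel H1 -> R), (0 < n)%N -> `|t| < eps n ->
    measurable_fun setT u -> (forall f, 0 <= u f) ->
    ((expR (- (eta n * (1 + n%:R * t ^+ 2))))%:E * \int[pi_f]_(f in ~` B n) (u f)%:E
      <= \int[pi_f]_f (u ((f : H1) + t *: gamman n)%R)%:E)%E).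

Local Notation l0 n w f := (lratio W n v0 (K theta0 f) w).
Local Notation Z n w := (gauss_mass (n%:R * i) (Num.sqrt n%:R * W v w)).
Local Notation mu := (@lebesgue_measure R).

Section one_observation.
Variables (n : nat) (w : Omega) (del e re C L dd : R).
Hypotheses (n_gt0 : (0 < n)%N) (e_gt0 : 0 < e) (e_le1 : e <= 1)
  (dd_le : dd <= i / 4)
  (err_le : err n + CS * del + `|W (K theta0 (gamman n - gamma)) w| + eta n <= dd)
  (prior_le : forall (F : set (measurableTypeR R)) (g : R -> R), measurable F ->
    (forall x, F x -> `|x - theta0| < re) ->
    measurable_fun setT g -> (forall x, 0 <= g x) ->
    (((1 - e) * p theta0)%:E * \int[mu]_(x in F) (g x)%:E
       <= \int[pi_theta]_(x in F) (g x)%:E)%E /\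
    (\int[pi_theta]_(x in F) (g x)%:E
       <= ((1 + e) * p theta0)%:E * \int[mu]_(x in F) (g x)%:E)%E)
  (eps_re : eps n <= re).

Local Notation q x := (gauss_exp (n%:R * i) (Num.sqrt n%:R * W v w) (x - theta0)).
Local Notation c := (err n + CS * del + `|W (K theta0 (gamman n - gamma)) w|).
Local Notation win := ([set x | `|x - theta0| < eps n] : set (measurableTypeR R)).

Let n0 : 0 < n%:R :> R. Proof. by rewrite ltr0n. Qed.
Let p0 : 0 < p theta0. Proof. exact: p_gt0. Qed.

Let mq (a b : R) : measurable_fun setT (fun x : R => gauss_exp a b (x - theta0)).
Proof. exact: measurable_gauss_exp. Qed.

Let ml0 : measurable_fun setT (fun f : borel H1 => l0 n w f).
Proof. exact: (measurable_lratio1 isoW n v0 mK0 w). Qed.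

Let ml1 : measurable_fun setT (fun z => lratio W n v0 (Kt z) w).
Proof. exact: (measurable_lratio1 isoW n v0 mKt w). Qed.

Let mexp (a : R) : measurable_fun setT
  ((fun x => expR (a * (1 + n%:R * (x - theta0) ^+ 2))) : measurableTypeR R -> R).
Proof.
apply: measurableT_comp => //; apply: measurable_funM => //; apply: measurable_funD => //.
by apply: measurable_funM => //; apply: measurable_funX; exact: measurable_funB.
Qed.

Let driftE z : drift n w z = Num.sqrt n%:R * W v w * kt z - n%:R * i * kt z ^+ 2 / 2.
Proof. by rewrite /drift iE. Qed.

(** Substituting the expansion and translating the prior separates the integrals:
    a Gaussian integral over the parameter and an integral over the functions at
    the true parameter. *)
Lemma upper_mass :
  {ae Pi, forall z, near0 n z -> (setT `*` A n) z -> `|diff n w z| <= bound n del 0 w z} ->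
  (mass n w (win `*` (A n `\` B n)) <=
   ((1 + e) * p theta0 * (expR dd * gauss_mass (n%:R * (i - 2 * dd)) (Num.sqrt n%:R * W v w)))%:E
     * \int[pi_f]_(f in As n) (l0 n w f)%:E)%E.
Proof.
move=> aeb.
have mW : measurable win by exact: measurable_near.
have := likelihood_upper (m1 := pi_theta) (m2 := pi_f)
  (L := fun z => lratio W n v0 (Kt z) w) (L0 := fun f : borel H1 => l0 n w f)
  (sh := fun x f => shift n x f)
  (phi := fun x => q x * expR (c * (1 + n%:R * (x - theta0) ^+ 2)))
  (psi := fun x => expR (eta n * (1 + n%:R * (x - theta0) ^+ 2)))
  (U := win) (A' := As n) (B := B n) ml1 (fun z => lratio_ge0 _ _ _ _ _) ml0
  (fun f => lratio_ge0 _ _ _ _ _) (measurable_shift n).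
move/(_ (measurable_funM (mq _ _) (mexp _))).
move/(_ (fun x => mulr_ge0 (expR_ge0 _) (expR_ge0 _)) (mexp _) (fun x => expR_gt0 _) mW).
move/(_ (measurable_shifted_functions n) (mB n) _ (measurable_local_functions n)).
move/(_ (fun x f => @shift_local n x f)).
move/(_ _ _)/le_trans; apply.
- apply: filterS aeb => z h zw zA; have /h/(_ (conj I zA)) : near0 n z by split.
  rewrite /diff /bound driftE mulr0 mul0r addr0 => /(le_trans (ler_norm _)) h1.
  rewrite /gauss_exp /lratio -!expRD ler_expR; lra.
- by move=> x u xw mu_ u0; exact: tr_up.
apply: lee_wpmul2r; first by apply: integral_ge0 => f _; rewrite lee_fin lratio_ge0.
pose g x := expR dd * gauss_exp (n%:R * (i - 2 * dd)) (Num.sqrt n%:R * W v w) (x - theta0).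
have mg : measurable_fun setT (g : measurableTypeR R -> R).
  by apply: measurable_funM => //; exact: mq.
have g0 x : 0 <= g x by rewrite mulr_ge0// expR_ge0.
have mgE : measurable_fun setT (fun x : measurableTypeR R => (g x)%:E) by exact/measurable_EFinP.
have win_re x : win x -> `|x - theta0| < re by move=> /lt_le_trans; apply.
apply: (@le_trans _ _ (\int[pi_theta]_(x in win) (g x)%:E)%E).
  apply: ge0_le_integral => //.
  - by move=> x _; rewrite lee_fin !mulr_ge0// expR_ge0.
  - apply/measurable_EFinP; apply: measurable_funTS.
    exact: (measurable_funM (measurable_funM (mq _ _) (mexp _)) (mexp _)).
  - exact: measurable_funTS.
  move=> x _; rewrite lee_fin /g /gauss_exp -!expRD ler_expR.
  have t0 : 0 <= n%:R * (x - theta0) ^+ 2 by rewrite mulr_ge0// sqr_ge0.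
  have : (c + eta n) * (1 + n%:R * (x - theta0) ^+ 2) <= dd * (1 + n%:R * (x - theta0) ^+ 2).
    by rewrite ler_wpM2r// addr_ge0.
  lra.
apply: le_trans (prior_le mW win_re mg g0).2 _.
rewrite [leRHS]EFinM; apply: lee_wpmul2l.
  by rewrite lee_fin mulr_ge0 ?(ltW p0)//; have := e_gt0; lra.
apply: (@le_trans _ _ (\int[mu]_x (g x)%:E)%E).
  by apply: ge0_subset_integral => // x _; rewrite lee_fin.
rewrite /g; under eq_integral do rewrite EFinM.
rewrite ge0_integralZl//.
- rewrite integralT_gauss_exp ?EFinM//.
  by rewrite mulr_gt0//; have := dd_le; have := i_gt0; lra.
- by apply/measurable_EFinP; exact: mq.
- by move=> x _; rewrite lee_fin expR_ge0.
Qed.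

(** The effect of moving along the approximate least favourable direction on the
    operator at other parameter values; it only enters the lower bound. *)
Definition shift_noise x : R :=
  Num.sqrt n%:R * (2 * eps n) * `|W (Kt (x, gamman n) - K theta0 (gamman n)) w|.

Let mzeta : measurable_fun setT (shift_noise : measurableTypeR R -> R).
Proof.
apply: measurable_funM => //; apply: measurableT_comp => //.
exact: (measurable_fun_pair1 w (measurable_shift_increment n)).
Qed.

Let zeta_ge0 x : 0 <= shift_noise x.
Proof. by rewrite mulr_ge0// mulr_ge0 ?sqrtr_ge0// mulr_ge0. Qed.

Local Notation core := ([set x | `|x - theta0| <= L / Num.sqrt n%:R] : set (measurableTypeR R)).

Let n_i : 0 < n%:R * i. Proof. exact: mulr_gt0. Qed.

Let q_le x : `|W v w| <= C -> q x <= expR (C ^+ 2 / (2 * i)).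
Proof.
move=> WC; rewrite ler_expR; set t := x - theta0; set b := W v w.
have i0 : i != 0 by rewrite gt_eqF.
have nN0 : n%:R != 0 :> R by rewrite gt_eqF.
have s2 : Num.sqrt n%:R ^+ 2 = n%:R :> R by rewrite sqr_sqrtr.
have h1 : Num.sqrt n%:R * b * t - n%:R * i * t ^+ 2 / 2 <= b ^+ 2 / (2 * i).
  rewrite -subr_ge0.
  have -> : b ^+ 2 / (2 * i) - (Num.sqrt n%:R * b * t - n%:R * i * t ^+ 2 / 2) =
      (b - i * (Num.sqrt n%:R * t)) ^+ 2 / (2 * i).
    by move: s2; move: (Num.sqrt n%:R) => s <-; field.
  by rewrite divr_ge0 ?sqr_ge0// mulr_ge0// ltW.
apply: le_trans h1 _; rewrite ler_wpM2r ?invr_ge0 ?mulr_ge0 ?(ltW i_gt0)//.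
by rewrite -[leLHS]real_normK ?num_real// lerXn2r ?nnegrE// (le_trans _ WC).
Qed.

(** On [core] the error terms cost a factor [1 - e], and [exp (- z) >= 1 - z]
    reduces the noise of the shift to its integral. *)
Let core_integral (F : set (measurableTypeR R)) (Nf : R) : measurable F ->
  0 <= L -> L / Num.sqrt n%:R < eps n -> 0 <= dd ->
  `|W v w| <= C -> 1 - e <= expR (- (dd * (1 + L ^+ 2))) ->
  (\int[pi_theta]_(x in core) (shift_noise x)%:E
    <= (e * p theta0 * Num.sqrt (pi *+ 2 / (n%:R * i)) / expR (C ^+ 2 / (2 * i)))%:E)%E ->
  ((Z n w * Nf)%:E <= \int[mu]_(x in F `&` core) (q x)%:E)%E ->
  ((((1 - e) ^+ 2 * p theta0 * Nf - e * p theta0) * Z n w)%:E <=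
   \int[pi_theta]_(x in F `&` core)
     (q x * expR (- c * (1 + n%:R * (x - theta0) ^+ 2)) * expR (- shift_noise x) *
      expR (- eta n * (1 + n%:R * (x - theta0) ^+ 2)))%:E)%E.
Proof.
move=> mF L0 Leps dd0 WC dL zeta_le Nf_le.
have mcore : measurable core.
  apply: measurable_setT_ler => //; apply: measurableT_comp => //; exact: measurable_funB.
have mFc : measurable (F `&` core) by exact: measurableI.
have mez : measurable_fun setT ((fun x => expR (- shift_noise x)) : measurableTypeR R -> R).
  by apply: measurableT_comp => //; exact: measurableT_comp.
have mJ := measurable_funM (measurable_funM (measurable_funM (mq (n%:R * i) (Num.sqrt n%:R * W v w)) (mexp (- c))) mez) (mexp (- eta n)).
pose g x := q x * expR (- c * (1 + n%:R * (x - theta0) ^+ 2)) * expR (- shift_noise x) *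
  expR (- eta n * (1 + n%:R * (x - theta0) ^+ 2)).
pose J := (\int[pi_theta]_(x in F `&` core) (g x)%:E)%E.
rewrite -/J.
have g0 x : 0 <= g x by rewrite !mulr_ge0// expR_ge0.
have q0 x : 0 <= q x by exact: expR_ge0.
have e1 : 0 <= 1 - e by rewrite subr_ge0.
have mqE : measurable_fun setT (fun x : measurableTypeR R => (q x)%:E).
  by apply/measurable_EFinP; exact: mq.
have mqz : measurable_fun setT (fun x : measurableTypeR R => (q x * shift_noise x)%:E).
  by apply/measurable_EFinP; apply: measurable_funM => //; exact: mq.
have mgE : measurable_fun setT (fun x : measurableTypeR R => (g x)%:E) by exact/measurable_EFinP.
have pw x : core x -> (1 - e) * q x <= g x + q x * shift_noise x.
  move=> xc; have nt : n%:R * (x - theta0) ^+ 2 <= L ^+ 2.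
    have sn : 0 < Num.sqrt n%:R :> R by rewrite sqrtr_gt0.
    have : Num.sqrt n%:R * `|x - theta0| <= L by rewrite mulrC -ler_pdivlMr.
    move=> h; have -> : n%:R * (x - theta0) ^+ 2 = (Num.sqrt n%:R * `|x - theta0|) ^+ 2.
      by rewrite exprMn sqr_sqrtr// real_normK ?num_real.
    by rewrite lerXn2r ?nnegrE// mulr_ge0// ltW.
  have z0 := zeta_ge0 x; set z := shift_noise x in z0 *.
  have -> : g x = q x * (expR (- (c + eta n) * (1 + n%:R * (x - theta0) ^+ 2)) * expR (- z)).
    by rewrite /g -/z -!mulrA; congr (_ * _); rewrite -!expRD; congr expR; ring.
  have nt0 : 0 <= n%:R * (x - theta0) ^+ 2 by rewrite mulr_ge0// sqr_ge0.
  have E1 : 1 - e <= expR (- (c + eta n) * (1 + n%:R * (x - theta0) ^+ 2)).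
    apply: le_trans dL _; rewrite ler_expR mulNr lerN2.
    apply: (@le_trans _ _ (dd * (1 + n%:R * (x - theta0) ^+ 2))).
      by rewrite ler_wpM2r// addr_ge0.
    by rewrite ler_wpM2l// lerD2l.
  have E2 : 1 - z <= expR (- z) by apply: expR_ge1Dx.
  rewrite mulrC -mulrDr ler_wpM2l//.
  have := expR_ge0 (- z).
  have [z1|z1] := leP z 1; last first.
    have : 0 <= expR (- (c + eta n) * (1 + n%:R * (x - theta0) ^+ 2)) * expR (- z).
      by rewrite mulr_ge0// expR_ge0.
    by have := e_gt0; lra.
  have : (1 - e) * (1 - z) <= expR (- (c + eta n) * (1 + n%:R * (x - theta0) ^+ 2)) * expR (- z).
    by rewrite ler_pM// subr_ge0.
  have : 0 <= e * z by rewrite mulr_ge0// ltW.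
  lra.
have core_re x : (F `&` core) x -> `|x - theta0| < re.
  by move=> [_ xc]; apply: le_lt_trans xc (lt_le_trans Leps eps_re).
have h1 : (((1 - e) ^+ 2 * p theta0 * Nf * Z n w)%:E <=
    (1 - e)%:E * \int[pi_theta]_(x in F `&` core) (q x)%:E)%E.
  have -> : (1 - e) ^+ 2 * p theta0 * Nf * Z n w = (1 - e) * ((1 - e) * p theta0 * (Z n w * Nf)) by ring.
  rewrite EFinM; apply: lee_wpmul2l; first by rewrite lee_fin.
  apply: le_trans (prior_le mFc core_re (mq _ _) q0).1; rewrite EFinM; apply: lee_wpmul2l => //.
  by rewrite lee_fin mulr_ge0// ltW.
have h2 : ((1 - e)%:E * \int[pi_theta]_(x in F `&` core) (q x)%:E <=
    J + \int[pi_theta]_(x in F `&` core) (q x * shift_noise x)%:E)%E.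
  rewrite -ge0_integralZl//; last 2 first.
  - exact: measurable_funTS.
  - by move=> x _; rewrite lee_fin.
  rewrite /J -ge0_integralD//; last 4 first.
  - by move=> x _; rewrite lee_fin.
  - exact: measurable_funTS.
  - by move=> x _; rewrite lee_fin mulr_ge0.
  - exact: measurable_funTS.
  apply: ge0_le_integral => //.
  - by move=> x _; rewrite -EFinM lee_fin mulr_ge0.
  - by apply: measurable_funeM; exact: measurable_funTS.
  - by apply: emeasurable_funD; exact: measurable_funTS.
  by move=> x [_ xc]; rewrite -EFinM -EFinD lee_fin; exact: pw.
set s := Num.sqrt (_ / (_ * i)) in zeta_le.
have sZ : s <= Z n w.
  rewrite /gauss_mass -/s; set a := expR _.
  have a1 : 1 <= a.
    by rewrite -[leLHS]expR0 ler_expR divr_ge0 ?sqr_ge0// mulr_ge0// ltW.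
  by rewrite -[leLHS]mulr1; apply: ler_wpM2l => //; exact: sqrtr_ge0.
have h3 : (\int[pi_theta]_(x in F `&` core) (q x * shift_noise x)%:E <= (e * p theta0 * s)%:E)%E.
  apply: (@le_trans _ _ ((expR (C ^+ 2 / (2 * i)))%:E * \int[pi_theta]_(x in core) (shift_noise x)%:E)%E).
    rewrite -ge0_integralZl//; last 2 first.
    - by apply: measurable_funTS; exact/measurable_EFinP.
    - by move=> x _; rewrite lee_fin.
    apply: (@le_trans _ _ (\int[pi_theta]_(x in core) (q x * shift_noise x)%:E)%E).
      apply: ge0_subset_integral => //; first exact: measurable_funTS.
      by move=> x _; rewrite lee_fin mulr_ge0.
    apply: ge0_le_integral => //.
    - by move=> x _; rewrite lee_fin mulr_ge0.
    - exact: measurable_funTS.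
    - by apply: measurable_funeM; apply: measurable_funTS; exact/measurable_EFinP.
    by move=> x _; rewrite -EFinM lee_fin ler_wpM2r// q_le.
  apply: le_trans (lee_wpmul2l _ zeta_le) _; first by rewrite lee_fin expR_ge0.
  by rewrite -EFinM lee_fin mulrC divfK// gt_eqF// expR_gt0.
have J0 : (0 <= J)%E by apply: integral_ge0 => x _; rewrite lee_fin.
have := le_trans h1 (le_trans h2 (leeD2l J h3)).
move: J J0 {h1 h2} => [j| |]// _; rewrite ?leey// -EFinD !lee_fin.
have : e * p theta0 * s <= e * p theta0 * Z n w by rewrite ler_wpM2l// mulr_ge0// ltW.
lra.
Qed.

(** The same separation from below. The parameter is restricted to [core], which
    carries almost all of the Gaussian integral and has length of order
    [n^(-1/2)], so that the noise of the shift can be bounded in the mean. *)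
Lemma lower_mass (F : set (measurableTypeR R)) (Nf : R) : measurable F ->
  0 <= L -> L / Num.sqrt n%:R < eps n -> 0 <= dd ->
  `|W v w| <= C -> 1 - e <= expR (- (dd * (1 + L ^+ 2))) ->
  {ae Pi, forall z, near0 n z -> As n (shift n z.1 z.2) ->
    `|diff n w z| <= bound n del (2 * eps n) w z} ->
  (\int[pi_theta]_(x in core) (shift_noise x)%:E
    <= (e * p theta0 * Num.sqrt (pi *+ 2 / (n%:R * i)) / expR (C ^+ 2 / (2 * i)))%:E)%E ->
  ((Z n w * Nf)%:E <= \int[mu]_(x in F `&` core) (q x)%:E)%E ->
  ((((1 - e) ^+ 2 * p theta0 * Nf - e * p theta0) * Z n w)%:E
    * \int[pi_f]_(f in As n `\` B n) (l0 n w f)%:E <= mass n w (F `*` setT))%E.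
Proof.
move=> mF L0 Leps dd0 WC dL aeb zeta_le Nf_le.
have mcore : measurable core.
  apply: measurable_setT_ler => //; apply: measurableT_comp => //; exact: measurable_funB.
have mFc : measurable (F `&` core) by exact: measurableI.
have := likelihood_lower (m1 := pi_theta) (m2 := pi_f)
  (L := fun z => lratio W n v0 (Kt z) w) (L0 := fun f : borel H1 => l0 n w f)
  (sh := fun x f => shift n x f)
  (phi := fun x => q x * expR (- c * (1 + n%:R * (x - theta0) ^+ 2)) * expR (- shift_noise x))
  (psi := fun x => expR (- eta n * (1 + n%:R * (x - theta0) ^+ 2)))
  (U := F `&` core) (A' := As n) (B := B n) ml1 (fun z => lratio_ge0 _ _ _ _ _) ml0
  (fun f => lratio_ge0 _ _ _ _ _) (measurable_shift n).
have mez : measurable_fun setT ((fun x => expR (- shift_noise x)) : measurableTypeR R -> R).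
  by apply: measurableT_comp => //; exact: measurableT_comp.
move/(_ (measurable_funM (measurable_funM (mq _ _) (mexp _)) mez)).
move/(_ (fun x => mulr_ge0 (mulr_ge0 (expR_ge0 _) (expR_ge0 _)) (expR_ge0 _)) (mexp _)
  (fun x => expR_gt0 _) mFc (measurable_shifted_functions n) (mB n)).
move/(_ _ _) => low; apply: le_trans (le_trans (low _ _) _).
- apply: lee_wpmul2r; first by apply: integral_ge0 => f _; rewrite lee_fin lratio_ge0.
  exact: core_integral.
- apply: filterS aeb => z h [zF zc] zA.
  have /h/(_ zA) : near0 n z by split => //; exact: le_lt_trans Leps.
  rewrite /diff /bound driftE => h1.
  move: h1; rewrite ler_norml => /andP[h1 _].
  rewrite /gauss_exp /lratio /shift_noise -!expRD ler_expR; lra.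
- move=> x u [xF xc] mu_ u0; rewrite mulNr; apply: tr_low => //; exact: le_lt_trans Leps.
- apply: ge0_subset_integral => //.
  + by apply: measurableX => //.
  + by apply: measurableX.
  + exact: measurable_funTS.
  + by move=> z [[? _] _]; split.
Qed.

Let A2 : set (measurableTypeR R * borel H1) := [set q | `|Kdot theta0 (q.2 - f0)| < xi n].
Let A3 : set (measurableTypeR R * borel H1) := [set q | normH q.2 < M].

Let mA2 : measurable (A2 `&` (Theta `*` H)).
Proof.
have -> : A2 `&` (Theta `*` H) =
   Theta `*` (H `&` [set f : borel H1 | `|Kdot theta0 ((f : H1) - f0)| < xi n]).
  by apply/seteqP; split => z /=; [move=> [? [? ?]]|move=> [? [? ?]]].
apply: measurableX => //; exact: measurable_set_ltr.
Qed.

Let mA3 : measurable (A3 `&` (Theta `*` H)).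
Proof.
have -> : A3 `&` (Theta `*` H) = Theta `*` (H `&` [set f : borel H1 | normH f < M]).
  by apply/seteqP; split => z /=; [move=> [? [? ?]]|move=> [? [? ?]]].
apply: measurableX => //; exact: measurable_set_ltr.
Qed.

Hypotheses (mass_pos : (0 < mass n w setT)%E) (mass_fin : (mass n w setT < +oo)%E)
  (post1 : 1 - post n w (A1 n) <= e) (post2 : 1 - post n w A2 <= e)
  (post3 : 1 - post n w A3 <= e)
  (massB : (mass n w (setT `*` B n) <= e%:E * mass n w setT)%E).

Let mA : measurable (A n). Proof. exact: measurable_local_functions. Qed.

Let mwinA : measurable (win `*` (A n `\` B n)).
Proof. by apply: measurableX; [exact: measurable_near | exact: measurableD]. Qed.

Let mass_setU (X Y : set (measurableTypeR R * borel H1)) : measurable X -> measurable Y ->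
  (mass n w (X `|` Y) <= mass n w X + mass n w Y)%E.
Proof. by move=> mX mY; apply: ge0_integral_setU_le. Qed.

(** Three assumed concentrations and the negligible integral over [B n] leave
    little outside the set to which the expansion applies. *)
Lemma mass_concentrated :
  ((1 - 4 * e)%:E * mass n w setT <= mass n w (win `*` (A n `\` B n)))%E.
Proof.
have m1 : measurable (A1 n `&` (Theta `*` H)) by exact: measurableI.
have n1 := missing n_gt0 mass_pos mass_fin m1 post1.
have n2 := missing n_gt0 mass_pos mass_fin mA2 post2.
have n3 := missing n_gt0 mass_pos mass_fin mA3 post3.
have := massC n w mwinA.
have : (mass n w (~` (win `*` (A n `\` B n))) <= (4 * e)%:E * mass n w setT)%E.
  pose X := (~` (A1 n `&` (Theta `*` H)) `|` ~` (A2 `&` (Theta `*` H)))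
     `|` (~` (A3 `&` (Theta `*` H)) `|` setT `*` B n).
  have mX1 := measurableU _ _ (measurableC m1) (measurableC mA2).
  have mTB : measurable ((setT : set (measurableTypeR R)) `*` B n) by exact: measurableX.
  have mX2 := measurableU _ _ (measurableC mA3) mTB.
  apply: (@le_trans _ _ (mass n w X)).
    apply: ge0_subset_integral => //; [exact: measurableC|exact: measurableU|exact: measurable_funTS|].
    move=> z; apply: contra_notP => /not_orP[/not_orP[/contrapT[z1 [zT zH]] /contrapT[z2 _]]].
    move=> /not_orP[/contrapT[z3 _] zB].
    have [zw _] := A1_near z1; split => //; split; last by move=> Bz; apply: zB; split.
    split => //; apply: le_lt_trans z1; by rewrite lerDr.
  apply: le_trans (mass_setU mX1 mX2) _.
  apply: le_trans (leeD (mass_setU (measurableC m1) (measurableC mA2)) (mass_setU (measurableC mA3) mTB)) _.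
  apply: le_trans (leeD (leeD n1 n2) (leeD n3 massB)) _.
  move: mass_fin mass_pos; case: (mass n w setT) => [D| |]// _ _.
  by rewrite -!EFinM -!EFinD lee_fin; lra.
have := mass_ge0 n w (~` (win `*` (A n `\` B n))).
have := mass_ge0 n w (win `*` (A n `\` B n)).
move: mass_fin mass_pos.
case: (mass n w setT) => [D| |]// _ _.
case: (mass n w (win `*` _)) => [x| |]//; case: (mass n w _) => [y| |]//.
rewrite -EFinD -!EFinM !lee_fin => ? ? ? [] ?; lra.
Qed.

Local Notation I := (\int[pi_f]_(f in As n) (l0 n w f)%:E)%E.
Local Notation IB := (\int[pi_f]_(f in B n) (l0 n w f)%:E)%E.
Local Notation tail := [set x : R | L / Num.sqrt n%:R < `|x - theta0|].
Local Notation target := (normal_prob (theta0 + Num.sqrt n%:R * W v w / (n%:R * i))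
  (Num.sqrt (n%:R * i)^-1) : set (measurableTypeR R) -> \bar R).

Hypotheses (I_fin : (I < +oo)%E) (L_ge0 : 0 <= L) (Leps : L / Num.sqrt n%:R < eps n)
  (dd_ge0 : 0 <= dd) (WC : `|W v w| <= C)
  (dL : 1 - e <= expR (- (dd * (1 + L ^+ 2))))
  (tilt : expR dd * gauss_mass (n%:R * (i - 2 * dd)) (Num.sqrt n%:R * W v w) <= (1 + e) * Z n w)
  (target_tail : (target tail <= e%:E)%E)
  (aeU : {ae Pi, forall z, near0 n z -> (setT `*` A n) z -> `|diff n w z| <= bound n del 0 w z})
  (aeL : {ae Pi, forall z, near0 n z -> As n (shift n z.1 z.2) ->
    `|diff n w z| <= bound n del (2 * eps n) w z})
  (zeta_le : (\int[pi_theta]_(x in core) (shift_noise x)%:E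
    <= (e * p theta0 * Num.sqrt (pi *+ 2 / (n%:R * i)) / expR (C ^+ 2 / (2 * i)))%:E)%E)
  (e_small : e <= 20^-1)
  (IB_le : (IB <= (expR (- (5 / 2 * (n%:R * eps n ^+ 2))))%:E)%E)
  (mass_ge : ((expR (- (2 * (n%:R * eps n ^+ 2))))%:E <= mass n w setT)%E)
  (rate_large : expR (- (n%:R * eps n ^+ 2 / 2)) *
     ((1 + e) ^+ 2 * p theta0 * (Num.sqrt (pi *+ 2 / i) * expR (C ^+ 2 / (2 * i))))
     <= e * (1 - 4 * e)).

Let Z_gt0 : 0 < Z n w. Proof. exact: gauss_mass_gt0. Qed.

Let Z_le : Z n w <= Num.sqrt (pi *+ 2 / i) * expR (C ^+ 2 / (2 * i)).
Proof.
have i2 : 0 < 2 * i by rewrite mulr_gt0.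
rewrite /gauss_mass; apply: ler_pM; rewrite ?sqrtr_ge0 ?expR_ge0//.
  rewrite ler_wsqrtr// ler_wpM2l//; first by rewrite mulrn_wge0// pi_ge0.
  by rewrite lef_pV2 ?posrE// ler_peMl ?(ltW i_gt0)// ler1n.
rewrite ler_expR exprMn sqr_sqrtr//.
have -> : n%:R * W v w ^+ 2 / (2 * (n%:R * i)) = W v w ^+ 2 / (2 * i).
  by field; rewrite !gt_eqF.
rewrite ler_wpM2r ?invr_ge0 ?(ltW i2)//.
by rewrite -[leLHS]real_normK ?num_real// lerXn2r ?nnegrE// (le_trans _ WC).
Qed.

Let upper : ((1 - 4 * e)%:E * mass n w setT <= ((1 + e) ^+ 2 * p theta0 * Z n w)%:E * I)%E.
Proof.
apply: le_trans mass_concentrated _; apply: le_trans (upper_mass aeU) _.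
apply: lee_wpmul2r; first by apply: integral_ge0 => f _; rewrite lee_fin lratio_ge0.
have -> : (1 + e) ^+ 2 * p theta0 * Z n w = (1 + e) * p theta0 * ((1 + e) * Z n w) by ring.
by rewrite lee_fin ler_wpM2l// mulr_ge0 ?(ltW p0)//; have := e_gt0; lra.
Qed.

Let I_ge0 : (0 <= I)%E.
Proof. by apply: integral_ge0 => f _; rewrite lee_fin lratio_ge0. Qed.

Let IB_small : (IB <= e%:E * I)%E.
Proof.
apply: le_trans IB_le _; move: upper mass_ge I_ge0 I_fin.
move: mass_pos mass_fin; case: (mass n w setT) => [D| |]// _ _.
case: I => [j| |]// h1 h2 _ _; move: h1 h2; rewrite -!EFinM !lee_fin => h1 h2.
have ep := e_gt0; have rl := rate_large; have zl := Z_le.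
set a := n%:R * eps n ^+ 2 in h2 rl *.
have c0 : 0 < (1 + e) ^+ 2 * p theta0 by rewrite mulr_gt0// exprn_gt0//; lra.
set Q := _ * expR _ in zl rl.
have Q0 : 0 < Q by apply: lt_le_trans zl.
have E0 := expR_gt0 (- (2 * a)).
have j0 : 0 < j.
  rewrite ltNge; apply/negP => j0.
  have : (1 + e) ^+ 2 * p theta0 * Z n w * j <= 0 
    by apply: mulr_ge0_le0 => //; apply: mulr_ge0; exact: ltW.
  have : 0 < (1 - 4 * e) * D by rewrite mulr_gt0//; have := e_small; lra.
  lra.
have h3 : (1 - 4 * e) * expR (- (2 * a)) <= (1 + e) ^+ 2 * p theta0 * Q * j.
  apply: (@le_trans _ _ ((1 - 4 * e) * D)).
    by rewrite ler_wpM2l//; have := e_small; lra.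
  apply: le_trans h1 _; rewrite ler_wpM2r ?(ltW j0)// ler_wpM2l// ltW//.
rewrite -(ler_pM2r (mulr_gt0 c0 Q0)).
have -> : expR (- (5 / 2 * a)) = expR (- (a / 2)) * expR (- (2 * a)).
  by rewrite -expRD; congr expR; field.
apply: (@le_trans _ _ (e * (1 - 4 * e) * expR (- (2 * a)))).
  by rewrite mulrAC ler_wpM2r ?(ltW E0).
have := ler_wpM2l (ltW ep) h3; lra.
Qed.

Let I_le : ((1 - e)%:E * I <= \int[pi_f]_(f in As n `\` B n) (l0 n w f)%:E)%E.
Proof.
have mAs := measurable_shifted_functions n; have mAB := measurableD mAs (mB n).
have ml0E : measurable_fun setT (fun f : borel H1 => (l0 n w f)%:E) by exact/measurable_EFinP.
have l00 f : (0 <= (l0 n w f)%:E)%E by rewrite lee_fin lratio_ge0.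
have h : (I <= \int[pi_f]_(f in As n `\` B n) (l0 n w f)%:E + IB)%E.
  apply: le_trans (ge0_integral_setU_le pi_f mAB (mB n) ml0E l00).
  apply: ge0_subset_integral => //; [exact: measurableU|exact: measurable_funTS|].
  by move=> f Af; have [Bf|Bf] := pselect (B n f); [right|left; split].
have := le_trans h (leeD2l _ IB_small).
have J0 : (0 <= \int[pi_f]_(f in As n `\` B n) (l0 n w f)%:E)%E by apply: integral_ge0.
move: J0 I_ge0 I_fin; move: I => [j| |]//.
move: (\int[pi_f]_(f in As n `\` B n) (l0 n w f)%:E)%E => [x| |]//=; rewrite ?leey//.
by rewrite -!EFinM -EFinD !lee_fin; lra.
Qed.

(** The integral over the functions is a common factor of the upper bound for the
    denominator and the lower bound for the numerator of Bayes' formula, and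
    cancels; what remains is the normal probability. *)
Lemma posterior_lower (F : set (measurableTypeR R)) : measurable F ->
  fine (target F) - 11 * e <= post n w (F `*` setT).
Proof.
move=> mF; have mFT : measurable (F `*` (setT : set (borel H1))) by exact: measurableX.
have NF1 : fine (target F) <= 1.
  by rewrite -lee_fin fineK ?fin_num_measure// probability_le1.
have ep := e_gt0; have es := e_small.
have mcore : measurable core.
  apply: measurable_setT_ler => //; apply: measurableT_comp => //; exact: measurable_funB.
have mtail : measurable tail.
  apply: measurable_setT_ltr => //; apply: measurableT_comp => //; exact: measurable_funB.
set a := fine (target F) in NF1 *.
apply: (posterior_ge sepH2 mTheta mH mN contK lipK pi_Theta pi_fH isoW n_gt0 mass_pos mass_fin mFT).
have [N11|N11] := leP a (11 * e).
  apply: (@le_trans _ _ 0%E); last exact: mass_ge0.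
  by rewrite mule_le0_ge0 ?lee_fin ?subr_le0// ltW.
have Nf_le : ((Z n w * (a - e))%:E <= \int[mu]_(x in F `&` core) (q x)%:E)%E.
  rewrite integral_gauss_exp//; last exact: measurableI.
  rewrite EFinM; apply: lee_wpmul2l; first by rewrite lee_fin ltW.
  have h : (target F <= target (F `&` core) + e%:E)%E.
    apply: (@le_trans _ _ (target (F `&` core) + target tail)%E); last exact: leeD2l.
    apply: le_trans (measureU2 _ (measurableI _ _ mF mcore) mtail).
    apply: le_measure; rewrite ?inE//; first by apply: measurableU => //; exact: measurableI.
    by move=> x Fx; have [xL|xL] := leP `|x - theta0| (L / Num.sqrt n%:R); [left|right].
  move: h; have fc : target (F `&` core) \is a fin_num.
    by rewrite fin_num_measure//; exact: measurableI.
  have fF : target F \is a fin_num by rewrite fin_num_measure.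
  by rewrite /a -{1}(fineK fF) -(fineK fc) -EFinD !lee_fin; lra.
have low := lower_mass mF L_ge0 Leps dd_ge0 WC dL aeL zeta_le Nf_le.
apply: le_trans low.
have J0 : (0 <= \int[pi_f]_(f in As n `\` B n) (l0 n w f)%:E)%E.
  by apply: integral_ge0 => f _; rewrite lee_fin lratio_ge0.
have I1 := I_le; have U1 := upper.
set X := ((1 - e) ^+ 2 * p theta0 * (a - e) - e * p theta0) * Z n w.
(* The normal probability reduced by the three losses of the numerator. *)
pose y := (1 - e) ^+ 2 * (a - e) - e.
have XE : X = p theta0 * y * Z n w by rewrite /X /y; ring.
have e2 := sqr_ge0 e.
have Ne : (2 * e) * (a - e) <= 2 * e by rewrite ler_piMr//; lra.
have Ne2 : 0 <= e ^+ 2 * (a - e) by rewrite mulr_ge0//; lra.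
have yN : a - 4 * e <= y by rewrite /y; lra.
have y1 : y <= 1.
  have : (1 - e) ^+ 2 <= 1 by rewrite exprn_ile1 ?subr_ge0// gerBl ltW.
  move/(ler_wpM2r (_ : 0 <= a - e)) => /(_ ltac:(lra)).
  by rewrite /y; lra.
have y0 : 0 < y by lra.
have X0 : 0 < X by rewrite XE; apply: mulr_gt0 => //; exact: mulr_gt0.
apply: (@le_trans _ _ (X%:E * ((1 - e)%:E * I))%E); last by rewrite lee_pmul2l ?lte_fin//.
move: I1 U1 I_ge0 I_fin => _ + + +; move: I => [j| |]//.
move: mass_pos mass_fin; case: (mass n w setT) => [D| |]// D0 _.
rewrite lte_fin in D0.
rewrite -!EFinM !lee_fin => U1 j0 _.
have c1 : 0 < (1 + e) ^+ 2 by rewrite exprn_gt0//; lra.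
rewrite XE -(ler_pM2l c1).
have -> : (1 + e) ^+ 2 * (p theta0 * y * Z n w * ((1 - e) * j)) =
   y * (1 - e) * ((1 + e) ^+ 2 * p theta0 * Z n w * j) by ring.
apply: (@le_trans _ _ (y * (1 - e) * ((1 - 4 * e) * D))); last first.
  by rewrite ler_wpM2l// mulr_ge0 ?(ltW y0)//; lra.
rewrite !mulrA ler_wpM2r ?(ltW D0)//.
have k : (1 + e) ^+ 2 * (1 - 7 * e) <= (1 - e) * (1 - 4 * e).
  have e3 : 0 <= e ^+ 3 by rewrite exprn_ge0// ltW.
  rewrite -subr_ge0.
  have -> : (1 - e) * (1 - 4 * e) - (1 + e) ^+ 2 * (1 - 7 * e) = 17 * e ^+ 2 + 7 * e ^+ 3 by ring.
  lra.
apply: (@le_trans _ _ ((1 + e) ^+ 2 * (y * (1 - 7 * e)))).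
  rewrite ler_wpM2l ?(ltW c1)//.
  have : 7 * e * y <= 7 * e by rewrite ler_piMr//; lra.
  lra.
by have := ler_wpM2l (ltW y0) k; lra.
Qed.

(** Both measures have mass one, so that a lower bound for all sets, used for a set
    and its complement, bounds the total variation distance. *)
Lemma tv_bound : tv_dist (fun F => post n w (F `*` setT)) (fun F => fine (target F)) <= 22 * e.
Proof.
have lowF F (mF : measurable F) := posterior_lower mF.
rewrite /tv_dist; have -> : 22 * e = 2 * (11 * e) by ring.
rewrite ler_wpM2l//; apply: ge_sup.
  by exists `|post n w (set0 `*` setT) - fine (target set0)|; exists set0.
move=> _ [F mF <-]; have mC := measurableC mF.
have mFT : measurable (F `*` (setT : set (borel H1))) by exact: measurableX.
have h1 := lowF _ mF; have := lowF _ mC.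
have -> : (~` F) `*` setT = ~` (F `*` setT) :> set (measurableTypeR R * borel H1).
  by apply/seteqP; split => z /=; [move=> [zF _] [] | move=> zF; split => // ?; apply: zF].
rewrite (posterior_setC sepH2 mTheta mH mN contK lipK pi_Theta pi_fH isoW n_gt0 mass_pos mass_fin mFT).
have -> : fine (target (~` F)) = 1 - fine (target F).
  rewrite probability_setC// fineB//.
  by rewrite fin_num_measure.
by rewrite ler_norml; move: h1; lra.
Qed.

End one_observation.

(** * The exceptional events *)

Context (contract_xi : cvg_in_prob0 P (fun n w => 1 - post n w
    [set q | `|Kdot theta0 (q.2 - f0)| < xi n]))
  (bounded : cvg_in_prob0 P (fun n w => 1 - post n w [set q | normH q.2 < M]))
  (eta0 : decreases_to0 eta) (kb0 : kb n @[n --> \oo] --> 0)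
  (err0 : err n @[n --> \oo] --> 0)
  (B_le : forall n, (0 < n)%N -> (pi_f (B n) <= (2 * expR (- (3 * n%:R * eps n ^+ 2)))%R%:E)%E).

Local Notation rate n := (n%:R * eps n ^+ 2).
Local Notation I n w := (\int[pi_f]_(f in As n) (l0 n w f)%:E)%E.
Local Notation IB n w := (\int[pi_f]_(f in B n) (l0 n w f)%:E)%E.

(** The exponential compares the integrals over exceptional sets with the lower
    bound for the denominator of Bayes' formula. *)
Lemma exp_rate_le k : 0 < k -> \forall n \near \oo, expR (- (rate n / 2)) <= k.
Proof.
move=> k0; apply: filterS (rate_diverges (2 / k)) => n nk.
rewrite expRN -[leRHS]invrK lef_pV2 ?posrE ?expR_gt0 ?invr_gt0//.
apply: le_trans (expR_ge1Dx _); apply: (@le_trans _ _ (2 / k / 2)).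
  by rewrite mulrAC divff// mul1r.
by rewrite -[leLHS]add0r lerD// ler_wpM2r.
Qed.

Let mostly_contraction (e : R) (A' : nat -> set (measurableTypeR R * borel H1)) :
  cvg_in_prob0 P (fun n w => 1 - post n w (A' n)) -> 0 < e ->
  vanishing P (fun n => [set w | ~ (1 - post n w (A' n) <= e)]).
Proof.
move=> c e0; apply: vanishing_sub (vanishing_cvg c e0); apply: nearW => n w /= /negP.
by rewrite -ltNge => /lt_le_trans; apply; exact: ler_norm.
Qed.

Let mostly_IB : vanishing P (fun n => [set w | ~ (IB n w <= (expR (- (5 / 2 * rate n)))%:E)%E]).
Proof.
have mI n : measurable_fun setT (fun w => IB n w).
  exact: (measurable_integral_lratio isoW n v0 pi_f mK0 (mB n)).
apply: (@vanishing_sub _ _ _ _ _ (fun n => [set w | ((expR (- (5 / 2 * rate n)))%:E <= IB n w)%E])).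
  by apply: nearW => n w /= /negP; rewrite -ltNge => /ltW.
apply: vanishing_markov.
- exact: mI.
- by move=> n w; apply: integral_ge0 => f _; rewrite lee_fin lratio_ge0.
- by apply: nearW => n; exact: expR_gt0.
move=> k k0; have k2 : 0 < k / 2 by rewrite divr_gt0.
apply: filterS2 (exp_rate_le k2) (nbhs_infty_gt 0) => n h n0.
have -> : (\int[P]_w IB n w = pi_f (B n))%E.
  exact: (integral_integral_lratio isoW n v0 pi_f mK0 (mB n)).
apply: le_trans (B_le n0) _; rewrite lee_fin.
have -> : - (3 * n%:R * eps n ^+ 2) = - (rate n / 2) - 5 / 2 * rate n by field.
rewrite expRD mulrA ler_wpM2r ?expR_ge0//; lra.
Qed.

Let mostly_massB : vanishing P
  (fun n => [set w | ~ (mass n w (setT `*` B n) <= (expR (- (5 / 2 * rate n)))%:E)%E]).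
Proof.
have mTB n : measurable ((setT : set (measurableTypeR R)) `*` B n) by exact: measurableX.
apply: (@vanishing_sub _ _ _ _ _ (fun n => [set w |
    ((expR (- (5 / 2 * rate n)))%:E <= mass n w (setT `*` B n))%E])).
  by apply: nearW => n w /= /negP; rewrite -ltNge => /ltW.
apply: vanishing_markov.
- by move=> n; exact: measurable_mass.
- by move=> n w; exact: mass_ge0.
- by apply: nearW => n; exact: expR_gt0.
move=> k k0; have k2 : 0 < k / 2 by rewrite divr_gt0.
apply: filterS2 (exp_rate_le k2) (nbhs_infty_gt 0) => n h n0.
rewrite mean_mass//.
have -> : (Pi (setT `*` B n) = pi_f (B n))%E.
  have e : (pi_theta setT * pi_f (B n) = pi_f (B n))%E by rewrite probability_setT mul1e.
  by rewrite -[RHS]e; apply: product_measure1E.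
apply: le_trans (B_le n0) _; rewrite lee_fin.
have -> : - (3 * n%:R * eps n ^+ 2) = - (rate n / 2) - 5 / 2 * rate n by field.
rewrite expRD mulrA ler_wpM2r ?expR_ge0//; lra.
Qed.

Let mostly_mass_ge : vanishing P
  (fun n => [set w | ~ ((expR (- (2 * rate n)))%:E <= mass n w setT)%E]).
Proof.
apply: vanishing_measurable => [n|k k0].
  rewrite (_ : [set w | _] = [set w | (mass n w setT < (expR (- (2 * rate n)))%:E)%E]); last first.
    by apply/seteqP; split => w /=; rewrite ltNge => /negP.
  rewrite -[X in measurable X]setTI; apply: emeasurable_fun_infty_o => //.
  exact: measurable_mass.
apply: filterS2 (exp_rate_le k0) (nbhs_infty_gt 0) => n h n0.
(* [3 / 2 + 1 / 64 <= 2] keeps the bound, and [3 / 2 > 1] makes its probability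
   of failure vanish. *)
have := mass_lower n0 (expR_gt0 (- (3 / 2 * rate n))).
rewrite -!expRD => h1.
apply: (@le_trans _ _ (expR (- (3 / 2 * rate n) + rate n))%:E); last first.
  by rewrite lee_fin (_ : _ + _ = - (rate n / 2))//; field.
apply: le_trans h1; apply: le_measure.
- rewrite inE (_ : [set w | _] = [set w | (mass n w setT < (expR (- (2 * rate n)))%:E)%E]); last first.
    by apply/seteqP; split => w /=; rewrite ltNge => /negP.
  rewrite -[X in measurable X]setTI; apply: emeasurable_fun_infty_o => //.
  exact: measurable_mass.
- rewrite inE -[X in measurable X]setTI; apply: emeasurable_fun_infty_o => //.
  exact: measurable_mass.
move=> w /= /negP; rewrite -ltNge => /lt_le_trans; apply; rewrite lee_fin ler_expR.
have : 0 <= rate n by rewrite mulr_ge0// sqr_ge0.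
lra.
Qed.

Let mostly_I : vanishing P (fun n => [set w | ~ (I n w < +oo)%E]).
Proof.
have mAs n := measurable_shifted_functions n.
apply: (@vanishing_sub _ _ _ _ _ (fun n => [set w | (n.+1%:R%:E <= I n w)%E])).
  by apply: nearW => n w /= /negP; rewrite -leNgt leye_eq => /eqP ->; rewrite leey.
apply: vanishing_markov.
- by move=> n; exact: (measurable_integral_lratio isoW n v0 pi_f mK0 (mAs n)).
- by move=> n w; apply: integral_ge0 => f _; rewrite lee_fin lratio_ge0.
- by apply: nearW => n; rewrite ltr0n.
move=> k k0; have [m _ mk] := near_infty_natSinv_lt (PosNum k0).
exists m => // n /mk /= /ltW nk.
have -> : (\int[P]_w I n w = pi_f (As n))%E.
  exact: (integral_integral_lratio isoW n v0 pi_f mK0 (mAs n)).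
apply: le_trans (probability_le1 _ (mAs n)) _; rewrite lee_fin.
by rewrite -ler_pdivrMr ?ltr0n// mul1r.
Qed.

Let mostly_kb (a : R) : 0 < a ->
  vanishing P (fun n => [set w | ~ (`|W (K theta0 (gamman n - gamma)) w| <= a)]).
Proof.
move=> a0; have a2 : 0 < a ^+ 2 by rewrite exprn_gt0.
apply: (@vanishing_sub _ _ _ _ _ (fun n => [set w |
    ((a ^+ 2)%:E <= (W (K theta0 (gamman n - gamma)) w ^+ 2)%:E)%E])).
  apply: nearW => n w /= /negP; rewrite -ltNge lee_fin => h.
  by rewrite -[leRHS]real_normK ?num_real// lerXn2r ?nnegrE// ltW.
apply: vanishing_markov.
- by move=> n; apply/measurable_EFinP; apply: measurable_funX; exact: measurable_noise isoW _.
- by move=> n w; rewrite lee_fin sqr_ge0.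
- exact: nearW.
move=> k k0; have ka : 0 < Num.min 1 (k * a ^+ 2) by rewrite lt_min ltr01 mulr_gt0.
have /cvgr0Pnorm_lt/(_ _ ka) := kb0; apply: filterS => n.
rewrite normr_id lt_min => /andP[k1 k2]; rewrite (noise_sqr isoW) lee_fin.
apply: le_trans (ltW k2); rewrite expr2 ler_piMr//; exact: ltW.
Qed.

Let sqrt_inv_le (L a : R) : 0 <= L -> 0 < a -> \forall n \near \oo, L / Num.sqrt n%:R <= a.
Proof.
move=> L0 a0; apply: filterS2 (nbhs_infty_gt 0) (nbhs_infty_ger ((L / a) ^+ 2)) => n n0 nL.
have n0' : 0 < n%:R :> R by rewrite ltr0n.
rewrite ler_pdivrMr ?sqrtr_gt0// mulrC -ler_pdivrMr//.
rewrite -[leLHS]ger0_norm ?divr_ge0 ?(ltW a0)// -sqrtr_sqr ler_wsqrtr//.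
Qed.

(** The noise of the shift has standard deviation of order [n^(-1/2)] on [core],
    and [core] has prior mass of the same order; their product times
    [n^(1/2) eps n] is of smaller order than [n^(-1/2)]. *)
Let mostly_zeta (e L C : R) : 0 < e -> 0 < L ->
  vanishing P (fun n => [set w | ~ (\int[pi_theta]_(x in
      ([set x | (`|x - theta0| <= L / Num.sqrt n%:R)%R] : set (measurableTypeR R)))
      (shift_noise n w x)%:E
    <= (e * p theta0 * Num.sqrt (pi *+ 2 / (n%:R * i)) / expR (C ^+ 2 / (2 * i)))%:E)%E]).
Proof.
move=> e0 L0; have p0 : 0 < p theta0 by exact: p_gt0.
pose core n : set (measurableTypeR R) := [set x | `|x - theta0| <= L / Num.sqrt n%:R].
have mcore n : measurable (core n).
  apply: measurable_setT_ler => //; apply: measurableT_comp => //; exact: measurable_funB.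
pose h n (z : measurableTypeR R * Omega) : R := shift_noise n z.2 z.1.
have mh n : measurable_fun setT (h n).
  apply: measurable_funM => //; apply: measurableT_comp => //.
  exact: measurable_shift_increment.
have h0 n z : 0 <= h n z.
  by rewrite /h /shift_noise mulr_ge0// mulr_ge0 ?sqrtr_ge0// mulr_ge0.
set Q := expR (C ^+ 2 / (2 * i)).
pose an n : R := e * p theta0 * Num.sqrt (pi *+ 2 / (n%:R * i)) / Q.
have pi2 : 0 < pi *+ 2 :> R by rewrite mulrn_wgt0// pi_gt0.
apply: (@vanishing_sub _ _ _ _ _ (fun n => [set w |
    ((an n)%:E <= \int[pi_theta]_(x in core n) (h n (x, w))%:E)%E])).
  by apply: nearW => n w /= /negP; rewrite -ltNge => /ltW.
apply: vanishing_markov.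
- by move=> n; exact: (measurable_section_integral pi_theta (mh n)).
- by move=> n w; apply: integral_ge0 => x _; rewrite lee_fin.
- apply: filterS (nbhs_infty_gt 0) => n n0.
  rewrite divr_gt0 ?expR_gt0// !mulr_gt0// sqrtr_gt0 divr_gt0// mulr_gt0// ltr0n//.
move=> k k0.
have [r' [r'0 pr]] := prior_near cptTheta mp p_gt0 pi_thetaE theta0_int p_cont.
pose Dg := D1 * Gb + 1.
have Gb0 : 0 <= Gb := le_trans (normr_ge0 _) (gamman_le 0%N).
have Dg0 : 0 < Dg by rewrite ltr_wpDl// mulr_ge0.
pose c1 := k * e * Num.sqrt (pi *+ 2 / i) / Q / (16 * Dg * L ^+ 2).
have c10 : 0 < c1.
  rewrite divr_gt0// ?mulr_gt0 ?exprn_gt0//; last by rewrite invr_gt0 expR_gt0.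
  by rewrite sqrtr_gt0 divr_gt0.
have [_ /cvgr0Pnorm_lt/(_ _ c10) e1] := eps0.
have r2 : 0 < r / 2 by rewrite divr_gt0.
have L2 : 0 <= 2 * L by rewrite mulr_ge0// ltW.
apply: filterS2 (filterI (sqrt_inv_le L2 r'0) (sqrt_inv_le (ltW L0) r2))
  (filterI e1 (nbhs_infty_gt 0)) => n [n1 n2] [en n0].
rewrite (ger0_norm (eps_ge0 n)) in en.
have n0' : 0 < n%:R :> R by rewrite ltr0n.
have sn : 0 < Num.sqrt n%:R :> R by rewrite sqrtr_gt0.
pose b := Dg * (L / Num.sqrt n%:R).
have b0 : 0 < b by rewrite mulr_gt0// divr_gt0.
have cb0 : 0 <= Num.sqrt n%:R * (2 * eps n) * b by rewrite !mulr_ge0 ?sqrtr_ge0// ltW.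
apply: le_trans (mean_integral_le pi_theta (mh n) (h0 n) (mcore n) cb0 _) _.
  move=> x xc; rewrite /h /shift_noise /=.
  under eq_integral do rewrite EFinM.
  rewrite ge0_integralZl//; last 2 first.
  - by apply/measurable_EFinP; apply: measurableT_comp => //; exact: measurable_noise isoW _.
  - by rewrite lee_fin mulr_ge0 ?sqrtr_ge0// mulr_ge0.
  rewrite [leRHS]EFinM; apply: lee_wpmul2l; first by rewrite lee_fin mulr_ge0 ?sqrtr_ge0// mulr_ge0.
  apply: (noise_abs_mean isoW b0).
  have xr : `|x - theta0| < r.
    apply: le_lt_trans xc _; apply: le_lt_trans n2 _; have := r_gt0; lra.
  rewrite total_KE//; last exact: rTheta.
  apply: le_trans (K_lipschitz subH c3_ge0 Kdot_le taylor rTheta D1_ge0 xr (Hgamman n)) _.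
  apply: (@le_trans _ _ (D1 * (L / Num.sqrt n%:R) * Gb)).
    by rewrite ler_pM ?mulr_ge0// ler_wpM2l.
  rewrite /b /Dg mulrAC mulrDl lerDl mul1r; exact: divr_ge0 (ltW L0) (ltW sn).
have pc : (pi_theta (core n) <= (4 * p theta0 * (2 * L / Num.sqrt n%:R))%R%:E)%E.
  have L2n : 0 <= 2 * L / Num.sqrt n%:R by rewrite divr_ge0// ltW.
  apply: le_trans (pr _ L2n n1); apply: le_measure; rewrite ?inE//.
    exact: measurable_near.
  move=> x /= xc; apply: le_lt_trans xc _; rewrite ltr_pM2r ?invr_gt0//; lra.
have cb0' : (0 <= (Num.sqrt n%:R * (2 * eps n) * b)%:E)%E by rewrite lee_fin.
apply: le_trans (lee_wpmul2l cb0' pc) _; rewrite -EFinM lee_fin /an.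
have -> : Num.sqrt (pi *+ 2 / (n%:R * i)) = Num.sqrt (pi *+ 2 / i) / Num.sqrt n%:R.
  rewrite (_ : _ / _ = (pi *+ 2 / i) / n%:R); last by rewrite invfM mulrAC mulrA.
  by rewrite sqrtrM ?sqrtrV// divr_ge0// ltW.
have := ltW en; rewrite /c1 ler_pdivlMr ?mulr_gt0 ?exprn_gt0// => h1.
have -> : Num.sqrt n%:R * (2 * eps n) * b * (4 * p theta0 * (2 * L / Num.sqrt n%:R)) =
    (eps n * (16 * Dg * L ^+ 2)) * (p theta0 / Num.sqrt n%:R).
  by rewrite /b; field; rewrite gt_eqF.
have -> : k * (e * p theta0 * (Num.sqrt (pi *+ 2 / i) / Num.sqrt n%:R) / Q) =
    (k * e * Num.sqrt (pi *+ 2 / i) / Q) * (p theta0 / Num.sqrt n%:R).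
  by field; rewrite !gt_eqF// expR_gt0.
by rewrite ler_wpM2r// divr_ge0// ltW.
Qed.

(** The constants are chosen in the order: the truncation [C] of the efficient
    score, the window [L] and tolerance [dd] of the Gaussian integrals, the radius
    [re] where the prior is flat, and the event [G] on which the noise has small
    oscillation. Only [G] and the truncation leave a probability that does not
    tend to zero. *)
Lemma posterior_normal (e kap : R) : 0 < e -> e <= 20^-1 -> 0 < kap ->
  rare P kap (fun n => [set w | ~ (tv_dist (fun F => post n w (F `*` setT))
    (fun F => fine (normal_prob (theta0 + Num.sqrt n%:R * W v w / (n%:R * i))
      (Num.sqrt (n%:R * i)^-1) F)) <= 22 * e)]).
Proof.
move=> e0 es kap0; have e1 : e <= 1 by lra.
(* Chebyshev's inequality needs [i <= kap / 4 * C^2]. *)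
pose C := 1 + 4 * i / kap; have ik : 0 < 4 * i / kap by rewrite divr_gt0// mulr_gt0.
have C0 : 0 < C by rewrite /C; lra.
have [L [dd [L0 dd0 ddi dL gl]]] := gauss_local i_gt0 (ltW C0) e0 e1.
have [re [re0 _ prior_le]] := prior_local cptTheta mp p_gt0 pi_thetaE theta0_int p_cont e0.
have CS0 : 0 < CS by exact: (entropy_scale_gt0 subH D2_ge0 D3_ge0 Hf0 (ltW M_gt0)).
(* Each of four error terms receives a quarter of the tolerance. *)
pose del := dd / (4 * CS); have del0 : 0 < del by rewrite divr_gt0// mulr_gt0.
have kap4 : 0 < kap / 4 by rewrite divr_gt0.
have [sig [G [sig0 mG GP modG]]] := noise_modulus isoW entropyS del0 kap4.
have dd4 : 0 < dd / 4 by rewrite divr_gt0.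
pose nice n := [/\ (0 < n)%N, eps n <= 1, eps n <= r &
  small_const normH Cs D3 f0 M * xi n / CS <= sig].
pose QU n w := nice n -> G w -> {ae Pi, forall z, near0 n z -> (setT `*` A n) z ->
   `|diff n w z| <= bound n del 0 w z}.
pose QL n w := nice n -> G w -> {ae Pi, forall z, near0 n z -> As n (shift n z.1 z.2) ->
   `|diff n w z| <= bound n del (2 * eps n) w z}.
have modG' s : S s -> normS s <= 1 -> `|s| <= sig -> P (G `&` [set w | del < `|W s w|]) = 0%E.
  by move=> Ss s1 s2; apply: modG => //; split.
have vU : vanishing P (fun n => [set w | ~ QU n w]).
  apply: vanishing_ae => n; have [[n0 e1n ern sn]|nn] := pselect (nice n); last first.
    by apply: nearW => w /nn.
  have mC : measurable ((setT : set (measurableTypeR R)) `*` A n).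
    by apply: measurableX => //; exact: measurable_local_functions.
  apply: filterS (expansion_ae mC e1n ern mG modG' sn (ltW del0) (lexx 0) _).
    by move=> w h _; exact: h.
  move=> z [zn _] [_ zA]; exists z.2, 0; split => //; rewrite ?scale0r ?addr0 ?normr0//.
  by rewrite add0r; exact: ltW.
have vL : vanishing P (fun n => [set w | ~ QL n w]).
  apply: vanishing_ae => n; have [[n0 e1n ern sn]|nn] := pselect (nice n); last first.
    by apply: nearW => w /nn.
  have mC : measurable [set z : measurableTypeR R * borel H1 | As n (shift n z.1 z.2)].
    have := measurable_shift n measurableT (measurable_shifted_functions n).
    by rewrite setTI.
  have e2n : 0 <= 2 * eps n by rewrite mulr_ge0.
  apply: filterS (expansion_ae mC e1n ern mG modG' sn (ltW del0) e2n _).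
    by move=> w h _; exact: h.
  move=> z [zn _] [q /= qe qA]; exists (shift n z.1 z.2 - ratr q *: gamman n), (ratr q - kt z); split => //.
  - by rewrite /shift; vector.
  - by rewrite subrK ltW.
  - by apply: le_trans (ler_normB _ _) _; have := ltW zn; lra.
have vD := vanishing_infinite.
pose Qoo n w := (mass n w setT < +oo)%E.
have vD' : vanishing P (fun n => [set w | ~ Qoo n w]).
  apply: vanishing_sub vD; apply: nearW => n w /= /negP; rewrite -leNgt leye_eq => /eqP.
  exact.
have all := vanishingI (vanishingI (vanishingI vU vL) (vanishingI vD' mostly_I))
  (vanishingI (vanishingI (vanishingI (mostly_contraction contract_eps e0)
     (mostly_contraction contract_xi e0)) (mostly_contraction bounded e0))
   (vanishingI (vanishingI (mostly_kb dd4) (mostly_zeta C e0 L0))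
     (vanishingI (vanishingI mostly_IB mostly_massB) mostly_mass_ge))).
have rG : rare P (kap / 4) (fun=> ~` G).
  apply: nearW => n; have -> : mu_ext P (~` G) = P (~` G) by apply: measurable_mu_extE; exact: measurableC.
  exact: GP.
have rC : rare P (kap / 4) (fun=> [set w | C < `|W v w|]).
  apply: nearW => n; have mWv := measurable_noise isoW v.
  have mC : measurable [set w | C < `|W v w|].
    by apply: measurable_setT_ltr => //; exact: measurableT_comp.
  have -> : mu_ext P [set w | C < `|W v w|] = P [set w | C < `|W v w|] by exact: measurable_mu_extE.
  have C2 : 0 < C ^+ 2 by rewrite exprn_gt0.
  have mW2 : measurable_fun setT (fun w => W v w ^+ 2) by exact: measurable_funX.
  have := markov_ge0 P mW2 (fun w => sqr_ge0 _) C2; rewrite (noise_sqr isoW) -iE -EFinM => h.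
  apply: (@le_trans _ _ (P [set w | C ^+ 2 <= W v w ^+ 2])).
    apply: le_measure; rewrite ?inE//; first exact: measurable_setT_ler.
    move=> w /= Cw; rewrite -[leRHS]real_normK ?num_real// lerXn2r ?nnegrE ?(ltW C0)//.
    exact: ltW.
  apply: le_trans h _; rewrite lee_fin mulrC ler_pdivrMr//.
  have : kap / 4 * (4 * i / kap) = i by field; rewrite gt_eqF.
  have : 0 <= (4 * i / kap) ^+ 2 by exact: sqr_ge0.
  move=> q1 q2; have : kap / 4 * (1 + 4 * i / kap) <= kap / 4 * C ^+ 2.
    by rewrite ler_wpM2l ?(ltW kap4)// /C; lra.
  lra.
have kap2 : 0 < kap / 2 by rewrite divr_gt0.
have := rareU (rareU rG rC) (all _ kap2).
rewrite (_ : kap / 4 + kap / 4 + kap / 2 = kap); last by field.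
have p0 : 0 < p theta0 by exact: p_gt0.
pose Q' := (1 + e) ^+ 2 * p theta0 * (Num.sqrt (pi *+ 2 / i) * expR (C ^+ 2 / (2 * i))).
have Q'0 : 0 < Q'.
  apply: mulr_gt0; first by apply: mulr_gt0 => //; rewrite exprn_gt0// addr_gt0.
  by rewrite mulr_gt0 ?expR_gt0// sqrtr_gt0 divr_gt0// mulrn_wgt0// pi_gt0.
have qq : 0 < e * (1 - 4 * e) / Q' by rewrite divr_gt0// mulr_gt0//; lra.
have [_ /cvgr0Pnorm_lt epsl] := eps0.
have [_ /cvgr0Pnorm_lt xil] := xi0.
have [_ /cvgr0Pnorm_lt etal] := eta0.
move/cvgr0Pnorm_lt : err0 => errl.
have sc0 : 0 <= small_const normH Cs D3 f0 M by exact: (small_const_ge0 subH Cs_ge0 D3_ge0 Hf0 (ltW M_gt0)).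
have sx0 : 0 < sig * CS / (small_const normH Cs D3 f0 M + 1) by rewrite divr_gt0 ?mulr_gt0// ltr_wpDl.
apply: rare_sub.
apply: filterS2 (filterI (filterI (filterI (epsl _ ltr01) (epsl _ r_gt0)) (filterI (epsl _ re0) (xil _ sx0)))
   (filterI (nbhs_infty_gt 0) (filterI (exp_rate_le qq) (exp_rate_le e0))))
  (filterI (filterI (etal _ dd4) (errl _ dd4)) (rate_diverges (L ^+ 2 + 1))) => n.
move=> [[[ea eb] [ec xa]] [n0 [ra rb]]] [[eta_s err_s] rL] w nbad.
apply: contrapT => /not_orP[/not_orP[/contrapT Gw /negP]]; rewrite -leNgt => WC /contrapT.
move=> [[[qU qL] [qoo qI]] [[[c1 c2] c3] [[ckb cz] [[cIB cmB] cm]]]]; apply: nbad.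
have n0' : 0 < n%:R :> R by rewrite ltr0n.
have sn : 0 < Num.sqrt n%:R :> R by rewrite sqrtr_gt0.
move: ea eb ec; rewrite !(ger0_norm (eps_ge0 n)) => ea eb ec.
have nice_n : nice n.
  split => //; [exact: ltW|exact: ltW|].
  rewrite ler_pdivrMr//; move: xa; rewrite ltr_pdivlMr ?ltr_wpDl//.
  have x0 : 0 <= xi n := le_trans (eps_ge0 n) (eps_xi n).
  rewrite (ger0_norm x0) => /ltW/(le_trans _); apply.
  by rewrite mulrDr mulr1 mulrC lerDl.
have [tl tt] := gl n%:R (W v w) theta0 n0' WC.
have Leps : L / Num.sqrt n%:R < eps n.
  rewrite ltr_pdivrMr// -(@ltr_pXn2r _ 2) ?nnegrE ?mulr_ge0 ?(ltW L0) ?sqrtr_ge0//.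
  by rewrite exprMn sqr_sqrtr// mulrC; apply: lt_le_trans rL; rewrite ltrDl.
have sE : CS * del = dd / 4 by rewrite /del; field; rewrite gt_eqF.
have etaL := le_lt_trans (ler_norm _) eta_s; have errL := le_lt_trans (ler_norm _) err_s.
apply: (tv_bound n0 e0 e1 ddi _ prior_le (ltW ec) _ qoo c1 c2 c3 _ qI (ltW L0) Leps (ltW dd0) WC
   dL tl tt (qU nice_n Gw) (qL nice_n Gw) cz es cIB cm).
- rewrite sE; apply: le_trans (lerD (lerD (lerD (ltW errL) (lexx _)) ckb) (ltW etaL)) _.
  by rewrite le_eqVlt; apply/orP; left; apply/eqP; field.
- by apply: lt_le_trans cm; rewrite lte_fin expR_gt0.
- apply: le_trans cmB (le_trans _ (lee_wpmul2l _ cm)); last by rewrite lee_fin ltW.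
  rewrite -EFinM lee_fin (_ : - (5 / 2 * _) = - (rate n / 2) - 2 * rate n); last by field.
  by rewrite expRD ler_wpM2r// expR_ge0.
- by move: ra; rewrite ler_pdivlMr.
Qed.

End posterior_asymptotics.

(** * The Bernstein-von Mises theorem *)

(** The assumed exceptional set is not known to be measurable; a measurable hull
    of at most twice the mass replaces it. *)
Lemma exists_translation_set {R : realType} {H1 : hilbertType R}
    (pi_f : probability (borel H1) R) (eps eta : nat -> R) (gamman : nat -> H1)
    (lr : nat -> R -> R -> borel H1 -> R)
    (lrE : forall n s t, (0 < n)%N -> `|s| < eps n -> `|t| < eps n ->
      is_density (shift_law pi_f (s *: gamman n))
        (shift_law pi_f ((s + t) *: gamman n)) (lr n s t))
    (prior_shift : forall n, (0 < n)%N ->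
      (mu_ext pi_f [set f | exists s t : R,
          [/\ (`|s| < eps n)%R, (`|t| < eps n)%R &
            (eta n * (1 + n%:R * t ^+ 2))%R%:E < `|lne (lr n s t f)%:E| ]]
       <= (expR (- (3 * n%:R * eps n ^+ 2)))%R%:E)%E) :
  exists B : nat -> set (borel H1), [/\ forall n, measurable (B n),
    forall n, (0 < n)%N -> (pi_f (B n) <= (2 * expR (- (3 * n%:R * eps n ^+ 2)))%R%:E)%E &
    forall n s t f, (0 < n)%N -> `|s| < eps n -> `|t| < eps n -> ~ B n f ->
      expR (- (eta n * (1 + n%:R * t ^+ 2))) <= lr n s t f <=
        expR (eta n * (1 + n%:R * t ^+ 2))].
Proof.
pose bad n := [set f | exists s t : R, [/\ (`|s| < eps n)%R, (`|t| < eps n)%R &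
            ((eta n * (1 + n%:R * t ^+ 2))%R%:E < `|lne (lr n s t f)%:E|)%E ]].
have /choice[B BP] n : exists B : set (borel H1), measurable B /\ ((0 < n)%N ->
    bad n `<=` B /\ (pi_f B <= (2 * expR (- (3 * n%:R * eps n ^+ 2)))%R%:E)%E).
  have [n0|n0] := ltnP 0 n; last by exists set0; split => //; rewrite ltnNge n0.
  have [B [mB sB Bl]] := measurable_hull (expR_gt0 (- (3 * n%:R * eps n ^+ 2))) (prior_shift n n0).
  exists B; split => //; split => //; apply: le_trans Bl _; rewrite lee_fin.
  by move: (expR _) => z; lra.
exists B; split => [n|n n0|n s t f n0 se te nB]; first by have [] := BP n.
  by have [_ /(_ n0)[]] := BP n.
apply: lne_bound; first exact: density_ge0 (lrE n s t n0 se te) f.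
rewrite leNgt; apply/negP => lt; apply: nB.
by have [_ /(_ n0)[+ _]] := BP n; apply; exists s, t.
Qed.

Lemma cvgr0_sqrt {R : realType} (u : nat -> R) :
  u n @[n --> \oo] --> 0 -> Num.sqrt (u n) @[n --> \oo] --> 0.
Proof.
move=> u0; rewrite -[X in _ --> X](@sqrtr0 R).
by apply: continuous_cvg => //; exact: sqrt_continuous.
Qed.

Theorem corollary2p3 (R : realType)
  (* spaces and operators *)
  (H1 H2 : hilbertType R) (sepH1 : separable H1) (sepH2 : separable H2)
  (Theta : set R) (cptTheta : compact Theta)
  (K : R -> {linear H1 -> H2})
  (contK : forall theta, Theta theta -> continuous (K theta))
  (H : set H1) (normH : H1 -> R) (subH : normed_subspace H normH)
  (Kdot : R -> H1 -> H2) (derK : is_theta_derivative K Kdot Theta H)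
  (* the space S *)
  (S : set H2) (normS : H2 -> R) (subS : normed_subspace S normS)
  (strongS : exists C : R, forall h, S h -> `|h| <= C * normS h)
  (KS : forall theta f, Theta theta -> H f -> S (K theta f))
  (entropyS : (entropy_integral [set h | (S h /\ normS h <= 1)%R] < +oo)%E)
  (* the priors *)
  (mH : measurable (H : set (borel H1)))
  (mnormH : measurable_fun (H : set (borel H1)) normH)
  (pi_theta : probability (measurableTypeR R) R) (p : R -> R)
  (mp : measurable_fun Theta p)
  (p_gt0 : forall theta, Theta theta -> 0 < p theta)
  (pi_thetaE : forall B : set (measurableTypeR R), measurable B ->
    pi_theta B = (\int[lebesgue_measure]_(x in B `&` Theta) (p x)%:E)%E)
  (pi_f : probability (borel H1) R) (pi_fH : pi_f H = 1%E)
  (* the noise *)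
  (d : measure_display) (Omega : measurableType d) (P : probability Omega R)
  (W : H2 -> Omega -> R) (isoW : iso_gaussian P W)
  (* the true parameter *)
  (theta0 : R) (f0 : H1) (theta0_int : interior Theta theta0) (Hf0 : H f0)
  (p_cont : {for theta0, continuous p})
  (gamma : H1) (lfd : least_favourable K Kdot H theta0 f0 gamma)
  (info_gt0 : 0 < efficient_information K Kdot theta0 f0 gamma)
  (* smoothness *)
  (D1 D2 D3 D4 : R)
  (smoothK : forall theta theta1 f, Theta theta -> Theta theta1 -> H f ->
    [/\ `|K theta f| <= D1 * `|f| /\ `|Kdot theta f| <= D1 * `|f|,
        (let v := K theta f - K theta1 f in
         S v /\ normS v <= D2 * `|theta - theta1| * normH f),
        (let v := K theta f - K theta1 f - (theta - theta1) *: Kdot theta1 f in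
         S v /\ normS v <= D3 * `|theta - theta1| ^+ 2 * normH f) &
        (let v := Kdot theta1 (f - f0) in
         S v /\ normS v <= D4 * normH (f - f0))])
  (* contraction *)
  (eps xi : nat -> R) (eps0 : decreases_to0 eps) (xi0 : decreases_to0 xi)
  (eps_xi : forall n, eps n <= xi n)
  (post := fun n w => posterior K Theta H pi_theta pi_f n
    (observation W (K theta0 f0) n w))
  (post0 := fun n w => posterior_given K H pi_f theta0 n
    (observation W (K theta0 f0) n w))
  (contract_eps : cvg_in_prob0 P (fun n w => 1 - post n w
    [set q | `|q.1 - theta0| + `|K theta0 (q.2 - f0)| < eps n]))
  (contract_xi : cvg_in_prob0 P (fun n w => 1 - post n w
    [set q | `|Kdot theta0 (q.2 - f0)| < xi n]))
  (contract0_eps : cvg_in_prob0 P (fun n w => 1 - post0 n w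
    [set f | `|K theta0 (f - f0)| < eps n]))
  (contract0_xi : cvg_in_prob0 P (fun n w => 1 - post0 n w
    [set f | `|Kdot theta0 (f - f0)| < xi n]))
  (M : R) (M_gt0 : 0 < M)
  (bounded : cvg_in_prob0 P (fun n w => 1 - post n w
    [set q | normH q.2 < M]))
  (* approximate least favourable directions *)
  (gamman : nat -> H1) (Hgamman : forall n, H (gamman n))
  (rho : nat -> R) (rho0 : decreases_to0 rho)
  (gamman_rho : forall n, `|gamman n - gamma| <= rho n)
  (* prior mass and prior shift *)
  (eta : nat -> R) (eta0 : decreases_to0 eta)
  (prior_mass : forall n, (0 < n)%N ->
    ((expR (- (n%:R * eps n ^+ 2 / 64)))%R%:E <=
     (pi_theta \x pi_f)
       [set q : measurableTypeR R * borel H1 |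
         [/\ Theta q.1, H q.2 & (`|K q.1 q.2 - K theta0 f0| <= eps n)%R]])%E)
  (* lr n s t is a version of the density of the law of f + (s + t) gamma_n
     relative to that of f + s gamma_n *)
  (lr : nat -> R -> R -> borel H1 -> R)
  (lrE : forall n s t, (0 < n)%N -> `|s| < eps n -> `|t| < eps n ->
    is_density (shift_law pi_f (s *: gamman n))
      (shift_law pi_f ((s + t) *: gamman n)) (lr n s t))
  (prior_shift : forall n, (0 < n)%N ->
    (mu_ext pi_f [set f | exists s t : R,
        [/\ (`|s| < eps n)%R, (`|t| < eps n)%R &
          (eta n * (1 + n%:R * t ^+ 2))%R%:E < `|lne (lr n s t f)%:E| ]]
     <= (expR (- (3 * n%:R * eps n ^+ 2)))%R%:E)%E)
  (* rates *)
  (rate_gamma :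
    n%:R * eps n ^+ 2 * `|K theta0 (gamman n - gamma)| @[n --> \oo] --> 0)
  (rate_xi : (n%:R * eps n ^+ 2 * xi n ^+ 2 @[n --> \oo] --> 0) \/
    (forall (f : H1) theta theta1, Theta theta -> Theta theta1 ->
      `|K theta f| = `|K theta1 f|)) :
  bernstein_von_mises K Kdot Theta H pi_theta pi_f P W theta0 f0 gamma.
Proof.
have [Cs strongS'] := strongS.
have Ns h : S h -> 0 <= normS h := fun Sh => subspace_norm_ge0 subS Sh.
have Nh f : H f -> 0 <= normH f := fun Hf => subspace_norm_ge0 subH Hf.
have sS h : S h -> `|h| <= `|Cs| * normS h.
  move=> Sh; apply: le_trans (strongS' h Sh) _.
  by rewrite ler_wpM2r ?Ns// ler_norm.
have K_le theta (f : H1) : Theta theta -> H f -> `|K theta f| <= `|D1| * `|f|.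
  move=> Tt Hf; have [[h _] _ _ _] := smoothK theta theta f Tt Tt Hf.
  by apply: le_trans h _; rewrite ler_wpM2r// ler_norm.
have Kdot_le theta (f : H1) : Theta theta -> H f -> `|Kdot theta f| <= `|D1| * `|f|.
  move=> Tt Hf; have [[_ h] _ _ _] := smoothK theta theta f Tt Tt Hf.
  by apply: le_trans h _; rewrite ler_wpM2r// ler_norm.
have K_lip theta theta1 (f : H1) : Theta theta -> Theta theta1 -> H f ->
    let v := K theta f - K theta1 f in
    S v /\ normS v <= `|D2| * `|theta - theta1| * normH f.
  move=> Tt Tt1 Hf; have [_ [Sv h] _ _] := smoothK theta theta1 f Tt Tt1 Hf.
  split=> //; apply: le_trans h _; rewrite ler_wpM2r ?Nh// ler_wpM2r// ler_norm//.
have K_tay theta theta1 (f : H1) : Theta theta -> Theta theta1 -> H f ->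
    let v := K theta f - K theta1 f - (theta - theta1) *: Kdot theta1 f in
    S v /\ normS v <= `|D3| * `|theta - theta1| ^+ 2 * normH f.
  move=> Tt Tt1 Hf; have [_ _ [Sv h] _] := smoothK theta theta1 f Tt Tt1 Hf.
  by split=> //; apply: le_trans h _; rewrite ler_wpM2r ?Nh// ler_wpM2r ?sqr_ge0// ler_norm.
have T0 : Theta theta0 := interior_subset theta0_int.
have [r r0 rT] : exists2 r, 0 < r & forall theta, `|theta - theta0| < r -> Theta theta.
  have /nbhs_ballP[r /= r0 rT] := theta0_int; exists r => // theta tr.
  by apply: rT; rewrite /ball/= distrC.
have [Hgamma orth] := lfd.
(* The approximate directions are bounded in [H1], but they need not be bounded
   in the norm of [H]. *)
pose Gb := `|gamma| + rho 0%N.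
have Gb_ge n : `|gamman n| <= Gb.
  have : `|gamman n| <= `|gamma| + `|gamman n - gamma|.
    by rewrite -{1}(subrK gamma (gamman n)) addrC; exact: ler_normD.
  move/le_trans; apply; rewrite lerD2l; apply: le_trans (gamman_rho n) _.
  exact: (rho0.1 0%N n (leq0n n)).
have eps_ge0 n : 0 <= eps n by exact: decreases_to0_ge0.
have xi_ge0 n : 0 <= xi n by exact: decreases_to0_ge0.
have [_ eps_cvg] := eps0; have [_ xi_cvg] := xi0; have [_ rho_cvg] := rho0.
pose kb n := `|K theta0 (gamman n - gamma)|.
have kb0 : kb n @[n --> \oo] --> 0.
  apply: (@squeeze_cvgr _ _ _ _ (fun=> 0) (fun n => `|D1| * rho n)).
  - apply: nearW => n; rewrite normr_ge0/=.
    apply: le_trans (K_le _ _ T0 (subspaceB subH (Hgamman n) Hgamma)) _.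
    by rewrite ler_wpM2l.
  - exact: cvg_cst.
  - by rewrite -[X in _ --> X](mulr0 `|D1|); apply: cvgMr.
pose Cu := shift_const normH `|Cs| `|D1| `|D3| f0 M Gb.
pose al n := (1 + `|D1| * Gb) * eps n.
have al0 : al n @[n --> \oo] --> 0.
  by rewrite -[X in _ --> X](mulr0 (1 + `|D1| * Gb)); apply: cvgMr.
have Cux0 : Cu * xi n @[n --> \oo] --> 0.
  by rewrite -[X in _ --> X](mulr0 Cu); apply: cvgMr.
have sqrtM2 (n : nat) (a b : R) : 0 <= a -> 0 <= b ->
    Num.sqrt (n%:R * a ^+ 2 * b ^+ 2) = Num.sqrt n%:R * a * b.
  move=> a0 b0; rewrite sqrtrM ?mulr_ge0 ?sqr_ge0// sqrtrM// !sqrtr_sqr.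
  by rewrite !ger0_norm.
have [d1 [d1_cvg cross]] : exists d1 : nat -> R, d1 n @[n --> \oo] --> 0 /\ forall n,
    Num.sqrt n%:R * al n * (Cu * xi n) <= d1 n \/
    (forall (h : H1) th th1, Theta th -> Theta th1 -> `|K th h| = `|K th1 h|) /\
      (Cu * xi n) ^+ 2 / 2 + `|D1| * Gb * (Cu * xi n) <= d1 n.
  case: rate_xi => [rx|const].
    exists (fun n => Num.sqrt n%:R * al n * (Cu * xi n)); split; last by move=> n; left.
    rewrite (_ : (fun n => _) = (fun n => (1 + `|D1| * Gb) * Cu * Num.sqrt (n%:R * eps n ^+ 2 * xi n ^+ 2))).
      rewrite -[X in _ --> X](mulr0 ((1 + `|D1| * Gb) * Cu)); apply: cvgMr.
      exact: cvgr0_sqrt.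
    by apply/funext => n; rewrite sqrtM2// /al; ring.
  exists (fun n => (Cu * xi n) ^+ 2 / 2 + `|D1| * Gb * (Cu * xi n)); split; last by move=> n; right.
  rewrite [X in _ --> X](_ : 0 = 0 * 0 / 2 + `|D1| * Gb * 0); last by rewrite !mul0r mulr0 addr0.
  by apply: cvgD; [apply: cvgMl; apply: cvgM | apply: cvgMr].
have err0 : expansion_error K normH Kdot `|Cs| `|D1| `|D3| theta0 f0 gamma M Gb
    (eps n) (xi n) n%:R (kb n) (d1 n) @[n --> \oo] --> 0.
  have sk0 : Num.sqrt n%:R * al n * kb n @[n --> \oo] --> 0.
    (* [n eps^2 kb] and [kb] tend to zero, hence so does the root of their product. *)
    rewrite (_ : (fun n => _) = (fun n => (1 + `|D1| * Gb) * Num.sqrt (n%:R * eps n ^+ 2 * kb n * kb n))).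
      rewrite -[X in _ --> X](mulr0 (1 + `|D1| * Gb)); apply: cvgMr.
      by apply: cvgr0_sqrt; rewrite -[X in _ --> X](mulr0 0); apply: cvgM.
    have kb_ge0 n : 0 <= kb n by exact: normr_ge0.
    apply/funext => n; rewrite -(mulrA _ (kb n)) -expr2 sqrtM2//.
    by rewrite /al; move: (kb n) => k; ring.
  have rate0 : shift_rate normH `|Cs| `|D1| `|D3| f0 M Gb (eps n) (xi n) (kb n) @[n --> \oo] --> 0.
    rewrite [X in _ --> X](_ : 0 = 0 + taylor_const `|Cs| `|D3| * normH f0 * 0 + 0); last by rewrite mulr0 !addr0.
    by apply: cvgD => //; apply: cvgD => //; apply: cvgMr.
  rewrite /expansion_error.
  rewrite [X in _ --> X](_ : 0 = 0 + 0 * (taylor_const `|Cs| `|D3| * normH f0) + 0 +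
      `|efficient_direction K Kdot theta0 f0 gamma| * 0 + 0 * 0); last by rewrite mulr0 !mul0r !addr0.
  apply: cvgD; last exact: cvgM.
  apply: cvgD; last exact: cvgMr.
  apply: cvgD => //; apply: cvgD => //; exact: cvgMl.
have [B [mB B_le lr_le]] := exists_translation_set lrE prior_shift.
have up n (t : R) (u : borel H1 -> R) : (0 < n)%N -> `|t| < eps n ->
    measurable_fun setT u -> (forall f, 0 <= u f) ->
    (\int[pi_f]_(f in ~` B n) (u ((f : H1) + t *: gamman n)%R)%:E
      <= (expR (eta n * (1 + n%:R * t ^+ 2)))%:E * \int[pi_f]_f (u f)%:E)%E.
  move=> n0 te; have nte : `|- t| < eps n by rewrite normrN.
  apply: (prior_translation_upper (mB n) (lrE n (- t) t n0 nte te)) => f nB.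
  by have /andP[] := lr_le n (- t) t f n0 nte te nB.
have low n (t : R) (u : borel H1 -> R) : (0 < n)%N -> `|t| < eps n ->
    measurable_fun setT u -> (forall f, 0 <= u f) ->
    ((expR (- (eta n * (1 + n%:R * t ^+ 2))))%:E * \int[pi_f]_(f in ~` B n) (u f)%:E
      <= \int[pi_f]_f (u ((f : H1) + t *: gamman n)%R)%:E)%E.
  move=> n0 te; have e0 : `|0 : R| < eps n by rewrite normr0; exact: le_lt_trans te.
  apply: (prior_translation_lower (mB n) (lrE n 0 t n0 e0 te)) => f nB.
  by have /andP[] := lr_le n 0 t f n0 e0 te nB.
apply: cvg_of_rare => e k e0 k0.
pose e' := Num.min (e / 22) 20^-1.
have e'0 : 0 < e' by rewrite lt_min divr_gt0//= invr_gt0.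
have e'1 : e' <= 20^-1 by rewrite ge_min lexx orbT.
have e'2 : 22 * e' <= e by rewrite mulrC -ler_pdivlMr// ge_min lexx.
have main := posterior_normal sepH1 sepH2 cptTheta contK subH subS entropyS (normr_ge0 Cs)
  (normr_ge0 D1) (normr_ge0 D2) (normr_ge0 D3) sS K_le Kdot_le K_lip K_tay mH mnormH mp p_gt0
  pi_thetaE pi_fH isoW theta0_int Hf0 p_cont eps0 contract_eps prior_mass r0 rT orth xi0 eps_xi
  M_gt0 Hgamman Gb_ge cross erefl info_gt0 mB up low contract_xi bounded eta0 kb0 err0 B_le
  e'0 e'1 k0.
apply: rare_sub main; apply: filterS (nbhs_infty_gt 0) => n n0 w /=.
rewrite ger0_norm ?tv_dist_ge0// => h /le_trans/(_ e'2); apply/negP; rewrite -ltNge.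
have n0' : 0 < n%:R :> R by rewrite ltr0n.
have s0 : Num.sqrt n%:R != 0 :> R by rewrite gt_eqF// sqrtr_gt0.
have i0 : `|Kdot theta0 f0 - K theta0 gamma| ^+ 2 != 0 by rewrite gt_eqF.
have tvE m m' s s' X : m = m' -> s = s' ->
    tv_dist X (fun F => fine (normal_prob m s F)) =
    tv_dist X (fun F => fine (normal_prob m' s' F)) by move=> -> ->.
apply: lt_le_trans h _; rewrite le_eqVlt; apply/orP; left; apply/eqP; apply: tvE.
  rewrite /efficient_information /efficient_direction.
  have := sqr_sqrtr (ltW n0'); move: (Num.sqrt _) s0 => q q0 <-.
  move: (`|_| ^+ 2) i0 => z z0.
  by congr (_ + _); field; rewrite q0 z0.
by rewrite [in RHS]invfM.
Qed.
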